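(* The functions $$\phi_\pm(\tau)=\tau-\frac{2\pi i}{\eta_1(\tau)\pm\sqrt{g_2(\tau)/12}}$$ are both locally one-to-one from $\mathbb{H}\setminus\mathfrak{S}$ to $\mathbb{C}\cup\{\infty\}$. For each $k\in\{1,2,3\}$, the function $$\phi_k(\tau)=\tau-\frac{6\pi i\,e_k(\tau)}{3e_k(\tau)\eta_1(\tau)+\frac{g_2(\tau)}2-3e_k(\tau)^2}$$ is locally one-to-one from $\mathbb{H}$ to $\mathbb{C}\cup\{\infty\}$.
   Context: $\mathbb{H}=\{\tau\in\mathbb{C}:\operatorname{Im}\tau>0\}$. For $\tau\in\mathbb{H}$ let $\Lambda_\tau=\mathbb{Z}+\mathbb{Z}\tau$, $\wp(z|\tau)=\frac1{z^2}+\sum_{\omega\in\Lambda_\tau\setminus\{0\}}\left(\frac1{(z-\omega)^2}-\frac1{\omega^2}\right)$, and let $\zeta(z|\tau)$ be the Weierstrass zeta function, i.e. the odd meromorphic function with $\zeta'(z|\tau)=-\wp(z|\tau)$. Put $\eta_1(\tau)=\zeta(z+1|\tau)-\zeta(z|\tau)$, $\omega_1=1$, $\omega_2=\tau$, $\omega_3=1+\tau$, $e_k(\tau)=\wp(\omega_k/2|\tau)$ for $k=1,2,3$, and $g_2(\tau)=-4(e_1e_2+e_1e_3+e_2e_3)$. $\mathfrak{S}=\left\{\frac{ae^{\pi i/3}+b}{ce^{\pi i/3}+d} : \begin{pmatrix}a&b\\c&d\end{pmatrix}\in SL(2,\mathbb{Z})\right\}$; one has $g_2(\tau)=0$ if and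 only if $\tau\in\mathfrak{S}$. $\phi_+$ and $\phi_-$ are the two branches of a single 2-valued meromorphic function on $\mathbb{H}$ whose set of branch points is $\mathfrak{S}$. Locally near a point $\tau_0\in\mathbb{H}\setminus\mathfrak{S}$ one takes a holomorphic branch of $\sqrt{g_2/12}$, and $\phi_\pm$ are then the two corresponding meromorphic functions near $\tau_0$. Meromorphic functions are viewed as maps to $\mathbb{C}\cup\{\infty\}$ (taking the value $\infty$ at poles). ''Locally one-to-one'' means that each point of the domain has a neighborhood on which the function is injective. *)

(* Defs.v *)
From Stdlib Require Export Reals ZArith List.
From Coquelicot Require Export Coquelicot.

Open Scope C_scope.

Definition upper_half_plane (tau : C) : Prop := (0 < Im tau)%R.

Definition lattice (tau w : C) : Prop :=
  exists m n : Z, w = RtoC (IZR m) + RtoC (IZR n) * tau.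

(* Unordered summation: the finite partial sums converge to [s] along the
   finite subsets of [D] directed by inclusion.  For complex terms this is
   absolute convergence, so no enumeration of [D] has to be chosen. *)
Definition is_sum_over (D : C -> Prop) (f : C -> C) (s : C) : Prop :=
  forall eps : R, (0 < eps)%R ->
  exists F0 : list C,
    (forall w, In w F0 -> D w) /\
    forall F : list C,
      NoDup F -> (forall w, In w F -> D w) -> incl F0 F ->
      (Cmod (fold_right Cplus (RtoC 0) (map f F) - s) < eps)%R.

(* Coquelicot's [iota P] is the unique element satisfying [P], when there is
   exactly one. *)
Definition the_C (P : C -> Prop) : C := iota (T := C_CompleteNormedModule) P.

Definition sum_over (D : C -> Prop) (f : C -> C) : C :=
  the_C (is_sum_over D f).

Definition wp (z tau : C) : C :=
  / (z ^ 2) +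
  sum_over (fun w => lattice tau w /\ w <> RtoC 0)
           (fun w => / ((z - w) ^ 2) - / (w ^ 2)).

(* The conditions are imposed off the lattice, the set of poles.  Meromorphy at
   the lattice points is then automatic: an antiderivative of -wp around a
   lattice point, where wp has a double pole without residue, has a simple pole
   there.  Oddness fixes the constant of integration. *)
Definition is_weierstrass_zeta (tau : C) (Z : C -> C) : Prop :=
  forall z, ~ lattice tau z ->
    Z (- z) = - Z z /\ is_derive Z z (- wp z tau).

(* The values at the (irrelevant) lattice points are junk. *)
Definition zeta (z tau : C) : C :=
  the_C (fun v => exists Z, is_weierstrass_zeta tau Z /\ Z z = v).

(* The constant value of zeta (z + 1) - zeta z. *)
Definition eta1 (tau : C) : C :=
  the_C (fun c => forall z, ~ lattice tau z ->
                    zeta (z + 1) tau - zeta z tau = c).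

(* Only the indices 1, 2, 3 are meaningful. *)
Definition omega (k : nat) (tau : C) : C :=
  match k with
  | 1%nat => RtoC 1
  | 2%nat => tau
  | _ => 1 + tau
  end.

Definition e (k : nat) (tau : C) : C := wp (omega k tau / 2) tau.

Definition g2 (tau : C) : C :=
  - 4 * (e 1 tau * e 2 tau + e 1 tau * e 3 tau + e 2 tau * e 3 tau).

(* exp (pi i / 3) *)
Definition rho : C := (cos (PI / 3), sin (PI / 3)).

Definition frak_S (tau : C) : Prop :=
  exists a b c d : Z,
    (a * d - b * c = 1)%Z /\
    tau = (RtoC (IZR a) * rho + RtoC (IZR b)) /
          (RtoC (IZR c) * rho + RtoC (IZR d)).

(* The Riemann sphere; [None] is the point at infinity. *)
Definition sphere : Type := option C.

(* tau - num / den as a point of the sphere.  In both uses below num and den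
   have no common zero: for [phi_pm] num is a nonzero constant, and for [phi_k]
   a common zero would give e_k = g2 = 0, i.e. a multiple root of
   4 x^3 - g2 x - g3.  So a zero of den is a pole. *)
Definition sub_quot (tau num den : C) : sphere :=
  if Ceq_dec den (RtoC 0) then None else Some (tau - num / den).

Definition is_sqrt_branch (U : C -> Prop) (s : C -> C) : Prop :=
  forall tau, U tau -> ex_derive s tau /\ s tau ^ 2 = g2 tau / 12.

(* The two functions attached to a branch s of sqrt (g2 / 12). *)
Definition phi_plus (s : C -> C) (tau : C) : sphere :=
  sub_quot tau (2 * PI * Ci) (eta1 tau + s tau).

Definition phi_minus (s : C -> C) (tau : C) : sphere :=
  sub_quot tau (2 * PI * Ci) (eta1 tau - s tau).

Definition phi_k (k : nat) (tau : C) : sphere :=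
  sub_quot tau (6 * PI * Ci * e k tau)
    (3 * e k tau * eta1 tau + g2 tau / 2 - 3 * e k tau ^ 2).

Definition locally_one_to_one (D : C -> Prop) (f : C -> sphere) : Prop :=
  forall tau, D tau ->
  exists V : C -> Prop, locally tau V /\
    forall x y, V x -> D x -> V y -> D y -> f x = f y -> x = y.

(* Main.v *)
Require Import Defs.
From Stdlib Require Import Lra Lia Classical Permutation.

(** Why the theorem holds.  Write each of the functions as [tau - N / D].  Its
    derivative is [W / D^2] with [W = D^2 - N' D + N D'], and where [D] vanishes
    the inverse function has derivative [- W / N^2]; so a nonvanishing [W] gives
    local injectivity on the sphere ([sub_quot_locally_injective]).  With the
    derivatives
      [2 pi i eta1' = g2 / 12 - eta1^2],
      [2 pi i e_k' = 2 e_k^2 - 2 e_k eta1 - g2 / 3]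
    ([cderiv_eta1], [cderiv_e]) one finds
      [s W = 2 s^3 + g3 / 4] for [phi_plus] and
      [W = - 3 (e_k - e_i) (e_k - e_j) (e_i - e_j)^2] for [phi_k],
    and both are nonzero because [e_1], [e_2], [e_3] are distinct.  Branches of the
    square root exist off [frak_S] because [g2] vanishes exactly there.

    The derivatives come from Eisenstein's way of summing over the lattice by rows.
    The sum of [1 / (x + m)^2] over the integers [m] is [sq x = pi^2 / sin^2 (pi x)]
    ([has_sum_sq]), hence [wp z = E2 z - eta1] with [E2 z] the sum of
    [sq (z + n tau)] and [eta1] the same sum at [z = 0] without its pole
    ([wp_eis2], [eta1_eta]).  These sums converge exponentially.  Two
    addition formulas for [sq] and the cotangent, summed over pairs of
    rows, give
      [E2^2 = E2'' / 6 + 2 eta1 E2 + 2 pi i eta1'] and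
      [2 pi i dE2/dtau = E1 E2' + E2'' / 2 - E2^2]
    ([eis2_square], [heat_equation]), where [E1 z = zeta z - eta1 z].  The first is
    the equation [wp'' = 6 wp^2 - g2 / 2] together with the derivative of [eta1]; the
    second, taken at half periods, where [E2' = 0], gives the derivatives of the [e_k].

    Complex integration is replaced by uniqueness for the equation
    [y'' = 6 y^2 - g2 / 2] along segments: two solutions with the same initial values
    run into their first pole together ([pole_transfer]).  If two half-period values
    were equal, this would make the difference of the half periods a period.  If
    [g2 = 0], the solutions [mu^2 wp (mu z)] satisfy the same equation, and comparing
    two of them at different half periods shows that the lattice is stable under a
    primitive cube root of unity; such a lattice is generated by a shortest
    vector over Z[rho], so that [tau] lies in [frak_S]. *)

(** * Complex differentiation *)

Lemma RtoC_neq (x y : R) : x <> y -> RtoC x <> RtoC y.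
Proof. intros H E. apply H. now injection E. Qed.

Ltac cnum := apply RtoC_neq; lra.

Lemma Cmod_minus_sym (x y : C) : Cmod (x - y) = Cmod (y - x).
Proof. rewrite <- (Cmod_opp (y - x)). f_equal. ring. Qed.

Lemma Cmod_triangle_minus (x y : C) : (Cmod (x - y) <= Cmod x + Cmod y)%R.
Proof. unfold Cminus. rewrite <- (Cmod_opp y). apply Cmod_triangle. Qed.

Lemma Cmod_triangle_rev (x y : C) : (Cmod x - Cmod y <= Cmod (x - y))%R.
Proof.
  pose proof (Cmod_triangle (x - y) y) as H.
  replace (x - y + y) with x in H by ring. lra.
Qed.

Lemma Cmod_pos_neq (x : C) : (0 < Cmod x)%R -> x <> 0.
Proof. intros H. now apply Cmod_gt_0. Qed.

Lemma Cmod_self (x : C) : Cmod (x - x) = 0%R.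
Proof. replace (x - x) with (RtoC 0) by ring. apply Cmod_0. Qed.

(** Stated with the modulus, because the source and the target of [is_derive] carry
    two different, though equivalent, uniform structures on [C]. *)
Definition ccont (f : C -> C) (x : C) : Prop :=
  forall eps : R, (0 < eps)%R -> exists d : R, (0 < d)%R /\
    forall y, (Cmod (y - x) < d)%R -> (Cmod (f y - f x) < eps)%R.

Definition cderiv (f : C -> C) (x l : C) : Prop :=
  forall eps : R, (0 < eps)%R -> exists d : R, (0 < d)%R /\
    forall y, (Cmod (y - x) < d)%R ->
      (Cmod (f y - f x - l * (y - x)) <= eps * Cmod (y - x))%R.

Definition near (x : C) (P : C -> Prop) : Prop :=
  exists d : R, (0 < d)%R /\ forall y, (Cmod (y - x) < d)%R -> P y.

Lemma near_and x (P Q : C -> Prop) :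
  near x P -> near x Q -> near x (fun y => P y /\ Q y).
Proof.
  intros [d [Hd H]] [d' [Hd' H']]. exists (Rmin d d'). split.
  - now apply Rmin_glb_lt.
  - intros y Hy. split; [apply H | apply H'].
    + eapply Rlt_le_trans; [exact Hy | apply Rmin_l].
    + eapply Rlt_le_trans; [exact Hy | apply Rmin_r].
Qed.

Lemma near_imp x (P Q : C -> Prop) : (forall y, P y -> Q y) -> near x P -> near x Q.
Proof. intros HPQ [d [Hd H]]. exists d. split; auto. Qed.

Lemma near_self x (P : C -> Prop) : near x P -> P x.
Proof. intros [d [Hd H]]. apply H. now rewrite Cmod_self. Qed.

Lemma near_ball x (r : R) : (0 < r)%R -> near x (fun y => (Cmod (y - x) < r)%R).
Proof. intros Hr. exists r. auto. Qed.

Lemma near_locally (x : C) (P : C -> Prop) : near x P <-> locally (T := C_UniformSpace) x P.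
Proof.
  split.
  - intros [d [Hd H]].
    assert (Hd' : (0 < d / 2)%R) by lra. exists (mkposreal _ Hd').
    intros y Hy. apply H.
    eapply Rlt_le_trans; [exact (C_NormedModule_mixin_compat2 x y _ Hy)|].
    cbn [pos]. assert (sqrt 2 <= 2)%R.
    { rewrite <- (sqrt_square 2) at 2 by lra. apply sqrt_le_1; lra. }
    nra.
  - intros [[d Hd] H]. exists d. split; [exact Hd|].
    intros y Hy. apply H. now apply C_NormedModule_mixin_compat1.
Qed.

Lemma cderiv_is_derive f x l :
  cderiv f x l <-> is_derive (K := C_AbsRing) (V := C_NormedModule) f x l.
Proof.
  split.
  - intros H. split; [apply is_linear_scal_l|].
    intros x0 Hx0.
    assert (E : x = x0) by (apply (is_filter_lim_locally_unique (K := C_AbsRing) (V := AbsRing_NormedModule C_AbsRing)); exact Hx0).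
    subst x0. intros [eps Heps]. destruct (H eps Heps) as [d [Hd Hf]].
    exists (mkposreal d Hd). intros y Hy.
    specialize (Hf y Hy).
    eapply Rle_trans; [|exact Hf]. right.
    change (Cmod (f y + - f x + - ((y + - x) * l)) = Cmod (f y - f x - l * (y - x))).
    f_equal. ring.
  - intros [_ H] eps Heps.
    destruct (H x (fun P HP => HP) (mkposreal eps Heps)) as [[d Hd] Hf].
    exists d. split; [exact Hd|]. intros y Hy.
    specialize (Hf y Hy). eapply Rle_trans; [|exact Hf]. right.
    change (Cmod (f y - f x - l * (y - x)) = Cmod (f y + - f x + - ((y + - x) * l))).
    f_equal. ring.
Qed.

Lemma ccont_near f x (P : C -> Prop) : ccont f x -> near (f x) P -> near x (fun y => P (f y)).
Proof.
  intros Hf [e [He HP]]. destruct (Hf e He) as [d [Hd H]]. exists d. split; auto.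
Qed.

Lemma near_neq (f : C -> C) (x c : C) : ccont f x -> f x <> c -> near x (fun y => f y <> c).
Proof.
  intros Hf H. apply (ccont_near f x (fun v => v <> c) Hf).
  exists (Cmod (f x - c)). split; [apply Cmod_gt_0; now apply Cminus_eq_contra|].
  intros y Hy E. subst y. rewrite Cmod_minus_sym in Hy. lra.
Qed.

Lemma ccont_ext_near f g x : near x (fun y => f y = g y) -> ccont f x -> ccont g x.
Proof.
  intros Hn Hf eps Heps. destruct (Hf eps Heps) as [d Hd].
  destruct (near_and _ _ _ Hn (ex_intro _ d Hd)) as [d' [Hd' H]].
  exists d'. split; [exact Hd'|]. intros y Hy.
  rewrite <- (near_self _ _ Hn). destruct (H y Hy) as [<- H2]. exact H2.
Qed.

Lemma ccont_ext f g x : (forall y, f y = g y) -> ccont f x -> ccont g x.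
Proof. intros H. apply ccont_ext_near. exists 1%R. split; [lra|auto]. Qed.

Lemma ccont_const (c x : C) : ccont (fun _ => c) x.
Proof. intros eps Heps. exists 1%R. split; [lra|]. intros y _. now rewrite Cmod_self. Qed.

Lemma ccont_id (x : C) : ccont (fun y => y) x.
Proof. intros eps Heps. now exists eps. Qed.

Lemma ccont_plus f g x : ccont f x -> ccont g x -> ccont (fun y => f y + g y) x.
Proof.
  intros Hf Hg eps Heps.
  destruct (near_and _ _ _ (Hf (eps / 2)%R ltac:(lra)) (Hg (eps / 2)%R ltac:(lra))) as [d [Hd H]].
  exists d. split; [exact Hd|]. intros y Hy. destruct (H y Hy) as [H1 H2].
  replace (f y + g y - (f x + g x)) with ((f y - f x) + (g y - g x)) by ring.
  eapply Rle_lt_trans; [apply Cmod_triangle|]. lra.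
Qed.

Lemma ccont_mult f g x : ccont f x -> ccont g x -> ccont (fun y => f y * g y) x.
Proof.
  intros Hf Hg eps Heps.
  pose proof (Cmod_ge_0 (f x)) as F0. pose proof (Cmod_ge_0 (g x)) as G0.
  set (K := (Cmod (f x) + Cmod (g x) + 1)%R).
  set (r := Rmin 1 (eps / (2 * K))).
  assert (Hr : (0 < r)%R).
  { apply Rmin_glb_lt; [lra|]. apply Rdiv_lt_0_compat; unfold K; lra. }
  destruct (near_and _ _ _ (Hf r Hr) (Hg r Hr)) as [d [Hd H]].
  exists d. split; [exact Hd|]. intros y Hy. destruct (H y Hy) as [H1 H2].
  replace (f y * g y - f x * g x)
    with ((f y - f x) * (g y - g x) + ((f y - f x) * g x + f x * (g y - g x))) by ring.
  eapply Rle_lt_trans; [apply Cmod_triangle|].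
  eapply Rle_lt_trans; [apply Rplus_le_compat_l, Cmod_triangle|].
  rewrite !Cmod_mult.
  pose proof (Cmod_ge_0 (f y - f x)) as A0. pose proof (Cmod_ge_0 (g y - g x)) as B0.
  pose proof (Rmin_l 1 (eps / (2 * K))) as R1. fold r in R1.
  pose proof (Rmin_r 1 (eps / (2 * K))) as R2. fold r in R2.
  assert (R3 : (r * K <= eps / 2)%R).
  { apply (Rmult_le_compat_r K) in R2; [|unfold K; lra].
    replace (eps / (2 * K) * K)%R with (eps / 2)%R in R2; [exact R2|].
    field. unfold K; lra. }
  unfold K in R3. nra.
Qed.

Lemma ccont_comp f g x : ccont f x -> ccont g (f x) -> ccont (fun y => g (f y)) x.
Proof.
  intros Hf Hg eps Heps. destruct (Hg eps Heps) as [d [Hd H]].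
  destruct (Hf d Hd) as [d' [Hd' H']]. exists d'. split; auto.
Qed.

Lemma ccont_inv (f : C -> C) x : f x <> 0 -> ccont f x -> ccont (fun y => / f y) x.
Proof.
  intros Hx Hf. apply (ccont_comp f Cinv); [exact Hf|].
  set (a := f x) in *. assert (Ha : (0 < Cmod a)%R) by now apply Cmod_gt_0.
  intros eps Heps. set (A := Cmod a) in *.
  exists (Rmin (A / 2) (eps * (A * A / 2)))%R. split.
  { apply Rmin_glb_lt; [lra|]. apply Rmult_lt_0_compat; nra. }
  intros y Hy.
  assert (Hy1 : (Cmod (y - a) < A / 2)%R) by (eapply Rlt_le_trans; [exact Hy | apply Rmin_l]).
  assert (Hy2 : (Cmod (y - a) < eps * (A * A / 2))%R) by (eapply Rlt_le_trans; [exact Hy | apply Rmin_r]).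
  pose proof (Cmod_triangle_rev a y) as T. rewrite Cmod_minus_sym in T. fold A in T.
  assert (Hy0 : y <> 0) by (apply Cmod_pos_neq; lra).
  replace (/ y - / a) with (- (y - a) / (y * a)) by (field; auto).
  rewrite Cmod_div, Cmod_opp, Cmod_mult by (apply Cmult_neq_0; auto). fold A.
  apply (Rmult_lt_reg_r (Cmod y * A)); [nra|].
  replace (Cmod (y - a) / (Cmod y * A) * (Cmod y * A))%R with (Cmod (y - a)) by (field; split; lra).
  eapply Rlt_le_trans; [exact Hy2|]. apply Rmult_le_compat_l; [lra|].
  replace (A * A / 2)%R with (A / 2 * A)%R by field.
  apply Rmult_le_compat_r; lra.
Qed.

Lemma ccont_opp f x : ccont f x -> ccont (fun y => - f y) x.
Proof.
  intros H. apply (ccont_ext (fun y => - (1) * f y)); [intros; ring|].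
  apply ccont_mult; [apply ccont_const | exact H].
Qed.

Lemma ccont_minus f g x : ccont f x -> ccont g x -> ccont (fun y => f y - g y) x.
Proof. intros Hf Hg. apply ccont_plus; [exact Hf | now apply ccont_opp]. Qed.

(** Caratheodory's form of differentiability: the difference quotient extends
    continuously.  It reduces the rules of differentiation to those of continuity. *)
Lemma cderiv_of_slope f x l (phi : C -> C) :
  near x (fun y => f y - f x = phi y * (y - x)) -> phi x = l -> ccont phi x -> cderiv f x l.
Proof.
  intros Hn Hl Hc eps Heps.
  destruct (near_and _ _ _ Hn (Hc eps Heps)) as [d [Hd H]].
  exists d. split; [exact Hd|]. intros y Hy. destruct (H y Hy) as [H1 H2].
  rewrite H1, <- Hl. replace (phi y * (y - x) - phi x * (y - x)) with ((phi y - phi x) * (y - x)) by ring.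
  rewrite Cmod_mult. apply Rmult_le_compat_r; [apply Cmod_ge_0 | lra].
Qed.

Lemma cderiv_slope f x l :
  cderiv f x l -> exists phi, (forall y, f y - f x = phi y * (y - x)) /\ phi x = l /\ ccont phi x.
Proof.
  intros H. exists (fun y => if Ceq_dec y x then l else (f y - f x) / (y - x)).
  split; [|split].
  - intros y. destruct (Ceq_dec y x) as [->|N]; [ring|].
    field. now apply Cminus_eq_contra.
  - destruct (Ceq_dec x x); [reflexivity | congruence].
  - intros eps Heps. destruct (H (eps / 2)%R ltac:(lra)) as [d [Hd Hf]].
    exists d. split; [exact Hd|]. intros y Hy. specialize (Hf y Hy).
    destruct (Ceq_dec x x); [|congruence].
    destruct (Ceq_dec y x) as [->|N]; [rewrite Cmod_self; lra|].
    assert (N' : y - x <> 0) by now apply Cminus_eq_contra.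
    replace ((f y - f x) / (y - x) - l) with ((f y - f x - l * (y - x)) / (y - x)) by (field; exact N').
    rewrite Cmod_div by exact N'.
    apply Cmod_gt_0 in N'.
    apply (Rmult_lt_reg_r (Cmod (y - x))); [exact N'|].
    replace (Cmod (f y - f x - l * (y - x)) / Cmod (y - x) * Cmod (y - x))%R
      with (Cmod (f y - f x - l * (y - x))) by (field; lra).
    nra.
Qed.

Lemma near_forall x (P : C -> Prop) : (forall y, P y) -> near x P.
Proof. intros H. exists 1%R. split; [lra|auto]. Qed.

Lemma cderiv_ccont f x l : cderiv f x l -> ccont f x.
Proof.
  intros H. destruct (cderiv_slope _ _ _ H) as [phi [H1 [_ H3]]].
  apply (ccont_ext (fun y => f x + phi y * (y - x))).
  { intros y. rewrite <- H1. ring. }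
  apply ccont_plus; [apply ccont_const|]. apply ccont_mult; [exact H3|].
  apply ccont_minus; [apply ccont_id | apply ccont_const].
Qed.

Lemma cderiv_ext_near f g x l : near x (fun y => f y = g y) -> cderiv f x l -> cderiv g x l.
Proof.
  intros Hn Hf. destruct (cderiv_slope _ _ _ Hf) as [phi [H1 [H2 H3]]].
  apply (cderiv_of_slope _ _ _ phi); auto.
  apply (near_imp x (fun y => f y = g y)); [|exact Hn].
  intros y Hy. now rewrite <- Hy, <- (near_self _ _ Hn).
Qed.

Lemma cderiv_ext f g x l : (forall y, f y = g y) -> cderiv f x l -> cderiv g x l.
Proof. intros H. apply cderiv_ext_near. now apply near_forall. Qed.

Lemma cderiv_eq f x l l' : cderiv f x l -> l = l' -> cderiv f x l'.
Proof. now intros H <-. Qed.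

Lemma cderiv_const (c x : C) : cderiv (fun _ => c) x 0.
Proof.
  apply (cderiv_of_slope _ _ _ (fun _ => 0)); auto.
  - apply near_forall. intros; ring.
  - apply ccont_const.
Qed.

Lemma cderiv_id (x : C) : cderiv (fun y => y) x 1.
Proof.
  apply (cderiv_of_slope _ _ _ (fun _ => 1)); auto.
  - apply near_forall. intros; ring.
  - apply ccont_const.
Qed.

Lemma cderiv_plus f g x lf lg :
  cderiv f x lf -> cderiv g x lg -> cderiv (fun y => f y + g y) x (lf + lg).
Proof.
  intros Hf Hg. destruct (cderiv_slope _ _ _ Hf) as [p [P1 [P2 P3]]].
  destruct (cderiv_slope _ _ _ Hg) as [q [Q1 [Q2 Q3]]].
  apply (cderiv_of_slope _ _ _ (fun y => p y + q y)).
  - apply near_forall. intros y. transitivity ((f y - f x) + (g y - g x)); [ring|].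
    rewrite P1, Q1. ring.
  - now rewrite P2, Q2.
  - now apply ccont_plus.
Qed.

Lemma cderiv_mult f g x lf lg :
  cderiv f x lf -> cderiv g x lg -> cderiv (fun y => f y * g y) x (lf * g x + f x * lg).
Proof.
  intros Hf Hg. destruct (cderiv_slope _ _ _ Hf) as [p [P1 [P2 P3]]].
  destruct (cderiv_slope _ _ _ Hg) as [q [Q1 [Q2 Q3]]].
  apply (cderiv_of_slope _ _ _ (fun y => p y * g y + f x * q y)).
  - apply near_forall. intros y. transitivity ((f y - f x) * g y + f x * (g y - g x)); [ring|].
    rewrite P1, Q1. ring.
  - now rewrite P2, Q2.
  - apply ccont_plus; apply ccont_mult; auto using ccont_const.
    now apply (cderiv_ccont g x lg).
Qed.

Lemma cderiv_comp f g x lf lg :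
  cderiv f x lf -> cderiv g (f x) lg -> cderiv (fun y => g (f y)) x (lg * lf).
Proof.
  intros Hf Hg. destruct (cderiv_slope _ _ _ Hf) as [p [P1 [P2 P3]]].
  destruct (cderiv_slope _ _ _ Hg) as [q [Q1 [Q2 Q3]]].
  apply (cderiv_of_slope _ _ _ (fun y => q (f y) * p y)).
  - apply near_forall. intros y. rewrite Q1, P1. ring.
  - now rewrite P2, Q2.
  - apply ccont_mult; auto. apply ccont_comp; auto. now apply (cderiv_ccont f x lf).
Qed.

Lemma cderiv_inv (f : C -> C) (x l : C) : f x <> 0 -> cderiv f x l -> cderiv (fun y => / f y) x (- l / (f x ^ 2)).
Proof.
  intros Hx Hf. destruct (cderiv_slope _ _ _ Hf) as [p [P1 [P2 P3]]].
  pose proof (cderiv_ccont _ _ _ Hf) as Hc.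
  pose proof (near_neq f x 0 Hc Hx) as Hn.
  apply (cderiv_of_slope _ _ _ (fun y => - p y * (/ f y * / f x))).
  - apply (near_imp x (fun y => f y <> 0)); [|exact Hn]. intros y Hy.
    transitivity (- (f y - f x) * (/ f y * / f x)); [field; auto|].
    rewrite P1. ring.
  - rewrite P2. field. auto.
  - apply ccont_mult; [now apply ccont_opp|]. apply ccont_mult; [|apply ccont_const].
    now apply ccont_inv.
Qed.

Lemma cderiv_opp f x l : cderiv f x l -> cderiv (fun y => - f y) x (- l).
Proof.
  intros H. apply (cderiv_ext (fun y => - (1) * f y)); [intros; ring|].
  eapply cderiv_eq; [apply cderiv_mult; [apply cderiv_const | exact H]|]. cbv beta. ring.
Qed.

Lemma cderiv_minus f g x lf lg :
  cderiv f x lf -> cderiv g x lg -> cderiv (fun y => f y - g y) x (lf - lg).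
Proof. intros Hf Hg. apply cderiv_plus; [exact Hf | now apply cderiv_opp]. Qed.

Lemma cderiv_scal c f x l : cderiv f x l -> cderiv (fun y => c * f y) x (c * l).
Proof.
  intros H. eapply cderiv_eq; [apply cderiv_mult; [apply cderiv_const | exact H]|]. cbv beta. ring.
Qed.

Lemma cderiv_affine (a b x : C) : cderiv (fun y => a + b * y) x b.
Proof.
  eapply cderiv_eq.
  - apply cderiv_plus; [apply cderiv_const | apply cderiv_scal, cderiv_id].
  - ring.
Qed.

Lemma cderiv_comp_affine g (a b x l : C) :
  cderiv g (a + b * x) l -> cderiv (fun y => g (a + b * y)) x (b * l).
Proof.
  intros H. eapply cderiv_eq.
  - apply (cderiv_comp (fun y => a + b * y) g); [apply cderiv_affine | exact H].
  - ring.
Qed.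

Lemma cderiv_unique f x l l' : cderiv f x l -> cderiv f x l' -> l = l'.
Proof.
  intros H H'. apply Ceq_minus. apply Cmod_eq_0.
  destruct (Req_dec (Cmod (l - l')) 0) as [E|N]; [exact E|exfalso].
  pose proof (Cmod_ge_0 (l - l')) as P.
  set (m := Cmod (l - l')) in *. assert (Hm : (0 < m)%R) by lra.
  destruct (near_and _ _ _ (H (m / 4)%R ltac:(lra)) (H' (m / 4)%R ltac:(lra))) as [d [Hd Hn]].
  destruct (Hn (x + RtoC (d / 2))) as [H1 H2].
  { replace (x + RtoC (d / 2) - x) with (RtoC (d / 2)) by ring.
    rewrite Cmod_R, Rabs_pos_eq; lra. }
  revert H1 H2. replace (x + RtoC (d / 2) - x) with (RtoC (d / 2)) by ring.
  set (A := f (x + RtoC (d / 2)) - f x). intros H1 H2.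
  assert (H3 : (Cmod ((l - l') * RtoC (d / 2)) <= m / 4 * Cmod (RtoC (d / 2)) + m / 4 * Cmod (RtoC (d / 2)))%R).
  { replace ((l - l') * RtoC (d / 2)) with ((A - l' * RtoC (d / 2)) - (A - l * RtoC (d / 2))) by ring.
    eapply Rle_trans; [apply Cmod_triangle_minus|]. lra. }
  rewrite Cmod_mult, Cmod_R, Rabs_pos_eq in H3 by lra. fold m in H3. nra.
Qed.

(** ** Segments and the mean value inequality *)

Lemma Re_path_derive f (a b : C) (t : R) l :
  cderiv f (a + RtoC t * b) l ->
  is_derive (fun t : R => Re (f (a + RtoC t * b))) t (Re (l * b)).
Proof.
  intros H. apply is_derive_Reals. intros eps Heps.
  assert (K : (0 < Cmod b + 1)%R) by (pose proof (Cmod_ge_0 b); lra).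
  destruct (H (eps / 2 / (Cmod b + 1))%R) as [d [Hd Hf]].
  { apply Rdiv_lt_0_compat; lra. }
  assert (Hd' : (0 < d / (Cmod b + 1))%R) by now apply Rdiv_lt_0_compat.
  exists (mkposreal _ Hd'). intros h Hh Hlt. cbn [pos] in Hlt.
  specialize (Hf (a + RtoC (t + h) * b)).
  replace (a + RtoC (t + h) * b - (a + RtoC t * b)) with (RtoC h * b) in Hf by (rewrite RtoC_plus; ring).
  rewrite Cmod_mult, Cmod_R in Hf.
  assert (Hh' : (0 < Rabs h)%R) by now apply Rabs_pos_lt.
  pose proof (Cmod_ge_0 b) as B0.
  assert (Hsm : (Rabs h * Cmod b < d)%R).
  { apply (Rmult_lt_compat_r (Cmod b + 1)) in Hlt; [|exact K].
    unfold Rdiv in Hlt. rewrite Rmult_assoc, Rinv_l in Hlt by lra. nra. }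
  specialize (Hf Hsm).
  set (v := f (a + RtoC (t + h) * b)) in *. set (v0 := f (a + RtoC t * b)) in *.
  replace ((Re v - Re v0) / h - Re (l * b))%R with (Re (v - v0 - l * (RtoC h * b)) / h)%R.
  2:{ destruct v, v0, l, b. cbn. field. exact Hh. }
  unfold Rdiv. rewrite Rabs_mult, Rabs_inv.
  apply (Rmult_lt_reg_r (Rabs h)); [exact Hh'|].
  rewrite Rmult_assoc, Rinv_l, Rmult_1_r by lra.
  eapply Rle_lt_trans; [apply re_le_Cmod|].
  eapply Rle_lt_trans; [exact Hf|].
  replace (eps / 2 / (Cmod b + 1) * (Rabs h * Cmod b))%R
    with (eps * Rabs h * (Cmod b / (2 * (Cmod b + 1))))%R by (field; lra).
  rewrite <- (Rmult_1_r (eps * Rabs h)) at 2. apply Rmult_lt_compat_l; [nra|].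
  apply (Rmult_lt_reg_r (2 * (Cmod b + 1))); [lra|].
  unfold Rdiv. rewrite Rmult_assoc, Rinv_l by lra. lra.
Qed.

Lemma Cmod_mean_value (f df : C -> C) (a b : C) (M : R) :
  (forall t : R, (0 <= t <= 1)%R ->
     cderiv f (a + RtoC t * (b - a)) (df (a + RtoC t * (b - a))) /\
     (Cmod (df (a + RtoC t * (b - a))%C) <= M)%R) ->
  (Cmod (f b - f a) <= M * Cmod (b - a))%R.
Proof.
  intros H. set (D := f b - f a).
  destruct (Ceq_dec D 0) as [E|N].
  { rewrite E, Cmod_0. destruct (H 0%R ltac:(lra)) as [_ H0].
    apply Rmult_le_pos; [|apply Cmod_ge_0]. eapply Rle_trans; [apply Cmod_ge_0 | exact H0]. }
  apply Cmod_gt_0 in N.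
  (* rotating [f] by [w] makes the increment real and positive *)
  set (w := Cconj D / RtoC (Cmod D)).
  assert (HD : RtoC (Cmod D) <> 0) by (apply RtoC_neq; lra).
  assert (Hw : Cmod w = 1%R).
  { unfold w. rewrite Cmod_div, Cmod_conj, Cmod_R, Rabs_pos_eq by (auto; lra). field. lra. }
  assert (HwD : Re (w * D) = Cmod D).
  { assert (w * D = RtoC (Cmod D)) as ->; [|reflexivity].
    unfold w. replace (Cconj D / RtoC (Cmod D) * D) with ((D * Cconj D) / RtoC (Cmod D)) by (field; exact HD).
    rewrite <- Cmod2_conj, RtoC_pow. field. exact HD. }
  set (g := fun t : R => Re ((fun x => w * f x) (a + RtoC t * (b - a)))).
  set (dg := fun t : R => Re ((w * df (a + RtoC t * (b - a))) * (b - a))).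
  assert (Hg : forall t, (0 <= t <= 1)%R -> is_derive g t (dg t)).
  { intros t Ht. apply (Re_path_derive (fun x => w * f x)).
    apply cderiv_scal. now apply H. }
  destruct (MVT_gen g 0 1 dg) as [c [Hc E]].
  - intros x Hx. rewrite Rmin_left, Rmax_right in Hx by lra. apply Hg. lra.
  - intros x Hx. rewrite Rmin_left, Rmax_right in Hx by lra.
    apply derivable_continuous_pt. exists (dg x). apply is_derive_Reals, Hg. lra.
  - rewrite Rmin_left, Rmax_right in Hc by lra.
    assert (E1 : (g 1 - g 0)%R = Cmod D).
    { unfold g. rewrite <- HwD. unfold D.
      replace (a + RtoC 1 * (b - a)) with b by ring.
      replace (a + RtoC 0 * (b - a)) with a by ring.
      destruct w, (f b), (f a). cbn. ring. }
    rewrite E1 in E. rewrite E.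
    destruct (H c Hc) as [_ HM].
    assert (B : (Rabs (dg c) <= M * Cmod (b - a))%R).
    { unfold dg. eapply Rle_trans; [apply re_le_Cmod|].
      rewrite !Cmod_mult, Hw, Rmult_1_l. apply Rmult_le_compat_r; [apply Cmod_ge_0 | exact HM]. }
    pose proof (Rle_abs (dg c)). lra.
Qed.

Lemma segment_in_ball (x a b : C) (r t : R) :
  (Cmod (a - x) < r)%R -> (Cmod (b - x) < r)%R -> (0 <= t <= 1)%R ->
  (Cmod (a + RtoC t * (b - a) - x) < r)%R.
Proof.
  intros Ha Hb Ht.
  replace (a + RtoC t * (b - a) - x) with (RtoC (1 - t) * (a - x) + RtoC t * (b - x))
    by (rewrite RtoC_minus; ring).
  eapply Rle_lt_trans; [apply Cmod_triangle|].
  rewrite !Cmod_mult, !Cmod_R, !Rabs_pos_eq by lra.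
  pose proof (Cmod_ge_0 (a - x)). pose proof (Cmod_ge_0 (b - x)).
  destruct (Req_dec t 0) as [->|N]; [lra|]. nra.
Qed.

(** If the derivative is close to [df x], then [f] minus the linear map
    [df x] is a contraction, too weak to merge two points that the linear map separates. *)
Lemma injective_near (f df : C -> C) (x : C) :
  near x (fun y => cderiv f y (df y)) -> ccont df x -> df x <> 0 ->
  exists d : R, (0 < d)%R /\
    forall y z, (Cmod (y - x) < d)%R -> (Cmod (z - x) < d)%R -> f y = f z -> y = z.
Proof.
  intros Hd Hc Hx. assert (Hp : (0 < Cmod (df x))%R) by now apply Cmod_gt_0.
  set (m := Cmod (df x)) in *.
  destruct (near_and _ _ _ Hd (Hc (m / 2)%R ltac:(lra))) as [d [Hd0 H]].
  exists d. split; [exact Hd0|]. intros y z Hy Hz E.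
  assert (B : (Cmod ((f z - df x * z) - (f y - df x * y)) <= m / 2 * Cmod (z - y))%R).
  { apply (Cmod_mean_value (fun v => f v - df x * v) (fun v => df v - df x * 1)).
    intros t Ht. destruct (H _ (segment_in_ball x y z d t Hy Hz Ht)) as [H1 H2]. split.
    - apply cderiv_minus; [exact H1 | apply cderiv_scal, cderiv_id].
    - replace (df x * 1) with (df x) by ring. lra. }
  rewrite E in B. replace (f z - df x * z - (f z - df x * y)) with (- (df x * (z - y))) in B by ring.
  rewrite Cmod_opp, Cmod_mult in B. fold m in B.
  assert (Z : Cmod (z - y) = 0%R) by (pose proof (Cmod_ge_0 (z - y)); nra).
  apply Cmod_eq_0, Ceq_minus in Z. now symmetry.
Qed.

Lemma constant_on_segment (f : C -> C) (a b : C) :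
  (forall t : R, (0 <= t <= 1)%R -> cderiv f (a + RtoC t * (b - a)) 0) -> f a = f b.
Proof.
  intros H.
  assert (B : (Cmod (f b - f a) <= 0 * Cmod (b - a))%R).
  { apply (Cmod_mean_value f (fun _ => 0)). intros t Ht. split; [now apply H | rewrite Cmod_0; lra]. }
  symmetry. apply Ceq_minus, Cmod_eq_0. pose proof (Cmod_ge_0 (f b - f a)). lra.
Qed.

(** * Unordered sums *)



Definition Csum {I : Type} (f : I -> C) (F : list I) : C :=
  fold_right Cplus (RtoC 0) (map f F).
Definition Rsum {I : Type} (f : I -> R) (F : list I) : R :=
  fold_right Rplus 0%R (map f F).

Definition has_sum {I : Type} (f : I -> C) (s : C) : Prop :=
  forall eps : R, (0 < eps)%R -> exists F0 : list I, NoDup F0 /\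
    forall F, NoDup F -> incl F0 F -> (Cmod (Csum f F - s) < eps)%R.

Definition Rsummable {I : Type} (g : I -> R) : Prop :=
  (forall i, (0 <= g i)%R) /\ exists B : R, forall F, NoDup F -> (Rsum g F <= B)%R.

Definition summable {I : Type} (f : I -> C) : Prop := Rsummable (fun i => Cmod (f i)).

Lemma dedup {I : Type} (l : list I) : exists l', NoDup l' /\ forall x, In x l' <-> In x l.
Proof.
  induction l as [|a l [l' [H1 H2]]].
  - exists nil. split; [constructor | tauto].
  - destruct (classic (In a l)) as [Ha|Ha].
    + exists l'. split; [exact H1|]. intros x. rewrite H2. split; [now right|].
      intros [<-|Hx]; assumption.
    + exists (a :: l'). split.
      * constructor; [|exact H1]. now rewrite H2.
      * intros x. cbn. now rewrite H2.
Qed.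

Lemma union_list {I : Type} (F G : list I) :
  exists H, NoDup H /\ incl F H /\ incl G H.
Proof.
  destruct (dedup (F ++ G)) as [H [H1 H2]]. exists H. repeat split; auto.
  - intros x Hx. apply H2, in_or_app. now left.
  - intros x Hx. apply H2, in_or_app. now right.
Qed.

Lemma NoDup_app_not_in {I : Type} (F G : list I) i : NoDup (F ++ G) -> In i G -> ~ In i F.
Proof.
  intros HN Hi Hi0. apply in_split in Hi. destruct Hi as [l1 [l2 ->]].
  rewrite app_assoc in HN. apply NoDup_remove_2 in HN. apply HN.
  apply in_or_app. left. apply in_or_app. now left.
Qed.

Lemma incl_complement {I : Type} (F0 F : list I) :
  NoDup F0 -> incl F0 F -> exists F', Permutation F (F0 ++ F').
Proof.
  revert F. induction F0 as [|a F0 IH]; intros F HN Hi.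
  - now exists F.
  - inversion_clear HN as [|? ? Ha HN'].
    destruct (in_split a F (Hi a (or_introl eq_refl))) as [l1 [l2 ->]].
    destruct (IH (l1 ++ l2) HN') as [F' HF'].
    + intros x Hx. assert (Hx' : In x (l1 ++ a :: l2)) by (apply Hi; now right).
      apply in_app_or in Hx'. apply in_or_app. destruct Hx' as [|[->|]]; auto. contradiction.
    + exists F'. cbn. rewrite <- HF'. symmetry. apply Permutation_middle.
Qed.

Lemma Csum_cons {I} (f : I -> C) a F : Csum f (a :: F) = f a + Csum f F.
Proof. reflexivity. Qed.

Lemma Rsum_cons {I} (f : I -> R) a F : Rsum f (a :: F) = (f a + Rsum f F)%R.
Proof. reflexivity. Qed.

Lemma Csum_app {I} (f : I -> C) F G : Csum f (F ++ G) = Csum f F + Csum f G.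
Proof.
  induction F as [|a F IH]; [unfold Csum; cbn; ring|].
  change ((a :: F) ++ G) with (a :: (F ++ G)). rewrite !Csum_cons, IH. ring.
Qed.

Lemma Rsum_app {I} (f : I -> R) F G : Rsum f (F ++ G) = (Rsum f F + Rsum f G)%R.
Proof.
  induction F as [|a F IH]; [unfold Rsum; cbn; ring|].
  change ((a :: F) ++ G) with (a :: (F ++ G)). rewrite !Rsum_cons, IH. ring.
Qed.

Lemma Csum_perm {I} (f : I -> C) F G : Permutation F G -> Csum f F = Csum f G.
Proof.
  induction 1; rewrite ?Csum_cons; try congruence. ring.
Qed.

Lemma Rsum_perm {I} (f : I -> R) F G : Permutation F G -> Rsum f F = Rsum f G.
Proof.
  induction 1; rewrite ?Rsum_cons; try congruence. ring.
Qed.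

Lemma Csum_ext_in {I} (f g : I -> C) F : (forall i, In i F -> f i = g i) -> Csum f F = Csum g F.
Proof. intros H. unfold Csum. f_equal. now apply map_ext_in. Qed.

Lemma Csum_map {I J} (h : I -> J) (f : J -> C) F : Csum f (map h F) = Csum (fun i => f (h i)) F.
Proof. unfold Csum. now rewrite map_map. Qed.

Lemma Rsum_map {I J} (h : I -> J) (f : J -> R) F : Rsum f (map h F) = Rsum (fun i => f (h i)) F.
Proof. unfold Rsum. now rewrite map_map. Qed.

Lemma Csum_plus {I} (f g : I -> C) F : Csum (fun i => f i + g i) F = Csum f F + Csum g F.
Proof. induction F as [|a F IH]; [cbn; ring|]. rewrite !Csum_cons, IH. ring. Qed.

Lemma Csum_scal {I} c (f : I -> C) F : Csum (fun i => c * f i) F = c * Csum f F.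
Proof. induction F as [|a F IH]; [cbn; ring|]. rewrite !Csum_cons, IH. ring. Qed.

Lemma Rsum_scal {I} c (f : I -> R) F : Rsum (fun i => c * f i)%R F = (c * Rsum f F)%R.
Proof. induction F as [|a F IH]; [cbn; ring|]. rewrite !Rsum_cons, IH. ring. Qed.

Lemma Csum_RtoC {I} (g : I -> R) F : Csum (fun i => RtoC (g i)) F = RtoC (Rsum g F).
Proof. induction F as [|a F IH]; [reflexivity|]. now rewrite Csum_cons, Rsum_cons, IH, RtoC_plus. Qed.

Lemma Rsum_le {I} (f g : I -> R) F : (forall i, In i F -> (f i <= g i)%R) -> (Rsum f F <= Rsum g F)%R.
Proof.
  induction F as [|a F IH]; intros H; [cbn; lra|]. rewrite !Rsum_cons.
  apply Rplus_le_compat; [apply H; now left | apply IH; intros; apply H; now right].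
Qed.

Lemma Rsum_ge0 {I} (f : I -> R) F : (forall i, (0 <= f i)%R) -> (0 <= Rsum f F)%R.
Proof. intros H. induction F as [|a F IH]; [cbn; lra|]. rewrite Rsum_cons. specialize (H a). lra. Qed.

Lemma Cmod_Csum {I} (f : I -> C) F : (Cmod (Csum f F) <= Rsum (fun i => Cmod (f i)) F)%R.
Proof.
  induction F as [|a F IH]; [cbn; rewrite Cmod_0; lra|]. rewrite Csum_cons, Rsum_cons.
  eapply Rle_trans; [apply Cmod_triangle | lra].
Qed.

Lemma Rsum_incl {I} (g : I -> R) F0 F :
  (forall i, (0 <= g i)%R) -> NoDup F0 -> incl F0 F -> (Rsum g F0 <= Rsum g F)%R.
Proof.
  intros Hg H0 Hi. destruct (incl_complement F0 F H0 Hi) as [F' HF'].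
  rewrite (Rsum_perm _ _ _ HF'), Rsum_app. pose proof (Rsum_ge0 g F' Hg). lra.
Qed.

Lemma has_sum_unique {I} (f : I -> C) s s' : has_sum f s -> has_sum f s' -> s = s'.
Proof.
  intros H H'. apply Ceq_minus, Cmod_eq_0.
  destruct (Req_dec (Cmod (s - s')) 0) as [E|N]; [exact E|exfalso].
  pose proof (Cmod_ge_0 (s - s')).
  destruct (H (Cmod (s - s') / 2)%R ltac:(lra)) as [F [_ HF]].
  destruct (H' (Cmod (s - s') / 2)%R ltac:(lra)) as [F' [_ HF']].
  destruct (union_list F F') as [G [G1 [G2 G3]]].
  specialize (HF G G1 G2). specialize (HF' G G1 G3).
  replace (s - s') with ((Csum f G - s') - (Csum f G - s)) in HF, HF', N, H0 by ring.
  pose proof (Cmod_triangle_minus (Csum f G - s') (Csum f G - s)). lra.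
Qed.

Lemma has_sum_ext {I} (f g : I -> C) s : (forall i, f i = g i) -> has_sum f s -> has_sum g s.
Proof.
  intros E H eps Heps. destruct (H eps Heps) as [F0 [H0 HF]]. exists F0. split; [exact H0|].
  intros F HN Hi. rewrite <- (Csum_ext_in f g); auto.
Qed.

Lemma has_sum_eq {I} (f : I -> C) s s' : has_sum f s -> s = s' -> has_sum f s'.
Proof. now intros H <-. Qed.

Lemma has_sum_plus {I} (f g : I -> C) s t :
  has_sum f s -> has_sum g t -> has_sum (fun i => f i + g i) (s + t).
Proof.
  intros Hf Hg eps Heps.
  destruct (Hf (eps / 2)%R ltac:(lra)) as [F1 [_ H1]].
  destruct (Hg (eps / 2)%R ltac:(lra)) as [F2 [_ H2]].
  destruct (union_list F1 F2) as [F0 [N0 [I1 I2]]].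
  exists F0. split; [exact N0|]. intros F HN Hi.
  specialize (H1 F HN (incl_tran I1 Hi)). specialize (H2 F HN (incl_tran I2 Hi)).
  rewrite Csum_plus.
  replace (Csum f F + Csum g F - (s + t)) with ((Csum f F - s) + (Csum g F - t)) by ring.
  eapply Rle_lt_trans; [apply Cmod_triangle|]. lra.
Qed.

Lemma has_sum_scal {I} c (f : I -> C) s : has_sum f s -> has_sum (fun i => c * f i) (c * s).
Proof.
  intros Hf eps Heps. pose proof (Cmod_ge_0 c).
  destruct (Hf (eps / (Cmod c + 1))%R) as [F0 [N0 H0]]; [apply Rdiv_lt_0_compat; lra|].
  exists F0. split; [exact N0|]. intros F HN Hi. specialize (H0 F HN Hi).
  rewrite Csum_scal. replace (c * Csum f F - c * s) with (c * (Csum f F - s)) by ring.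
  rewrite Cmod_mult. apply (Rmult_lt_compat_r (Cmod c + 1)) in H0; [|lra].
  unfold Rdiv in H0. rewrite Rmult_assoc, Rinv_l in H0 by lra.
  pose proof (Cmod_ge_0 (Csum f F - s)). nra.
Qed.

Lemma has_sum_opp {I} (f : I -> C) s : has_sum f s -> has_sum (fun i => - f i) (- s).
Proof.
  intros H. apply (has_sum_ext (fun i => - (1) * f i)); [intros; ring|].
  apply (has_sum_eq _ (- (1) * s)); [now apply has_sum_scal | ring].
Qed.

Lemma has_sum_minus {I} (f g : I -> C) s t :
  has_sum f s -> has_sum g t -> has_sum (fun i => f i - g i) (s - t).
Proof. intros Hf Hg. apply has_sum_plus; [exact Hf | now apply has_sum_opp]. Qed.

Lemma has_sum_finite {I} (f : I -> C) F0 :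
  NoDup F0 -> (forall i, ~ In i F0 -> f i = 0) -> has_sum f (Csum f F0).
Proof.
  intros N0 Hf eps Heps. exists F0. split; [exact N0|]. intros F HN Hi.
  destruct (incl_complement F0 F N0 Hi) as [F' HF'].
  rewrite (Csum_perm _ _ _ HF'), Csum_app.
  assert (Z : Csum f F' = 0).
  { assert (HN' : NoDup (F0 ++ F')) by (eapply Permutation_NoDup; eauto).
    assert (Hz : forall i, In i F' -> f i = 0).
    { intros i Hin. apply Hf. now apply (NoDup_app_not_in F0 F'). }
    clear -Hz. induction F' as [|a F' IH]; [reflexivity|].
    rewrite Csum_cons, Hz, IH; [ring| |now left]. intros i Hi. apply Hz. now right. }
  rewrite Z. replace (Csum f F0 + 0 - Csum f F0) with (RtoC 0) by ring. now rewrite Cmod_0.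
Qed.

Lemma has_sum_zero {I} : has_sum (fun _ : I => RtoC 0) 0.
Proof. apply (has_sum_finite (fun _ : I => RtoC 0) nil); [constructor | auto]. Qed.

Lemma has_sum_single {I} (f : I -> C) (j : I) : (forall i, i <> j -> f i = 0) -> has_sum f (f j).
Proof.
  intros H. apply (has_sum_eq _ (Csum f (j :: nil))); [|cbn; ring].
  apply has_sum_finite; [constructor; [intros []|constructor]|].
  intros i Hi. apply H. intros ->. apply Hi. now left.
Qed.

Lemma has_sum_reindex {I J} (h : I -> J) (k : J -> I) (f : J -> C) s :
  (forall i, k (h i) = i) -> (forall j, h (k j) = j) ->
  has_sum f s -> has_sum (fun i => f (h i)) s.
Proof.
  intros Hkh Hhk H eps Heps. destruct (H eps Heps) as [F0 [N0 H0]].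
  exists (map k F0). split.
  - apply FinFun.Injective_map_NoDup; [|exact N0]. intros x y E.
    rewrite <- (Hhk x), <- (Hhk y). now rewrite E.
  - intros F HN Hi. rewrite <- (Csum_map h f). apply H0.
    + apply FinFun.Injective_map_NoDup; [|exact HN]. intros x y E.
      rewrite <- (Hkh x), <- (Hkh y). now rewrite E.
    + intros j Hj. rewrite <- (Hhk j). apply in_map, Hi. now apply in_map.
Qed.

(** Monotone limit: the supremum of the finite sums is the sum. *)
Lemma Rsummable_has_sum {I} (g : I -> R) :
  Rsummable g -> exists M : R, has_sum (fun i => RtoC (g i)) (RtoC M).
Proof.
  intros [Hg [B HB]].
  destruct (completeness (fun r => exists F, NoDup F /\ r = Rsum g F)) as [M [M1 M2]].
  - exists B. intros r [F [HN ->]]. now apply HB.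
  - exists 0%R, nil. split; [constructor | reflexivity].
  - exists M. intros eps Heps.
    assert (HF0 : exists F0, NoDup F0 /\ (M - eps < Rsum g F0)%R).
    { apply NNPP. intros N. assert (M <= M - eps)%R; [|lra].
      apply M2. intros r [F [HN ->]]. apply Rnot_lt_le. intros L. apply N. now exists F. }
    destruct HF0 as [F0 [N0 L0]]. exists F0. split; [exact N0|]. intros F HN Hi.
    rewrite Csum_RtoC, <- RtoC_minus, Cmod_R.
    pose proof (Rsum_incl g F0 F Hg N0 Hi).
    assert (Rsum g F <= M)%R by (apply M1; now exists F).
    rewrite Rabs_left1; lra.
Qed.

Lemma Rsummable_le {I} (f g : I -> R) K :
  (forall i, (0 <= f i)%R) -> (forall i, (f i <= K * g i)%R) -> Rsummable g -> Rsummable f.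
Proof.
  intros H0 Hle [Hg [B HB]]. split; [exact H0|]. exists (Rabs K * B)%R. intros F HN.
  eapply Rle_trans; [apply Rsum_le; intros i _; apply (Hle i)|]. rewrite Rsum_scal.
  eapply Rle_trans; [apply Rmult_le_compat_r; [now apply Rsum_ge0 | apply Rle_abs]|].
  apply Rmult_le_compat_l; [apply Rabs_pos | auto].
Qed.

Lemma summable_le {I} (f : I -> C) (g : I -> R) K :
  (forall i, (Cmod (f i) <= K * g i)%R) -> Rsummable g -> summable f.
Proof. intros H. apply (Rsummable_le _ _ K); [intros; apply Cmod_ge_0 | exact H]. Qed.

Lemma summable_has_sum {I} (f : I -> C) : summable f -> exists s, has_sum f s.
Proof.
  intros H.
  destruct (Rsummable_has_sum _ H) as [M HM].
  assert (P : forall p : C -> R, (forall z, Rabs (p z) <= Cmod z)%R ->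
     exists s, has_sum (fun i => RtoC (p (f i))) (RtoC s)).
  { intros p Hp.
    destruct (Rsummable_has_sum (fun i => Cmod (f i) + p (f i))%R) as [N HN].
    { apply (Rsummable_le _ (fun i => Cmod (f i)) 2); [| |exact H]; intros i;
      specialize (Hp (f i)); pose proof (Rle_abs (p (f i))); pose proof (Rle_abs (- p (f i)));
      rewrite Rabs_Ropp in *; lra. }
    exists (N - M)%R.
    apply (has_sum_ext (fun i => RtoC (Cmod (f i) + p (f i)) - RtoC (Cmod (f i)))).
    { intros i. rewrite RtoC_plus. ring. }
    rewrite RtoC_minus. now apply has_sum_minus. }
  destruct (P Re re_le_Cmod) as [x Hx].
  assert (HIm : forall z : C, (Rabs (Im z) <= Cmod z)%R).
  { intros z. eapply Rle_trans; [apply Rmax_r | apply Rmax_Cmod]. }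
  destruct (P Im HIm) as [y Hy].
  exists (RtoC x + Ci * RtoC y).
  apply (has_sum_ext (fun i => RtoC (Re (f i)) + Ci * RtoC (Im (f i)))).
  { intros i. destruct (f i) as [a b]. unfold Ci, RtoC, Cplus, Cmult. cbn. f_equal; ring. }
  apply has_sum_plus; [exact Hx | now apply has_sum_scal].
Qed.

(** A finite set of indices [i] is completed to a finite set of pairs by choosing over
    each [i] a finite set of [j] that contains a given one and sums closely to [g i];
    the errors add up to less than any given bound. *)
Lemma has_sum_fubini {I J} (f : I * J -> C) (g : I -> C) s :
  has_sum f s -> (forall i, has_sum (fun j => f (i, j)) (g i)) -> has_sum g s.
Proof.
  intros H Hg eps Heps. destruct (H (eps / 2)%R ltac:(lra)) as [F0 [N0 H0]].
  destruct (dedup (map fst F0)) as [I0 [NI HI]].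
  exists I0. split; [exact NI|]. intros F HN Hi.
  assert (G : forall dl, (0 < dl)%R -> forall F, NoDup F -> exists G, NoDup G /\
            (forall p, In p G -> In (fst p) F) /\
            (forall i j, In i F -> In j (map snd F0) -> In (i, j) G) /\
            (Cmod (Csum f G - Csum g F) <= INR (length F) * dl)%R).
  { clear -Hg. intros dl Hdl F HN. induction F as [|i F IH].
    - exists nil. repeat split; [constructor | tauto | intros i j [] |].
      cbn. rewrite Cmod_self. lra.
    - inversion_clear HN as [|? ? Hin HN']. destruct (IH HN') as [G [G1 [G2 [G3 G4]]]].
      destruct (Hg i dl Hdl) as [J0 [_ HJ]].
      destruct (union_list J0 (map snd F0)) as [J1 [J1N [J1a J1b]]].
      exists (map (fun j => (i, j)) J1 ++ G). repeat split.
      + apply NoDup_app; [| exact G1 |].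
        * apply FinFun.Injective_map_NoDup; [|exact J1N]. intros x y E. congruence.
        * intros p Hp Hp'. apply in_map_iff in Hp. destruct Hp as [j [<- _]].
          apply G2 in Hp'. contradiction.
      + intros p Hp. apply in_app_or in Hp. destruct Hp as [Hp|Hp].
        * apply in_map_iff in Hp. destruct Hp as [j [<- _]]. now left.
        * right. now apply G2.
      + intros i' j [<-|Hi'] Hj; apply in_or_app.
        * left. apply in_map_iff. exists j. split; auto.
        * right. now apply G3.
      + rewrite Csum_app, Csum_map, Csum_cons.
        replace (Csum (fun i0 : J => f (i, i0)) J1 + Csum f G - (g i + Csum g F))
          with ((Csum (fun i0 : J => f (i, i0)) J1 - g i) + (Csum f G - Csum g F)) by ring.
        eapply Rle_trans; [apply Cmod_triangle|]. specialize (HJ J1 J1N J1a).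
        cbn [length]. rewrite S_INR. lra. }
  pose proof (pos_INR (length F)) as PL.
  destruct (G (eps / 2 / (INR (length F) + 1))%R ltac:(apply Rdiv_lt_0_compat; lra) F HN) as [G0 [G1 [G2 [G3 G4]]]].
  assert (GI : incl F0 G0).
  { intros [i j] Hp. apply G3.
    - apply Hi, HI. now apply (in_map fst) in Hp.
    - now apply (in_map snd) in Hp. }
  specialize (H0 G0 G1 GI).
  replace (Csum g F - s) with ((Csum f G0 - s) - (Csum f G0 - Csum g F)) by ring.
  eapply Rle_lt_trans; [apply Cmod_triangle_minus|].
  assert (INR (length F) * (eps / 2 / (INR (length F) + 1)) < eps / 2)%R; [|lra].
  apply (Rmult_lt_reg_r (INR (length F) + 1)); [lra|].
  replace (INR (length F) * (eps / 2 / (INR (length F) + 1)) * (INR (length F) + 1))%R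
    with (INR (length F) * (eps / 2))%R by (field; lra). nra.
Qed.

Lemma has_sum_fubini_exchange {I J} (f : I -> J -> C) (g : I -> C) (h : J -> C) s t :
  summable (fun p : I * J => f (fst p) (snd p)) ->
  (forall i, has_sum (f i) (g i)) -> (forall j, has_sum (fun i => f i j) (h j)) ->
  has_sum g s -> has_sum h t -> s = t.
Proof.
  intros Hs Hg Hh Hgs Hht. destruct (summable_has_sum _ Hs) as [u Hu].
  assert (u = s) as <-.
  { eapply has_sum_unique; [|exact Hgs]. apply (has_sum_fubini _ _ _ Hu). exact Hg. }
  eapply has_sum_unique; [|exact Hht].
  apply (has_sum_fubini (fun p : J * I => f (snd p) (fst p))); [|exact Hh].
  apply (has_sum_reindex (fun p : J * I => (snd p, fst p)) (fun p => (snd p, fst p))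
           (fun p : I * J => f (fst p) (snd p))); [now intros [] | now intros [] | exact Hu].
Qed.

Lemma Rsummable_fibres {I J} (g : I * J -> R) (b : I -> R) :
  (forall p, (0 <= g p)%R) -> Rsummable b ->
  (forall i F, NoDup F -> (Rsum (fun j => g (i, j)) F <= b i)%R) -> Rsummable g.
Proof.
  intros Hg [Hb [B HB]] H. split; [exact Hg|].
  exists B. intros F HN.
  destruct (dedup (map fst F)) as [F1 [N1 I1]]. destruct (dedup (map snd F)) as [F2 [N2 I2]].
  apply Rle_trans with (Rsum g (list_prod F1 F2)).
  - apply Rsum_incl; [exact Hg | exact HN |].
    intros [i j] Hp. apply in_prod.
    + apply I1. now apply (in_map fst) in Hp.
    + apply I2. now apply (in_map snd) in Hp.
  - eapply Rle_trans; [|apply (HB F1 N1)]. clear - H N2.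
    induction F1 as [|i F1 IH]; [unfold Rsum; cbn; lra|].
    cbn [list_prod]. rewrite Rsum_app, Rsum_cons, Rsum_map.
    specialize (H i F2 N2). lra.
Qed.

Lemma Rsummable_prod {I J} (f : I -> R) (g : J -> R) :
  Rsummable f -> Rsummable g -> Rsummable (fun p : I * J => (f (fst p) * g (snd p))%R).
Proof.
  intros Hf [Hg [B HB]].
  assert (B0 : (0 <= B)%R) by (specialize (HB nil (NoDup_nil _)); exact HB).
  apply (Rsummable_fibres _ (fun i => B * f i)%R).
  - intros p. apply Rmult_le_pos; [apply Hf | apply Hg].
  - apply (Rsummable_le _ f B); [|intros; lra|exact Hf].
    intros i. apply Rmult_le_pos; [exact B0 | apply Hf].
  - intros i F HN. cbn [fst snd]. rewrite Rsum_scal, (Rmult_comm B).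
    apply Rmult_le_compat_l; [apply Hf | now apply HB].
Qed.

Lemma summable_prod {I J} (f : I -> C) (g : J -> C) :
  summable f -> summable g -> summable (fun p : I * J => f (fst p) * g (snd p)).
Proof.
  intros Hf Hg. apply (summable_le _ (fun p : I * J => (Cmod (f (fst p)) * Cmod (g (snd p)))%R) 1).
  - intros [i j]. cbn. rewrite Cmod_mult. lra.
  - now apply (Rsummable_prod (fun i => Cmod (f i)) (fun j => Cmod (g j))).
Qed.

Lemma summable_plus {I} (f g : I -> C) : summable f -> summable g -> summable (fun i => f i + g i).
Proof.
  intros [_ [A HA]] [_ [B HB]]. split; [intros; apply Cmod_ge_0|]. exists (A + B)%R. intros F HN.
  specialize (HA F HN). specialize (HB F HN).
  apply Rle_trans with (Rsum (fun i => Cmod (f i)) F + Rsum (fun i => Cmod (g i)) F)%R; [|lra].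
  clear. induction F as [|a F IH]; [cbn; lra|]. rewrite !Rsum_cons.
  pose proof (Cmod_triangle (f a) (g a)). lra.
Qed.

Lemma summable_ext {I} (f g : I -> C) : (forall i, f i = g i) -> summable f -> summable g.
Proof.
  intros E H. apply (summable_le _ (fun i => Cmod (f i)) 1); [|exact H].
  intros i. rewrite E. lra.
Qed.

Lemma Rsummable_reindex {I J} (h : I -> J) (f : J -> R) :
  (forall i i', h i = h i' -> i = i') -> Rsummable f -> Rsummable (fun i => f (h i)).
Proof.
  intros Hh [H0 [B HB]]. split; [auto|]. exists B. intros F HN. rewrite <- (Rsum_map h f).
  apply HB. now apply FinFun.Injective_map_NoDup.
Qed.

Lemma summable_reindex {I J} (h : I -> J) (f : J -> C) :
  (forall i i', h i = h i' -> i = i') -> summable f -> summable (fun i => f (h i)).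
Proof. intros Hh. apply (Rsummable_reindex h (fun j => Cmod (f j)) Hh). Qed.

Lemma Rsummable_tail {I} (g : I -> R) (eps : R) : Rsummable g -> (0 < eps)%R ->
  exists F0, NoDup F0 /\
    forall F, NoDup F -> (forall i, In i F -> ~ In i F0) -> (Rsum g F <= eps)%R.
Proof.
  intros Hs Heps. destruct (Rsummable_has_sum g Hs) as [M HM].
  destruct (HM (eps / 2)%R ltac:(lra)) as [F0 [N0 H0]]. exists F0. split; [exact N0|].
  intros F HN Hd.
  pose proof (H0 F0 N0 (incl_refl F0)) as A.
  assert (N : NoDup (F0 ++ F)).
  { apply NoDup_app; auto. intros i Hi Hi'. now apply (Hd i). }
  pose proof (H0 (F0 ++ F) N (incl_appl _ (incl_refl F0))) as A'.
  rewrite Csum_RtoC, <- RtoC_minus, Cmod_R in A, A'. rewrite Rsum_app in A'.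
  apply Rabs_def2 in A. apply Rabs_def2 in A'. lra.
Qed.

Lemma has_sum_tail {I} (f : I -> C) s F0 (B : R) :
  has_sum f s -> NoDup F0 ->
  (forall F, NoDup F -> (forall i, In i F -> ~ In i F0) -> (Rsum (fun i => Cmod (f i)) F <= B)%R) ->
  (Cmod (s - Csum f F0) <= B)%R.
Proof.
  intros H N0 HB. apply Rnot_lt_le. intros L.
  destruct (H (Cmod (s - Csum f F0) - B)%R ltac:(lra)) as [F [_ HF]].
  destruct (union_list F F0) as [G [G1 [G2 G3]]].
  specialize (HF G G1 G2).
  destruct (incl_complement F0 G N0 G3) as [F' HF'].
  assert (N' : NoDup (F0 ++ F')) by (eapply Permutation_NoDup; eauto).
  assert (T : (Rsum (fun i => Cmod (f i)) F' <= B)%R).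
  { apply HB; [now apply NoDup_app_remove_l in N'|].
    intros i Hi. now apply (NoDup_app_not_in F0 F'). }
  rewrite (Csum_perm _ _ _ HF'), Csum_app in HF.
  pose proof (Cmod_Csum f F') as T'.
  replace (s - Csum f F0) with (Csum f F' - (Csum f F0 + Csum f F' - s)) in L, HF by ring.
  pose proof (Cmod_triangle_minus (Csum f F') (Csum f F0 + Csum f F' - s)) as T2.
  replace (s - Csum f F0) with (Csum f F' - (Csum f F0 + Csum f F' - s)) in T2 by ring.
  lra.
Qed.

Lemma cderiv_Csum {I} (f : I -> C -> C) (f' : I -> C) x F :
  (forall i, In i F -> cderiv (f i) x (f' i)) -> cderiv (fun t => Csum (fun i => f i t) F) x (Csum f' F).
Proof.
  induction F as [|a F IH]; intros H; [exact (cderiv_const 0 x)|].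
  apply (cderiv_plus (f a) (fun t => Csum (fun i => f i t) F)).
  - apply H. now left.
  - apply IH. intros i Hi. apply H. now right.
Qed.

(** Termwise differentiation: it suffices that the terms are, with finitely many
    exceptions, Lipschitz around [x] with summable constants. *)
Lemma cderiv_has_sum {I} (f : I -> C -> C) (f' : I -> C) (F : C -> C) (x l : C) (L : list I) (M : I -> R) :
  near x (fun t => has_sum (fun i => f i t) (F t)) ->
  (forall i, cderiv (f i) x (f' i)) -> has_sum f' l ->
  Rsummable M -> (forall i, ~ In i L -> (Cmod (f' i) <= M i)%R) ->
  near x (fun t => forall i, ~ In i L -> (Cmod (f i t - f i x) <= M i * Cmod (t - x))%R) ->
  cderiv F x l.
Proof.
  intros HF Hf Hl HM Hf' HL eps Heps.
  destruct (Rsummable_tail M (eps / 4)%R HM ltac:(lra)) as [F0 [N0 H0]].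
  destruct (union_list F0 L) as [F1 [N1 [I0 IL]]].
  destruct (cderiv_Csum f f' x F1 (fun i _ => Hf i) (eps / 2)%R ltac:(lra)) as [d1 [Hd1 H1]].
  destruct (near_and _ _ _ (near_and _ _ _ HF HL) (ex_intro _ d1 (conj Hd1 H1))) as [d [Hd H]].
  exists d. split; [exact Hd|]. intros t Ht. destruct (H t Ht) as [[A B] D].
  pose proof (near_self _ _ HF) as A0. cbv beta in A0.
  set (g := fun i => f i t - f i x - (t - x) * f' i).
  assert (G : has_sum g (F t - F x - (t - x) * l)).
  { apply has_sum_minus; [now apply has_sum_minus | now apply has_sum_scal]. }
  assert (T : (Cmod (F t - F x - (t - x) * l - Csum g F1) <= eps / 2 * Cmod (t - x))%R).
  { apply (has_sum_tail g _ F1); auto. intros K NK HK.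
    apply Rle_trans with (Rsum (fun i => 2 * Cmod (t - x) * M i)%R K).
    - apply Rsum_le. intros i Hi.
      assert (Hi' : ~ In i L) by (intros Hin; apply (HK i Hi), IL, Hin).
      unfold g. eapply Rle_trans; [apply Cmod_triangle_minus|]. rewrite Cmod_mult.
      specialize (B i Hi'). specialize (Hf' i Hi'). pose proof (Cmod_ge_0 (t - x)). nra.
    - rewrite Rsum_scal. assert (Rsum M K <= eps / 4)%R.
      { apply H0; auto. intros i Hi Hi0. apply (HK i Hi), I0, Hi0. }
      pose proof (Cmod_ge_0 (t - x)). nra. }
  assert (E : Csum g F1 = Csum (fun i => f i t) F1 - Csum (fun i => f i x) F1 - Csum f' F1 * (t - x)).
  { unfold g. rewrite (Csum_ext_in _ (fun i => (f i t + (- (1)) * f i x) + - (t - x) * f' i))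
      by (intros; ring).
    rewrite !Csum_plus, !Csum_scal. ring. }
  replace (F t - F x - l * (t - x)) with ((F t - F x - (t - x) * l - Csum g F1) + Csum g F1) by ring.
  eapply Rle_trans; [apply Cmod_triangle|]. rewrite E in *. lra.
Qed.

(** ** Sums over the integers *)

Fixpoint zball (n : nat) : list Z :=
  match n with
  | O => 0%Z :: nil
  | S k => Z.of_nat n :: (- Z.of_nat n)%Z :: zball k
  end.

Lemma in_zball n z : In z (zball n) <-> (Z.abs z <= Z.of_nat n)%Z.
Proof.
  induction n as [|n IH]; [cbn; lia|].
  change (In z (zball (S n))) with (Z.of_nat (S n) = z \/ (- Z.of_nat (S n))%Z = z \/ In z (zball n)).
  rewrite IH. lia.
Qed.

Lemma NoDup_zball n : NoDup (zball n).
Proof.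
  induction n as [|n IH]; [repeat constructor; tauto|].
  change (NoDup (Z.of_nat (S n) :: (- Z.of_nat (S n))%Z :: zball n)).
  constructor; [|constructor; [|exact IH]].
  - intros [E|Hi]; [lia|]. apply in_zball in Hi. lia.
  - intros Hi. apply in_zball in Hi. lia.
Qed.

Lemma incl_zball (F : list Z) : exists n, incl F (zball n).
Proof.
  induction F as [|a F [n Hn]]; [exists O; intros ? []|].
  exists (Nat.max n (Z.abs_nat a)). intros z [<-|Hz]; apply in_zball; [lia|].
  apply Hn, in_zball in Hz. lia.
Qed.

(** The families that are used have terms bounded by differences of a
    nonnegative sequence in the absolute value of the index, whose sum telescopes. *)
Lemma Rsummable_telescope (f : Z -> R) (h : nat -> R) :
  (forall z, (0 <= f z)%R) -> (forall n, (0 <= h n)%R) ->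
  (forall n, (f (Z.of_nat (S n)) <= h n - h (S n))%R /\ (f (- Z.of_nat (S n))%Z <= h n - h (S n))%R) ->
  Rsummable f.
Proof.
  intros Hf Hh H. split; [exact Hf|]. exists (f 0%Z + 2 * h O)%R. intros F HN.
  destruct (incl_zball F) as [n Hn].
  eapply Rle_trans; [apply (Rsum_incl f F (zball n)); auto|].
  apply Rle_trans with (f 0%Z + 2 * (h O - h n))%R; [|specialize (Hh n); lra].
  clear - H. induction n as [|n IH]; [cbn; lra|].
  change (Rsum f (zball (S n))) with (f (Z.of_nat (S n)) + (f (- Z.of_nat (S n))%Z + Rsum f (zball n)))%R.
  specialize (H n). lra.
Qed.

Lemma Rsummable_geometric (r : R) : (0 <= r < 1)%R -> Rsummable (fun n : Z => (r ^ Z.abs_nat n)%R).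
Proof.
  intros Hr. apply (Rsummable_telescope _ (fun n => r * (r ^ n) / (1 - r))%R).
  - intros z. apply pow_le. lra.
  - intros n. apply Rmult_le_pos; [|left; apply Rinv_0_lt_compat; lra].
    apply Rmult_le_pos; [lra | apply pow_le; lra].
  - intros n. replace (Z.abs_nat (Z.of_nat (S n))) with (S n) by lia.
    replace (Z.abs_nat (- Z.of_nat (S n))) with (S n) by lia.
    assert (E : (r * r ^ n / (1 - r) - r * r ^ S n / (1 - r) = r ^ S n)%R) by (cbn; field; lra).
    rewrite E. lra.
Qed.

Lemma has_sum_shift (f : Z -> C) (k : Z) s : has_sum f s -> has_sum (fun n => f (n + k)%Z) s.
Proof.
  apply (has_sum_reindex (fun n => n + k)%Z (fun n => n - k)%Z); intros; ring.
Qed.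

Lemma has_sum_neg (f : Z -> C) s : has_sum f s -> has_sum (fun n => f (- n)%Z) s.
Proof.
  apply (has_sum_reindex Z.opp Z.opp); intros; ring.
Qed.

Lemma has_sum_odd (f : Z -> C) s : (forall n, f (- n)%Z = - f n) -> has_sum f s -> s = 0.
Proof.
  intros Ho H.
  assert (E : s = - s).
  { apply (has_sum_unique (fun n => f (- n)%Z)); [now apply has_sum_neg|].
    apply (has_sum_ext (fun n => - f n)); [intros; now rewrite Ho | now apply has_sum_opp]. }
  replace s with (/ 2 * (s - - s)) by (field; cnum). rewrite <- E. ring.
Qed.

(** * The exponential and trigonometric functions of [2 pi i x] *)

Definition cexp (z : C) : C := ((exp (Re z) * cos (Im z))%R, (exp (Re z) * sin (Im z))%R).

Lemma C_eq (x y : C) : Re x = Re y -> Im x = Im y -> x = y.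
Proof. destruct x, y. cbn. now intros -> ->. Qed.

Lemma Im_plus (x y : C) : Im (x + y) = (Im x + Im y)%R.
Proof. reflexivity. Qed.

Lemma Im_opp (x : C) : Im (- x) = (- Im x)%R.
Proof. reflexivity. Qed.

Lemma Re_opp (x : C) : Re (- x) = (- Re x)%R.
Proof. reflexivity. Qed.

Lemma Im_minus (x y : C) : Im (x - y) = (Im x - Im y)%R.
Proof. reflexivity. Qed.

Lemma im_le_Cmod (z : C) : (Rabs (Im z) <= Cmod z)%R.
Proof. eapply Rle_trans; [apply Rmax_r | apply Rmax_Cmod]. Qed.

Lemma Cmod_le_Re_Im (z : C) : (Cmod z <= Rabs (Re z) + Rabs (Im z))%R.
Proof.
  replace z with (RtoC (Re z) + RtoC (Im z) * Ci) at 1.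
  - eapply Rle_trans; [apply Cmod_triangle|]. rewrite Cmod_mult, !Cmod_R, Cmod_Ci. lra.
  - apply C_eq; destruct z; unfold RtoC, Ci, Cplus, Cmult; cbn; ring.
Qed.

Lemma cexp_plus (x y : C) : cexp (x + y) = cexp x * cexp y.
Proof.
  unfold cexp. rewrite re_plus, Im_plus, exp_plus, cos_plus, sin_plus.
  apply C_eq; unfold Cmult; cbn; ring.
Qed.

Lemma cexp_0 : cexp 0 = 1.
Proof. unfold cexp. cbn. rewrite exp_0, cos_0, sin_0. apply C_eq; cbn; ring. Qed.

Lemma Cmod_cexp (z : C) : Cmod (cexp z) = exp (Re z).
Proof.
  assert (H : (Cmod (cexp z) ^ 2 = exp (Re z) ^ 2)%R).
  { rewrite Cmod2_alt. unfold cexp. cbn [Re Im fst snd].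
    pose proof (sin2_cos2 (Im z)) as E. unfold Rsqr in E. nra. }
  pose proof (Cmod_ge_0 (cexp z)). pose proof (exp_pos (Re z)). nra.
Qed.

Lemma derivable_at_0 (f : R -> R) (l : R) : derivable_pt_lim f 0 l ->
  forall eps, (0 < eps)%R -> exists d, (0 < d)%R /\
    forall h, (Rabs h < d)%R -> (Rabs (f h - f 0 - l * h) <= eps * Rabs h)%R.
Proof.
  intros H eps Heps. destruct (H eps Heps) as [[d Hd] Hf]. exists d. split; [exact Hd|].
  intros h Hh. destruct (Req_dec h 0) as [->|N].
  - rewrite Rmult_0_r, Rabs_R0, Rminus_0_r, Rminus_diag, Rabs_R0. lra.
  - specialize (Hf h N Hh). rewrite Rplus_0_l in Hf.
    replace (f h - f 0 - l * h)%R with (((f h - f 0) / h - l) * h)%R by (field; exact N).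
    rewrite Rabs_mult. apply Rmult_le_compat_r; [apply Rabs_pos | lra].
Qed.

Lemma cderiv_cexp (z : C) : cderiv cexp z (cexp z).
Proof.
  assert (H0 : forall eps, (0 < eps)%R -> exists d, (0 < d)%R /\
     forall h : C, (Cmod h < d)%R -> (Cmod (cexp h - 1 - h) <= eps * Cmod h)%R).
  { intros eps Heps. set (e1 := Rmin 1 (eps / 16)).
    assert (He1 : (0 < e1)%R) by (apply Rmin_glb_lt; lra).
    assert (He2 : (e1 <= 1)%R) by apply Rmin_l. assert (He3 : (e1 <= eps / 16)%R) by apply Rmin_r.
    destruct (derivable_at_0 exp 1 ltac:(pose proof (derivable_pt_lim_exp 0) as T; rewrite exp_0 in T; exact T) e1 He1) as [d1 [Hd1 A]].
    destruct (derivable_at_0 cos 0 ltac:(pose proof (derivable_pt_lim_cos 0) as T; rewrite sin_0, Ropp_0 in T; exact T) e1 He1) as [d2 [Hd2 B]].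
    destruct (derivable_at_0 sin 1 ltac:(pose proof (derivable_pt_lim_sin 0) as T; rewrite cos_0 in T; exact T) e1 He1) as [d3 [Hd3 D]].
    rewrite exp_0 in A. rewrite cos_0 in B. rewrite sin_0 in D.
    exists (Rmin e1 (Rmin d1 (Rmin d2 d3))). split; [repeat apply Rmin_glb_lt; lra|].
    intros h Hh.
    pose proof (Rmin_l e1 (Rmin d1 (Rmin d2 d3))). pose proof (Rmin_r e1 (Rmin d1 (Rmin d2 d3))).
    pose proof (Rmin_l d1 (Rmin d2 d3)). pose proof (Rmin_r d1 (Rmin d2 d3)).
    pose proof (Rmin_l d2 d3). pose proof (Rmin_r d2 d3).
    pose proof (re_le_Cmod h) as HR. pose proof (im_le_Cmod h) as HI.
    pose proof (Cmod_ge_0 h) as HC.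
    set (x := Re h) in *. set (y := Im h) in *.
    specialize (A x ltac:(lra)). specialize (B y ltac:(lra)). specialize (D y ltac:(lra)).
    replace (exp x - 1 - 1 * x)%R with (exp x - 1 - x)%R in A by ring.
    replace (cos y - 1 - 0 * y)%R with (cos y - 1)%R in B by ring.
    replace (sin y - 0 - 1 * y)%R with (sin y - y)%R in D by ring.
    pose proof (Rabs_pos x). pose proof (Rabs_pos y).
    assert (X : (Rabs (exp x - 1) <= 2 * Rabs x)%R).
    { replace (exp x - 1)%R with ((exp x - 1 - x) + x)%R by ring.
      eapply Rle_trans; [apply Rabs_triang|]. nra. }
    assert (X3 : (Rabs (exp x) <= 3)%R).
    { replace (exp x) with ((exp x - 1) + 1)%R by ring.
      eapply Rle_trans; [apply Rabs_triang|]. rewrite Rabs_R1. lra. }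
    assert (R1 : (Rabs (Re (cexp h - 1 - h)%C) <= 4 * e1 * Cmod h)%R).
    { replace (Re (cexp h - 1 - h)%C) with ((exp x - 1 - x) + exp x * (cos y - 1))%R.
      2:{ unfold cexp. fold x y. subst x y. destruct h. unfold Cminus, Cplus, Copp. cbn. ring. }
      eapply Rle_trans; [apply Rabs_triang|]. rewrite Rabs_mult.
      assert (Rabs (exp x) * Rabs (cos y - 1) <= 3 * (e1 * Rabs y))%R
        by (apply Rmult_le_compat; auto using Rabs_pos).
      nra. }
    assert (R2 : (Rabs (Im (cexp h - 1 - h)%C) <= 5 * e1 * Cmod h)%R).
    { replace (Im (cexp h - 1 - h)%C) with (exp x * (sin y - y) + (exp x - 1) * y)%R.
      2:{ unfold cexp. fold x y. subst x y. destruct h. unfold Cminus, Cplus, Copp. cbn. ring. }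
      eapply Rle_trans; [apply Rabs_triang|]. rewrite !Rabs_mult.
      assert (Rabs (exp x) * Rabs (sin y - y) <= 3 * (e1 * Rabs y))%R
        by (apply Rmult_le_compat; auto using Rabs_pos).
      assert (Rabs (exp x - 1) * Rabs y <= 2 * e1 * Rabs y)%R
        by (apply Rmult_le_compat_r; lra).
      nra. }
    eapply Rle_trans; [apply Cmod_le_Re_Im|]. nra. }
  intros eps Heps. pose proof (Cmod_ge_0 (cexp z)) as E0.
  destruct (H0 (eps / (Cmod (cexp z) + 1))%R) as [d [Hd H]]; [apply Rdiv_lt_0_compat; lra|].
  exists d. split; [exact Hd|]. intros y Hy. specialize (H (y - z) Hy).
  replace (cexp y) with (cexp z * cexp (y - z)) by (rewrite <- cexp_plus; f_equal; ring).
  replace (cexp z * cexp (y - z) - cexp z - cexp z * (y - z))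
    with (cexp z * (cexp (y - z) - 1 - (y - z))) by ring.
  rewrite Cmod_mult.
  eapply Rle_trans; [apply Rmult_le_compat_l; [exact E0 | exact H]|].
  pose proof (Cmod_ge_0 (y - z)).
  replace (Cmod (cexp z) * (eps / (Cmod (cexp z) + 1) * Cmod (y - z)))%R
    with (Cmod (cexp z) / (Cmod (cexp z) + 1) * (eps * Cmod (y - z)))%R by (field; lra).
  rewrite <- (Rmult_1_l (eps * Cmod (y - z))) at 2. apply Rmult_le_compat_r; [nra|].
  apply (Rmult_le_reg_r (Cmod (cexp z) + 1)); [lra|].
  unfold Rdiv. rewrite Rmult_assoc, Rinv_l by lra. lra.
Qed.

Definition pii : C := PI * Ci.
(** Normalized to have period 1. *)
Definition qe (x : C) : C := cexp (2 * pii * x).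

Lemma pii_neq : pii <> 0.
Proof. apply Cmult_neq_0; [apply RtoC_neq; pose proof PI_RGT_0; lra | apply Ci_nz]. Qed.

Lemma qe_plus (x y : C) : qe (x + y) = qe x * qe y.
Proof. unfold qe. rewrite <- cexp_plus. f_equal. ring. Qed.

Lemma qe_0 : qe 0 = 1.
Proof. unfold qe. rewrite Cmult_0_r. apply cexp_0. Qed.

Lemma qe_neq_0 (x : C) : qe x <> 0.
Proof. apply Cmod_pos_neq. unfold qe. rewrite Cmod_cexp. apply exp_pos. Qed.

Lemma qe_opp (x : C) : qe (- x) = / qe x.
Proof.
  assert (H : qe x * qe (- x) = 1) by (rewrite <- qe_plus, <- qe_0; f_equal; ring).
  pose proof (qe_neq_0 x) as N.
  replace (qe (- x)) with (/ qe x * (qe x * qe (- x))) by (field; exact N). rewrite H. ring.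
Qed.

Lemma two_pii_mult (x : C) :
  Re (2 * pii * x) = (- (2 * PI * Im x))%R /\ Im (2 * pii * x) = (2 * PI * Re x)%R.
Proof. destruct x. unfold pii, RtoC, Ci, Cmult. cbn. split; ring. Qed.

Lemma Cmod_qe (x : C) : Cmod (qe x) = exp (- (2 * PI * Im x)).
Proof. unfold qe. now rewrite Cmod_cexp, (proj1 (two_pii_mult x)). Qed.

Lemma qe_half : qe (/ 2) = - (1).
Proof.
  unfold qe, cexp. destruct (two_pii_mult (/ 2)) as [-> ->].
  rewrite <- RtoC_inv by lra. rewrite im_RtoC, re_RtoC.
  replace (- (2 * PI * 0))%R with 0%R by ring. replace (2 * PI * / 2)%R with PI by field.
  rewrite exp_0, cos_PI, sin_PI. apply C_eq; cbn; ring.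
Qed.

Lemma qe_1 : qe 1 = 1.
Proof.
  replace (RtoC 1) with (/ 2 + / 2) at 1 by (field; cnum).
  rewrite qe_plus, qe_half. ring.
Qed.

Lemma qe_IZR (m : Z) : qe (RtoC (IZR m)) = 1.
Proof.
  assert (N : forall n : nat, qe (RtoC (INR n)) = 1).
  { induction n as [|n IH]; [exact qe_0|].
    rewrite S_INR, RtoC_plus, qe_plus, IH, qe_1. ring. }
  destruct (Z_le_gt_dec 0 m) as [H|H].
  - rewrite <- (Z2Nat.id m H), <- INR_IZR_INZ. apply N.
  - replace m with (- Z.of_nat (Z.to_nat (- m)))%Z by lia.
    rewrite opp_IZR, <- INR_IZR_INZ, RtoC_opp, qe_opp, N. field.
Qed.

Lemma qe_eq_1 (x : C) : qe x = 1 -> exists m : Z, x = RtoC (IZR m).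
Proof.
  intros H.
  assert (HI : Im x = 0%R).
  { assert (E : Cmod (qe x) = 1%R) by (rewrite H; apply Cmod_1). rewrite Cmod_qe in E.
    rewrite <- exp_0 in E. apply exp_inv in E. pose proof PI_RGT_0. nra. }
  assert (HR : cos (2 * (PI * Re x)) = 1%R).
  { assert (E : Re (qe x) = 1%R) by (rewrite H; reflexivity).
    unfold qe, cexp in E. destruct (two_pii_mult x) as [E1 E2]. rewrite E1, E2, HI in E.
    cbn [Re fst] in E. replace (- (2 * PI * 0))%R with 0%R in E by ring.
    rewrite exp_0, Rmult_1_l, Rmult_assoc in E. exact E. }
  rewrite cos_2a_sin in HR.
  assert (HS : sin (PI * Re x) = 0%R) by nra.
  apply sin_eq_0_0 in HS. destruct HS as [k Hk]. exists k.
  pose proof PI_RGT_0. apply C_eq; [cbn|exact HI]. 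
  apply (Rmult_eq_reg_l PI); lra.
Qed.

Lemma cderiv_qe (x : C) : cderiv qe x (2 * pii * qe x).
Proof.
  eapply cderiv_eq; [apply (cderiv_comp (fun y => 2 * pii * y) cexp)|].
  - apply cderiv_scal, cderiv_id.
  - apply cderiv_cexp.
  - unfold qe. ring.
Qed.

Lemma qe_neq_1_near x : qe x <> 1 -> near x (fun y => qe y <> 1).
Proof. apply near_neq. eapply cderiv_ccont. apply cderiv_qe. Qed.

(** In terms of the usual functions, [ct x] is pi cot (pi x), and [sq], [sq1],
    [sq2] are pi^2 / sin^2 (pi x) and its first two derivatives. *)
Definition ct (x : C) : C := pii * (qe x + 1) / (qe x - 1).
Definition sq (x : C) : C := 4 * pii ^ 2 * qe x / (qe x - 1) ^ 2.
Definition sq1 (x : C) : C := - 2 * ct x * sq x.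
Definition sq2 (x : C) : C := 6 * sq x ^ 2 + 4 * pii ^ 2 * sq x.

Lemma qe_minus_1 (x : C) : qe x <> 1 -> qe x - 1 <> 0.
Proof. apply Cminus_eq_contra. Qed.

Lemma ct_square (x : C) : qe x <> 1 -> ct x ^ 2 = sq x + pii ^ 2.
Proof. intros H. apply qe_minus_1 in H. unfold ct, sq. field. exact H. Qed.

Lemma cderiv_ct (x : C) : qe x <> 1 -> cderiv ct x (- sq x).
Proof.
  intros H. apply qe_minus_1 in H.
  assert (D : cderiv (fun y => qe y - 1) x (2 * pii * qe x)).
  { eapply cderiv_eq; [apply cderiv_minus; [apply cderiv_qe | apply cderiv_const]|]. ring. }
  apply (cderiv_ext_near (fun y => pii + 2 * pii * / (qe y - 1))).
  - apply (near_imp x (fun y => qe y - 1 <> 0)).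
    + intros y Hy. unfold ct. field. exact Hy.
    + apply (near_neq (fun y => qe y - 1)); [eapply cderiv_ccont; exact D | exact H].
  - eapply cderiv_eq.
    + apply cderiv_plus; [apply cderiv_const|]. apply cderiv_scal.
      apply (cderiv_inv (fun y => qe y - 1)); [exact H | exact D].
    + unfold sq. field. exact H.
Qed.

Lemma cderiv_sq (x : C) : qe x <> 1 -> cderiv sq x (sq1 x).
Proof.
  intros H.
  assert (D : cderiv (fun y => ct y * ct y - pii ^ 2) x (sq1 x)).
  { eapply cderiv_eq.
    - apply cderiv_minus; [apply cderiv_mult; apply cderiv_ct; exact H | apply cderiv_const].
    - unfold sq1. ring. }
  apply (cderiv_ext_near (fun y => ct y * ct y - pii ^ 2)); [|exact D].
  apply (near_imp x (fun y => qe y <> 1)).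
  - intros y Hy. pose proof (ct_square y Hy) as E.
    replace (ct y * ct y) with (ct y ^ 2) by ring. rewrite E. ring.
  - now apply qe_neq_1_near.
Qed.

Lemma cderiv_sq1 (x : C) : qe x <> 1 -> cderiv sq1 x (sq2 x).
Proof.
  intros H. unfold sq1. eapply cderiv_eq.
  - apply cderiv_mult; [apply cderiv_scal, cderiv_ct, H | apply cderiv_sq, H].
  - unfold sq2, sq1. cbv beta. replace (- 2 * ct x * (- 2 * ct x * sq x)) with (4 * ct x ^ 2 * sq x) by ring.
    rewrite (ct_square x H). ring.
Qed.

Lemma qe_opp_neq (x : C) : qe x <> 1 -> qe (- x) <> 1.
Proof.
  intros H E. apply H. rewrite qe_opp in E. pose proof (qe_neq_0 x) as N.
  replace (qe x) with (/ / qe x) by (field; exact N). rewrite E. field.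
Qed.

Lemma ct_opp (x : C) : qe x <> 1 -> ct (- x) = - ct x.
Proof.
  intros H. pose proof (qe_neq_0 x). pose proof (qe_minus_1 x H).
  unfold ct. rewrite qe_opp. field. repeat split; auto.
  intros E. apply H1. replace (qe x - 1) with (- (1 - qe x)) by ring. rewrite E. ring.
Qed.

Lemma sq_opp (x : C) : qe x <> 1 -> sq (- x) = sq x.
Proof.
  intros H. pose proof (qe_neq_0 x). pose proof (qe_minus_1 x H).
  unfold sq. rewrite qe_opp. field. repeat split; auto.
  intros E. apply H1. replace (qe x - 1) with (- (1 - qe x)) by ring. rewrite E. ring.
Qed.

Lemma sq1_opp (x : C) : qe x <> 1 -> sq1 (- x) = - sq1 x.
Proof. intros H. unfold sq1. rewrite ct_opp, sq_opp by exact H. ring. Qed.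

Lemma sq2_opp (x : C) : qe x <> 1 -> sq2 (- x) = sq2 x.
Proof. intros H. unfold sq2. rewrite sq_opp by exact H. ring. Qed.

(** Periodicity, in the form that is applied to points moved by a lattice vector. *)
Lemma ct_qe (x y : C) : qe x = qe y -> ct x = ct y.
Proof. unfold ct. now intros ->. Qed.

Lemma sq_qe (x y : C) : qe x = qe y -> sq x = sq y.
Proof. unfold sq. now intros ->. Qed.

Lemma sq1_qe (x y : C) : qe x = qe y -> sq1 x = sq1 y.
Proof. unfold sq1, ct, sq. now intros ->. Qed.

Lemma qe_minus_neq (x y : C) : qe (x - y) <> 1 -> qe x - qe y <> 0.
Proof.
  intros H E. apply H. unfold Cminus. rewrite qe_plus, qe_opp.
  pose proof (qe_neq_0 y) as N. apply Ceq_minus in E. rewrite E. field. exact N.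
Qed.

(** Partial fractions of a product of two translates of 1/sin^2, obtained by
    differentiating the addition theorem of the cotangent in both arguments. *)
Lemma sq_mult_sq (x y : C) : qe x <> 1 -> qe y <> 1 -> qe (x - y) <> 1 ->
  sq x * sq y = sq (x - y) * (sq x + sq y) + sq1 (x - y) * (ct y - ct x).
Proof.
  intros Hx Hy Hd. pose proof (qe_minus_neq x y Hd).
  pose proof (qe_minus_1 x Hx). pose proof (qe_minus_1 y Hy). pose proof (qe_neq_0 y).
  unfold sq1, sq, ct.
  replace (qe (x - y)) with (qe x / qe y) by (unfold Cminus; rewrite qe_plus, qe_opp; reflexivity).
  field. repeat split; auto.
Qed.

Lemma sq1_mult_ct (x y : C) : qe x <> 1 -> qe y <> 1 -> qe (x - y) <> 1 ->
  sq1 x * ct y = sq x * sq y + sq (x - y) * (sq x - sq y) - ct (x - y) * sq1 x.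
Proof.
  intros Hx Hy Hd. pose proof (qe_minus_neq x y Hd).
  pose proof (qe_minus_1 x Hx). pose proof (qe_minus_1 y Hy). pose proof (qe_neq_0 y).
  unfold sq1, sq, ct.
  replace (qe (x - y)) with (qe x / qe y) by (unfold Cminus; rewrite qe_plus, qe_opp; reflexivity).
  field. repeat split; auto.
Qed.

(** ** Decay away from the real axis *)

Definition decay (x : C) : R := exp (- (2 * PI * Rabs (Im x))).
(** Any constant large enough for the four estimates of [trig_decay_upper]. *)
Definition decay_const : R := 409600%R.

Lemma Cmod_pii : Cmod pii = PI.
Proof. unfold pii. rewrite Cmod_mult, Cmod_R, Cmod_Ci, Rabs_pos_eq; [ring | left; apply PI_RGT_0]. Qed.

Lemma trig_small (x : C) : (Cmod (qe x) <= / 2)%R ->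
  (Cmod (sq x) <= 16 * PI ^ 2 * Cmod (qe x))%R /\
  (Cmod (ct x + pii) <= 4 * PI * Cmod (qe x))%R.
Proof.
  intros H. set (v := Cmod (qe x)) in *.
  assert (D : (/ 2 <= Cmod (qe x - 1))%R).
  { pose proof (Cmod_triangle_rev 1 (qe x)) as T. rewrite Cmod_1, Cmod_minus_sym in T. fold v in T. lra. }
  assert (N : qe x - 1 <> 0) by (apply Cmod_pos_neq; lra).
  assert (DI : (/ Cmod (qe x - 1) <= 2)%R).
  { rewrite <- (Rinv_inv 2). apply Rinv_le_contravar; lra. }
  assert (DP : (0 < / Cmod (qe x - 1))%R) by (apply Rinv_0_lt_compat; lra).
  pose proof PI_RGT_0 as HP. assert (Hv : (0 <= v)%R) by apply Cmod_ge_0.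
  set (i := (/ Cmod (qe x - 1))%R) in *.
  split.
  - assert (E : Cmod (sq x) = (4 * PI ^ 2 * v * (i * i))%R).
    { unfold sq. rewrite Cmod_div by now apply Cpow_nz.
      rewrite !Cmod_mult, !Cmod_pow, Cmod_pii, Cmod_R, Rabs_pos_eq by lra.
      unfold i. fold v. field. apply Cmod_gt_0 in N. lra. }
    rewrite E. assert (i * i <= 4)%R by nra.
    assert (0 <= 4 * PI ^ 2 * v)%R by nra. nra.
  - assert (E : Cmod (ct x + pii) = (2 * PI * v * i)%R).
    { replace (ct x + pii) with (2 * pii * qe x / (qe x - 1)) by (unfold ct; field; exact N).
      rewrite Cmod_div by exact N. rewrite !Cmod_mult, Cmod_pii, Cmod_R, Rabs_pos_eq by lra.
      reflexivity. }
    rewrite E. assert (0 <= 2 * PI * v)%R by nra. nra.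
Qed.

Lemma exp_le_half (t : R) : (1 <= t)%R -> (exp (- (2 * PI * t)) <= / 2)%R.
Proof.
  intros Ht. rewrite exp_Ropp. apply Rinv_le_contravar; [lra|].
  pose proof PI2_1. pose proof (exp_ineq1_le (2 * PI * t)).
  assert (1 * 1 <= PI * t)%R by (apply Rmult_le_compat; lra). lra.
Qed.

Lemma trig_decay_upper (x : C) : (1 <= Im x)%R ->
  (Cmod (sq x) <= decay_const * decay x)%R /\ (Cmod (sq1 x) <= decay_const * decay x)%R /\
  (Cmod (sq2 x) <= decay_const * decay x)%R /\ (Cmod (ct x + pii) <= decay_const * decay x)%R.
Proof.
  intros H. unfold decay. rewrite Rabs_pos_eq by lra.
  pose proof (exp_le_half (Im x) H) as Hv. rewrite <- Cmod_qe in *.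
  destruct (trig_small x Hv) as [A B].
  set (v := Cmod (qe x)) in *. assert (Hv0 : (0 <= v)%R) by apply Cmod_ge_0.
  pose proof PI_RGT_0 as HP. pose proof PI_4 as HP4.
  assert (P2 : (PI ^ 2 <= 16)%R) by nra.
  assert (A' : (Cmod (sq x) <= 256 * v)%R) by (eapply Rle_trans; [exact A|]; apply Rmult_le_compat_r; lra).
  assert (B' : (Cmod (ct x + pii) <= 16 * v)%R) by (eapply Rle_trans; [exact B|]; apply Rmult_le_compat_r; lra).
  assert (Cb : (Cmod (ct x) <= 12)%R).
  { replace (ct x) with ((ct x + pii) - pii) by ring.
    eapply Rle_trans; [apply Cmod_triangle_minus|]. rewrite Cmod_pii. lra. }
  pose proof (Cmod_ge_0 (sq x)) as S0. pose proof (Cmod_ge_0 (ct x)) as C0.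
  unfold decay_const. repeat split; try lra.
  - unfold sq1. rewrite !Cmod_mult, Cmod_R, Rabs_left by lra.
    assert (Cmod (ct x) * Cmod (sq x) <= 12 * (256 * v))%R by (apply Rmult_le_compat; lra). lra.
  - unfold sq2. eapply Rle_trans; [apply Cmod_triangle|].
    rewrite !Cmod_mult, !Cmod_pow, Cmod_pii, !Cmod_R, !Rabs_pos_eq by lra.
    assert (Cmod (sq x) ^ 2 <= 128 * (256 * v))%R.
    { cbn. rewrite Rmult_1_r. apply Rmult_le_compat; lra. }
    assert (PI ^ 2 * Cmod (sq x) <= 16 * (256 * v))%R by (apply Rmult_le_compat; nra). lra.
Qed.

Lemma qe_neq_1_Im (x : C) : Im x <> 0%R -> qe x <> 1.
Proof. intros H E. apply qe_eq_1 in E. destruct E as [m ->]. apply H. reflexivity. Qed.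

Lemma trig_decay (x : C) : (1 <= Rabs (Im x))%R ->
  (Cmod (sq x) <= decay_const * decay x)%R /\ (Cmod (sq1 x) <= decay_const * decay x)%R /\
  (Cmod (sq2 x) <= decay_const * decay x)%R /\
  (if Rlt_dec 0 (Im x) then Cmod (ct x + pii) <= decay_const * decay x
   else Cmod (ct x - pii) <= decay_const * decay x)%R.
Proof.
  intros H. destruct (Rlt_dec 0 (Im x)) as [P|P].
  - rewrite Rabs_pos_eq in H by lra. now apply trig_decay_upper.
  - rewrite Rabs_left1 in H by lra.
    assert (Q : qe x <> 1) by (apply qe_neq_1_Im; lra).
    destruct (trig_decay_upper (- x)) as [A [B [D E]]]; [rewrite Im_opp; lra|].
    assert (F : decay (- x) = decay x) by (unfold decay; now rewrite Im_opp, Rabs_Ropp).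
    rewrite F, sq_opp in A by exact Q. rewrite F, sq1_opp, Cmod_opp in B by exact Q.
    rewrite F, sq2_opp in D by exact Q. rewrite F, ct_opp in E by exact Q.
    replace (- ct x + pii) with (- (ct x - pii)) in E by ring. rewrite Cmod_opp in E. auto.
Qed.

Lemma exp_le (x y : R) : (x <= y)%R -> (exp x <= exp y)%R.
Proof. intros [H| ->]; [left; now apply exp_increasing | lra]. Qed.

(** ** Rows of points at linearly growing height *)

Lemma Rsummable_exp (a : R) : (0 < a)%R -> Rsummable (fun n : Z => exp (- (a * IZR (Z.abs n)))).
Proof.
  intros Ha.
  assert (Hr : (0 <= exp (- a) < 1)%R).
  { split; [left; apply exp_pos|]. rewrite <- exp_0. apply exp_increasing. lra. }
  apply (Rsummable_le _ (fun n => exp (- a) ^ Z.abs_nat n)%R 1);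
    [intros; left; apply exp_pos | | now apply Rsummable_geometric].
  intros n. rewrite Rmult_1_l. right.
  replace (Z.abs n) with (Z.of_nat (Z.abs_nat n)) by lia. rewrite <- INR_IZR_INZ.
  induction (Z.abs_nat n) as [|k IH].
  - cbn. rewrite Rmult_0_r, Ropp_0. apply exp_0.
  - rewrite S_INR. cbn [pow]. rewrite <- IH, <- exp_plus. f_equal. ring.
Qed.

Lemma Rsummable_weighted_exp (a : R) : (0 < a)%R ->
  Rsummable (fun n : Z => ((IZR (Z.abs n) + 1) * exp (- (a * IZR (Z.abs n))))%R).
Proof.
  intros Ha. assert (Hw : forall n, (0 <= IZR (Z.abs n))%R) by (intros n; apply (IZR_le 0); lia).
  apply (Rsummable_le _ (fun n => exp (- (a / 2 * IZR (Z.abs n)))) (1 + 2 / a)).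
  - intros n. specialize (Hw n). pose proof (exp_pos (- (a * IZR (Z.abs n)))). nra.
  - intros n. specialize (Hw n). set (w := IZR (Z.abs n)) in *.
    replace (exp (- (a * w))) with (exp (- (a / 2 * w)) * exp (- (a / 2 * w)))%R
      by (rewrite <- exp_plus; f_equal; field).
    rewrite <- Rmult_assoc. apply Rmult_le_compat_r; [left; apply exp_pos|].
    rewrite exp_Ropp. pose proof (exp_ineq1_le (a / 2 * w)) as E.
    pose proof (exp_pos (a / 2 * w)) as E0.
    apply (Rmult_le_reg_r (exp (a / 2 * w))); [exact E0|].
    rewrite Rmult_assoc, Rinv_l by lra.
    apply Rle_trans with ((1 + 2 / a) * (1 + a / 2 * w))%R.
    + replace ((1 + 2 / a) * (1 + a / 2 * w))%R with (1 + a / 2 * w + 2 / a + w)%R by (field; lra).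
      assert (0 < 2 / a)%R by (apply Rdiv_lt_0_compat; lra). nra.
    + apply Rmult_le_compat_l; [|exact E].
      assert (0 < 2 / a)%R by (apply Rdiv_lt_0_compat; lra). lra.
  - apply Rsummable_exp. lra.
Qed.

Lemma summable_cofinite {I} (f : I -> C) (M : I -> R) (L : list I) :
  NoDup L -> Rsummable M -> (forall i, ~ In i L -> (Cmod (f i) <= M i)%R) -> summable f.
Proof.
  intros NL [M0 [B HB]] Hf. split; [intros; apply Cmod_ge_0|].
  exists (Rsum (fun i => Cmod (f i)) L + B)%R. intros F HN.
  destruct (union_list L F) as [G [G1 [G2 G3]]].
  eapply Rle_trans; [apply (Rsum_incl _ F G (fun i => Cmod_ge_0 _) HN G3)|].
  destruct (incl_complement L G NL G2) as [F' HF'].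
  assert (N' : NoDup (L ++ F')) by (eapply Permutation_NoDup; eauto).
  rewrite (Rsum_perm _ _ _ HF'), Rsum_app. apply Rplus_le_compat_l.
  eapply Rle_trans; [|apply (HB F'); now apply NoDup_app_remove_l in N'].
  apply Rsum_le. intros i Hi. apply Hf. now apply (NoDup_app_not_in L F').
Qed.

Definition spread (kappa B : R) (x : Z -> C) : Prop :=
  forall n, (kappa * IZR (Z.abs n) - B <= Rabs (Im (x n)))%R.

Definition row_bound (kappa B : R) (n : Z) : R :=
  (decay_const * exp (2 * PI * B) * ((IZR (Z.abs n) + 1) * exp (- (2 * PI * kappa * IZR (Z.abs n)))))%R.

Lemma Rsummable_row_bound kappa B : (0 < kappa)%R -> Rsummable (row_bound kappa B).
Proof.
  intros Hk. pose proof PI_RGT_0.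
  apply (Rsummable_le _ (fun n : Z => ((IZR (Z.abs n) + 1) * exp (- (2 * PI * kappa * IZR (Z.abs n))))%R)
           (decay_const * exp (2 * PI * B))).
  - intros n. unfold row_bound, decay_const.
    assert (0 <= IZR (Z.abs n))%R by (apply (IZR_le 0); lia).
    repeat apply Rmult_le_pos; try (left; apply exp_pos); lra.
  - intros n. unfold row_bound. lra.
  - apply Rsummable_weighted_exp. nra.
Qed.

Lemma spread_exceptions kappa B : (0 < kappa)%R ->
  exists L : list Z, NoDup L /\ forall n, ~ In n L -> (1 <= kappa * IZR (Z.abs n) - B)%R.
Proof.
  intros Hk. destruct (archimed ((B + 1) / kappa)) as [U _]. set (u := up ((B + 1) / kappa)) in *.
  exists (zball (Z.to_nat u)). split; [apply NoDup_zball|]. intros n Hn.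
  rewrite in_zball in Hn.
  assert (E : (u <= Z.abs n)%Z) by lia. apply IZR_le in E.
  assert (T : ((B + 1) / kappa <= IZR (Z.abs n))%R) by lra.
  apply (Rmult_le_compat_l kappa) in T; [|lra].
  replace (kappa * ((B + 1) / kappa))%R with (B + 1)%R in T by (field; lra). lra.
Qed.

Lemma decay_row kappa B x n : spread kappa B x ->
  (decay (x n) <= exp (2 * PI * B) * exp (- (2 * PI * kappa * IZR (Z.abs n))))%R.
Proof.
  intros H. unfold decay. rewrite <- exp_plus. specialize (H n). pose proof PI_RGT_0.
  apply exp_le. nra.
Qed.

Lemma row_term_bound (g : C -> C) kappa B x w n :
  (forall y, (1 <= Rabs (Im y))%R -> (Cmod (g y) <= decay_const * decay y)%R) ->
  spread kappa B x -> (1 <= kappa * IZR (Z.abs n) - B)%R -> (Cmod w <= IZR (Z.abs n) + 1)%R ->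
  (Cmod (w * g (x n)) <= row_bound kappa B n)%R.
Proof.
  intros Hg Hx Hn Hw. rewrite Cmod_mult. unfold row_bound.
  pose proof (decay_row _ _ _ n Hx) as D. specialize (Hx n). specialize (Hg (x n) ltac:(lra)).
  pose proof (Cmod_ge_0 w). pose proof (Cmod_ge_0 (g (x n))).
  apply Rle_trans with ((IZR (Z.abs n) + 1) * (decay_const * (exp (2 * PI * B) * exp (- (2 * PI * kappa * IZR (Z.abs n))))))%R.
  - apply Rmult_le_compat; auto. eapply Rle_trans; [exact Hg|].
    apply Rmult_le_compat_l; [unfold decay_const; lra | exact D].
  - right. ring.
Qed.

Lemma row_summable (g : C -> C) kappa B x (w : Z -> C) :
  (forall y, (1 <= Rabs (Im y))%R -> (Cmod (g y) <= decay_const * decay y)%R) ->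
  (0 < kappa)%R -> spread kappa B x -> (forall n, (Cmod (w n) <= IZR (Z.abs n) + 1)%R) ->
  summable (fun n => w n * g (x n)).
Proof.
  intros Hg Hk Hx Hw. destruct (spread_exceptions kappa B Hk) as [L [NL HL]].
  apply (summable_cofinite _ (row_bound kappa B) L NL); [now apply Rsummable_row_bound|].
  intros n Hn. apply row_term_bound; auto.
Qed.

(** The points of all but finitely many rows stay at height at least 1, where the
    derivatives decay exponentially and absorb the speeds [p n]; the other rows
    only need to be differentiable. *)
Lemma row_cderiv (g g' : C -> C) (k a : Z -> C) (p : Z -> C) (F : C -> C) (t0 l : C) kappa B :
  (forall y, qe y <> 1 -> cderiv g y (g' y)) ->
  (forall y, (1 <= Rabs (Im y))%R -> (Cmod (g' y) <= decay_const * decay y)%R) ->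
  (0 < kappa)%R -> (forall n, (Cmod (p n) <= IZR (Z.abs n) + 1)%R) ->
  near t0 (fun t => spread kappa B (fun n => a n + p n * t)) ->
  (forall n, qe (a n + p n * t0) <> 1) ->
  near t0 (fun t => has_sum (fun n => g (a n + p n * t) + k n) (F t)) ->
  has_sum (fun n => p n * g' (a n + p n * t0)) l ->
  cderiv F t0 l.
Proof.
  intros Hg Hg' Hk Hp Hs Hq HF Hl.
  destruct (spread_exceptions kappa B Hk) as [L [NL HL]].
  apply (cderiv_has_sum (fun n t => g (a n + p n * t) + k n) (fun n => p n * g' (a n + p n * t0))
           F t0 l L (row_bound kappa B)).
  - exact HF.
  - intros n. eapply cderiv_eq.
    + apply cderiv_plus; [|apply cderiv_const]. apply cderiv_comp_affine. apply Hg, Hq.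
    + ring.
  - exact Hl.
  - now apply Rsummable_row_bound.
  - intros n Hn. apply (row_term_bound g' kappa B (fun n => a n + p n * t0)); auto.
    exact (near_self _ _ Hs).
  - destruct Hs as [d [Hd Hs]]. exists d. split; [exact Hd|]. intros t Ht n Hn.
    replace (g (a n + p n * t) + k n - (g (a n + p n * t0) + k n))
      with (g (a n + p n * t) - g (a n + p n * t0)) by ring.
    apply (Cmod_mean_value (fun t => g (a n + p n * t)) (fun t => p n * g' (a n + p n * t))).
    intros s Hs'. 
    pose proof (segment_in_ball t0 t0 t d s ltac:(rewrite Cmod_self; lra) Ht Hs') as Hu.
    specialize (Hs _ Hu). set (u := t0 + RtoC s * (t - t0)) in *.
    assert (H1 : (1 <= Rabs (Im (a n + p n * u)))%R).
    { specialize (Hs n). specialize (HL n Hn). cbv beta in Hs. lra. }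
    split.
    + apply cderiv_comp_affine, Hg. apply qe_neq_1_Im. intros E. rewrite E, Rabs_R0 in H1. lra.
    + apply (row_term_bound g' kappa B (fun n => a n + p n * u)); auto.
Qed.

(** * Partial fractions of 1/sin^2 *)

(** Mean value inequality on the segment from 0. *)
Lemma vanishing_order_succ (f f' : C -> C) (K R0 : R) (k : nat) :
  f 0 = 0 -> (forall y, cderiv f y (f' y)) -> (0 <= K)%R ->
  (forall y, (Cmod y <= R0)%R -> (Cmod (f' y) <= K * Cmod y ^ k)%R) ->
  forall y, (Cmod y <= R0)%R -> (Cmod (f y) <= K * Cmod y ^ S k)%R.
Proof.
  intros H0 Hd HK Hb y Hy.
  replace (f y) with (f y - f 0) by (rewrite H0; ring).
  replace (K * Cmod y ^ S k)%R with ((K * Cmod y ^ k) * Cmod (y - 0))%R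
    by (replace (y - 0) with y by ring; cbn; ring).
  apply (Cmod_mean_value f f'). intros t Ht. split; [apply Hd|].
  replace (0 + RtoC t * (y - 0)) with (RtoC t * y) by ring.
  assert (T : (Cmod (RtoC t * y) <= Cmod y)%R).
  { rewrite Cmod_mult, Cmod_R, Rabs_pos_eq by lra. pose proof (Cmod_ge_0 y). nra. }
  eapply Rle_trans; [apply Hb; lra|]. apply Rmult_le_compat_l; [exact HK|].
  apply pow_incr. split; [apply Cmod_ge_0 | exact T].
Qed.

(** The numerator of [sq_pole] and its first four derivatives are of this form, up
    to a constant. *)
Definition exp_poly (a b c d : C) (y : C) : C :=
  a * (cexp y * cexp y) + (b + c * y + d * (y * y)) * cexp y.

Lemma cderiv_exp_poly a b c d y :
  cderiv (exp_poly a b c d) y (exp_poly (2 * a) (b + c) (c + 2 * d) d y).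
Proof.
  unfold exp_poly. eapply cderiv_eq.
  - apply cderiv_plus.
    + apply cderiv_scal, cderiv_mult; apply cderiv_cexp.
    + apply cderiv_mult; [|apply cderiv_cexp].
      apply cderiv_plus; [apply cderiv_affine|]. apply cderiv_scal, cderiv_mult; apply cderiv_id.
  - cbv beta. ring.
Qed.

Lemma exp_poly_0 a b c d : exp_poly a b c d 0 = a + b.
Proof. unfold exp_poly. rewrite cexp_0. ring. Qed.

(** The function and its first three derivatives vanish at 0, and the fourth
    derivative is bounded on discs. *)
Lemma sq_numerator_bound (R0 : R) : (0 <= R0)%R -> exists K, (0 <= K)%R /\
  forall y, (Cmod y <= R0)%R -> (Cmod ((cexp y - 1) ^ 2 - y ^ 2 * cexp y) <= K * Cmod y ^ 4)%R.
Proof.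
  intros HR.
  set (K := (16 * (exp R0 * exp R0) + (14 + 8 * R0 + R0 * R0) * exp R0)%R).
  pose proof (exp_pos R0) as E0.
  assert (HK : (0 <= K)%R) by (unfold K; nra).
  exists K. split; [exact HK|].
  assert (B4 : forall y, (Cmod y <= R0)%R -> (Cmod (exp_poly 16 (-14) (-8) (-1) y) <= K * Cmod y ^ 0)%R).
  { intros y Hy. rewrite pow_O, Rmult_1_r. unfold exp_poly, K.
    assert (E1 : (Cmod (cexp y) <= exp R0)%R).
    { rewrite Cmod_cexp. apply exp_le. pose proof (re_le_Cmod y). pose proof (Rle_abs (Re y)). lra. }
    pose proof (Cmod_ge_0 (cexp y)). pose proof (Cmod_ge_0 y).
    eapply Rle_trans; [apply Cmod_triangle|]. apply Rplus_le_compat.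
    - rewrite !Cmod_mult, Cmod_R, Rabs_pos_eq by lra. apply Rmult_le_compat_l; [lra|].
      apply Rmult_le_compat; lra.
    - rewrite Cmod_mult. apply Rmult_le_compat; try apply Cmod_ge_0; [|exact E1].
      eapply Rle_trans; [apply Cmod_triangle|]. apply Rplus_le_compat.
      + eapply Rle_trans; [apply Cmod_triangle|].
        rewrite Cmod_mult, !Cmod_R, !Rabs_left by lra. lra.
      + rewrite !Cmod_mult, Cmod_R, Rabs_left by lra.
        assert (Cmod y * Cmod y <= R0 * R0)%R by (apply Rmult_le_compat; lra). lra. }
  assert (B3 : forall y, (Cmod y <= R0)%R -> (Cmod (exp_poly 8 (-8) (-6) (-1) y) <= K * Cmod y ^ 1)%R).
  { apply (vanishing_order_succ _ (exp_poly 16 (-14) (-8) (-1))); auto.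
    - rewrite exp_poly_0. ring.
    - intros y. eapply cderiv_eq; [apply cderiv_exp_poly|]. unfold exp_poly. ring. }
  assert (B2 : forall y, (Cmod y <= R0)%R -> (Cmod (exp_poly 4 (-4) (-4) (-1) y) <= K * Cmod y ^ 2)%R).
  { apply (vanishing_order_succ _ (exp_poly 8 (-8) (-6) (-1))); auto.
    - rewrite exp_poly_0. ring.
    - intros y. eapply cderiv_eq; [apply cderiv_exp_poly|]. unfold exp_poly. ring. }
  assert (B1 : forall y, (Cmod y <= R0)%R -> (Cmod (exp_poly 2 (-2) (-2) (-1) y) <= K * Cmod y ^ 3)%R).
  { apply (vanishing_order_succ _ (exp_poly 4 (-4) (-4) (-1))); auto.
    - rewrite exp_poly_0. ring.
    - intros y. eapply cderiv_eq; [apply cderiv_exp_poly|]. unfold exp_poly. ring. }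
  assert (B0 : forall y, (Cmod y <= R0)%R -> (Cmod (exp_poly 1 (-2) 0 (-1) y + 1) <= K * Cmod y ^ 4)%R).
  { apply (vanishing_order_succ _ (exp_poly 2 (-2) (-2) (-1))); auto.
    - rewrite exp_poly_0. ring.
    - intros y. eapply cderiv_eq; [apply cderiv_plus; [apply cderiv_exp_poly | apply cderiv_const]|].
      unfold exp_poly. ring. }
  intros y Hy. specialize (B0 y Hy).
  replace ((cexp y - 1) ^ 2 - y ^ 2 * cexp y) with (exp_poly 1 (-2) 0 (-1) y + 1); [exact B0|].
  unfold exp_poly. ring.
Qed.

Lemma sin_lower (t : R) : (Rabs t <= PI / 2)%R -> (t ^ 2 / 9 <= sin t ^ 2)%R.
Proof.
  assert (P : forall t, (0 <= t <= PI / 2)%R -> (t / 3 <= sin t)%R).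
  { intros s Hs. pose proof PI_4. destruct (SIN s) as [L _]; [lra | lra |].
    eapply Rle_trans; [|exact L].
    unfold sin_lb, sin_approx, sin_term. cbn -[Rmult Rplus Rdiv Ropp].
    replace (INR (fact 1)) with 1%R by (cbn; ring).
    replace (INR (fact 3)) with 6%R by (cbn; ring).
    replace (INR (fact 5)) with 120%R by (cbn; ring).
    replace (INR (fact 7)) with 5040%R by (unfold fact; rewrite INR_IZR_INZ; cbn; reflexivity).
    set (q := (s * s)%R). assert (Hq : (0 <= q <= 4)%R) by (unfold q; nra).
    match goal with |- (_ <= ?e)%R =>
      replace e with (s / 3 + s * ((2/3 - q / 6) + q * q * (1 - q / 42) / 120))%R by (unfold q; field) end.
    assert (0 <= q * q * (1 - q / 42))%R by (apply Rmult_le_pos; nra).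
    assert (0 <= s * ((2 / 3 - q / 6) + q * q * (1 - q / 42) / 120))%R by (apply Rmult_le_pos; lra).
    lra. }
  intros Ht. destruct (Rle_or_lt 0 t) as [H|H].
  - rewrite Rabs_pos_eq in Ht by lra. specialize (P t ltac:(lra)). assert (t / 3 * (t / 3) <= sin t * sin t)%R by (apply Rmult_le_compat; lra). cbn. lra.
  - rewrite Rabs_left in Ht by lra. specialize (P (- t)%R ltac:(lra)). rewrite sin_neg in P.
    assert (- t / 3 * (- t / 3) <= - sin t * - sin t)%R by (apply Rmult_le_compat; lra). cbn. lra.
Qed.

Lemma exp_minus_1_lower (t b : R) : (Rabs t <= b)%R -> (t ^ 2 * exp (- b) ^ 2 <= (exp t - 1) ^ 2)%R.
Proof.
  intros Hb. assert (B0 : (0 <= b)%R) by (pose proof (Rabs_pos t); lra).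
  assert (E : (0 < exp (- b) <= 1)%R).
  { split; [apply exp_pos|]. rewrite <- exp_0. apply exp_le. lra. }
  assert (L : (Rabs t * exp (- b) <= Rabs (exp t - 1))%R).
  { destruct (Rle_or_lt 0 t) as [H|H].
    - pose proof (exp_ineq1_le t). rewrite (Rabs_pos_eq t), Rabs_pos_eq by lra. nra.
    - rewrite (Rabs_left t) in * by lra.
      pose proof (exp_ineq1_le (- t)) as I.
      assert (M : (exp t < 1)%R) by (rewrite <- exp_0; now apply exp_increasing).
      rewrite Rabs_left by lra.
      assert (X : (exp t * exp (- t) = 1)%R) by (rewrite <- exp_plus, Rplus_opp_r; apply exp_0).
      assert (Y : (exp (- b) <= exp t)%R) by (apply exp_le; lra).
      pose proof (exp_pos t). nra. }
  rewrite <- (pow2_abs t), <- (pow2_abs (exp t - 1)).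
  replace (Rabs t ^ 2 * exp (- b) ^ 2)%R with ((Rabs t * exp (- b)) ^ 2)%R by ring.
  apply pow_incr. split; [|exact L]. apply Rmult_le_pos; [apply Rabs_pos | lra].
Qed.

Lemma qe_minus_1_lower (x : C) (B : R) : (Rabs (Re x) <= / 2)%R -> (Rabs (Im x) <= B)%R ->
  (exp (- (2 * PI * B)) * Cmod x <= Cmod (qe x - 1))%R.
Proof.
  intros HR HI. pose proof PI2_1 as P2. pose proof PI_4 as P4.
  assert (B0 : (0 <= B)%R) by (pose proof (Rabs_pos (Im x)); lra).
  set (m := exp (- (2 * PI * B))).
  assert (Hm : (0 < m <= 1)%R).
  { split; [apply exp_pos|]. rewrite <- exp_0. apply exp_le. nra. }
  apply Rsqr_incr_0_var; [|apply Cmod_ge_0]. unfold Rsqr.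
  replace (m * Cmod x * (m * Cmod x))%R with (m ^ 2 * (Cmod x ^ 2))%R by ring.
  replace (Cmod (qe x - 1) * Cmod (qe x - 1))%R with (Cmod (qe x - 1) ^ 2)%R by ring.
  rewrite !Cmod2_alt.
  destruct (two_pii_mult x) as [E1 E2].
  set (a := Re x) in *. set (b := Im x) in *.
  set (r := exp (- (2 * PI * b))).
  assert (F : (Re (qe x - 1)%C ^ 2 + Im (qe x - 1)%C ^ 2 = (r - 1) ^ 2 + 4 * r * sin (PI * a) ^ 2)%R).
  { assert (X1 : Re (qe x - 1)%C = (r * cos (2 * (PI * a)) - 1)%R).
    { change (Re (qe x - 1)%C) with (Re (qe x) - 1)%R. unfold qe, cexp. rewrite E1, E2.
      fold r. rewrite Rmult_assoc. reflexivity. }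
    assert (X2 : Im (qe x - 1)%C = (r * sin (2 * (PI * a)))%R).
    { rewrite Im_minus. unfold qe, cexp. rewrite E1, E2.
      fold r. rewrite Rmult_assoc. cbn. ring. }
    rewrite X1, X2, cos_2a_sin.
    pose proof (sin2_cos2 (2 * (PI * a))) as S. unfold Rsqr in S. rewrite cos_2a_sin in S.
    assert (S' : (sin (2 * (PI * a)) ^ 2 = 1 - (1 - 2 * sin (PI * a) * sin (PI * a)) ^ 2)%R) by (cbn; lra).
    rewrite Rpow_mult_distr, S'. ring. }
  rewrite F.
  assert (G1 : (m ^ 2 * b ^ 2 <= (r - 1) ^ 2)%R).
  { assert (X : ((2 * PI * b) ^ 2 * m ^ 2 <= (r - 1) ^ 2)%R).
    { replace ((2 * PI * b) ^ 2)%R with ((- (2 * PI * b)) ^ 2)%R by ring.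
      apply exp_minus_1_lower. rewrite Rabs_Ropp, Rabs_mult, (Rabs_pos_eq (2 * PI)) by lra.
      apply Rmult_le_compat_l; lra. }
    eapply Rle_trans; [|exact X]. rewrite Rmult_comm. apply Rmult_le_compat_r; [nra|].
    rewrite Rpow_mult_distr. rewrite <- (Rmult_1_l (b ^ 2)) at 1.
    apply Rmult_le_compat_r; [apply pow2_ge_0 | nra]. }
  assert (G2 : (m ^ 2 * a ^ 2 <= 4 * r * sin (PI * a) ^ 2)%R).
  { assert (X : ((PI * a) ^ 2 / 9 <= sin (PI * a) ^ 2)%R).
    { apply sin_lower. rewrite Rabs_mult, (Rabs_pos_eq PI) by lra. nra. }
    assert (Hr : (m <= r)%R).
    { apply exp_le. pose proof (Rle_abs b). nra. }
    assert (Y : (a ^ 2 <= 4 * sin (PI * a) ^ 2)%R).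
    { rewrite Rpow_mult_distr in X. pose proof (pow2_ge_0 a). pose proof (pow2_ge_0 (sin (PI * a))).
      assert (4 * a ^ 2 <= PI ^ 2 * a ^ 2)%R by (apply Rmult_le_compat_r; [assumption | nra]). lra. }
    pose proof (pow2_ge_0 a).
    assert (Z1 : (m ^ 2 <= r)%R) by nra.
    assert (Z2 : (m ^ 2 * a ^ 2 <= r * (4 * sin (PI * a) ^ 2))%R).
    { apply Rmult_le_compat; nra. }
    lra. }
  nra.
Qed.

(** With [y = 2 pi i x] the difference is [y^2 e^y - (e^y - 1)^2] over
    [x^2 (e^y - 1)^2]: a numerator of order [|x|^4] over a denominator that
    [qe_minus_1_lower] bounds below by a multiple of [|x|^4]. *)
Lemma sq_pole (B : R) : exists K, (0 <= K)%R /\ forall x : C, x <> 0 ->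
  (Rabs (Re x) <= / 2)%R -> (Rabs (Im x) <= B)%R -> (Cmod (sq x - / x ^ 2) <= K)%R.
Proof.
  destruct (sq_numerator_bound (2 * PI * (/ 2 + Rabs B))) as [K [HK H]].
  { pose proof PI_RGT_0. pose proof (Rabs_pos B). nra. }
  set (m := exp (- (2 * PI * B))). assert (Hm : (0 < m)%R) by apply exp_pos.
  exists (K * (2 * PI) ^ 4 / m ^ 2)%R. split.
  { apply Rmult_le_pos; [|left; apply Rinv_0_lt_compat; nra].
    apply Rmult_le_pos; [exact HK|]. apply pow_le. pose proof PI_RGT_0. lra. }
  intros x Hx HR HI. pose proof (qe_minus_1_lower x B HR HI) as L. fold m in L.
  assert (Cx : (0 < Cmod x)%R) by now apply Cmod_gt_0.
  assert (N : qe x - 1 <> 0) by (apply Cmod_pos_neq; nra).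
  set (y := 2 * pii * x).
  assert (Hy : Cmod y = (2 * PI * Cmod x)%R).
  { unfold y. rewrite !Cmod_mult, Cmod_pii, Cmod_R, Rabs_pos_eq by lra. reflexivity. }
  specialize (H y). change (cexp y) with (qe x) in H. rewrite Hy in H.
  assert (Hb : (2 * PI * Cmod x <= 2 * PI * (/ 2 + Rabs B))%R).
  { apply Rmult_le_compat_l; [pose proof PI_RGT_0; lra|].
    eapply Rle_trans; [apply Cmod_le_Re_Im|]. pose proof (Rle_abs B). lra. }
  specialize (H Hb).
  replace (sq x - / x ^ 2) with (- ((qe x - 1) ^ 2 - y ^ 2 * qe x) / (x ^ 2 * (qe x - 1) ^ 2))
    by (unfold sq, y; field; split; auto).
  rewrite Cmod_div by (apply Cmult_neq_0; now apply Cpow_nz).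
  rewrite Cmod_opp, Cmod_mult, !Cmod_pow.
  apply Rle_trans with ((K * (2 * PI * Cmod x) ^ 4) / (Cmod x ^ 2 * (m * Cmod x) ^ 2))%R.
  - unfold Rdiv. apply Rmult_le_compat; [apply Cmod_ge_0 | | exact H |].
    + left. apply Rinv_0_lt_compat, Rmult_lt_0_compat; apply pow_lt; [exact Cx | apply Cmod_gt_0; exact N].
    + apply Rinv_le_contravar.
      * apply Rmult_lt_0_compat; apply pow_lt; [exact Cx | now apply Rmult_lt_0_compat].
      * apply Rmult_le_compat_l; [apply pow_le; lra|]. apply pow_incr. split; [nra | exact L].
  - right. field. split; lra.
Qed.

Lemma qe_shift (x : C) (m : Z) : qe (x + RtoC (IZR m)) = qe x.
Proof. rewrite qe_plus, qe_IZR. ring. Qed.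

Lemma qe_shift_neq (x : C) (m : Z) : qe x <> 1 -> x + RtoC (IZR m) <> 0.
Proof. intros H E. apply H. rewrite <- (qe_shift x m), E. apply qe_0. Qed.

Lemma strip_representative (x : C) : exists m : Z, (Rabs (Re (x + RtoC (IZR m))) <= / 2)%R.
Proof.
  destruct (archimed (Re x - / 2)) as [A B]. exists (- up (Re x - / 2))%Z.
  rewrite re_plus, re_RtoC, opp_IZR. apply Rabs_le. lra.
Qed.

Definition inv_square_weight (m : Z) : R := if Z.eq_dec m 0 then 0%R else (4 / (IZR m) ^ 2)%R.

Lemma Rsummable_inv_square_weight : Rsummable inv_square_weight.
Proof.
  assert (P : forall m, m <> 0%Z -> (0 < IZR m ^ 2)%R).
  { intros m Hm. apply pow2_gt_0. now apply not_0_IZR. }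
  assert (Q : forall n, (4 / INR (S n) ^ 2 <= 8 / (INR n + 1) - 8 / (INR (S n) + 1))%R).
  { intros n. rewrite S_INR. pose proof (pos_INR n). set (k := INR n) in *.
    replace (8 / (k + 1) - 8 / (k + 1 + 1))%R with (8 / ((k + 1) * (k + 2)))%R by (field; lra).
    apply (Rmult_le_reg_r ((k + 1) ^ 2 * (k + 2))); [apply Rmult_lt_0_compat; nra|].
    replace (4 / (k + 1) ^ 2 * ((k + 1) ^ 2 * (k + 2)))%R with (4 * (k + 2))%R by (field; lra).
    replace (8 / ((k + 1) * (k + 2)) * ((k + 1) ^ 2 * (k + 2)))%R with (8 * (k + 1))%R by (field; lra).
    lra. }
  apply (Rsummable_telescope _ (fun n => 8 / (INR n + 1))%R).
  - intros m. unfold inv_square_weight. destruct (Z.eq_dec m 0) as [|Hm]; [lra|].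
    left. apply Rdiv_lt_0_compat; [lra | now apply P].
  - intros n. left. apply Rdiv_lt_0_compat; [lra|]. pose proof (pos_INR n). lra.
  - intros n. specialize (Q n). unfold inv_square_weight.
    destruct (Z.eq_dec (Z.of_nat (S n)) 0); [lia|]. destruct (Z.eq_dec (- Z.of_nat (S n)) 0); [lia|].
    rewrite opp_IZR, <- INR_IZR_INZ. split; [exact Q|].
    replace ((- INR (S n)) ^ 2)%R with (INR (S n) ^ 2)%R by ring. exact Q.
Qed.

Lemma inv_square_bound (x : C) (m : Z) : (Rabs (Re x) <= / 2)%R -> m <> 0%Z ->
  (Cmod (/ (x + RtoC (IZR m)) ^ 2) <= inv_square_weight m)%R.
Proof.
  intros Hx Hm. unfold inv_square_weight. destruct (Z.eq_dec m 0) as [|_]; [contradiction|].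
  assert (A : (1 <= Rabs (IZR m))%R).
  { rewrite <- abs_IZR. apply IZR_le. lia. }
  assert (L : (Rabs (IZR m) / 2 <= Cmod (x + RtoC (IZR m)))%R).
  { eapply Rle_trans; [|apply re_le_Cmod]. rewrite re_plus, re_RtoC.
    pose proof (Rabs_triang_inv (IZR m) (- Re x)) as T. rewrite Rabs_Ropp in T.
    replace (IZR m - - Re x)%R with (Re x + IZR m)%R in T by ring. lra. }
  rewrite Cmod_inv by (apply Cpow_nz, Cmod_pos_neq; lra). rewrite Cmod_pow.
  rewrite <- (pow2_abs (IZR m)).
  replace (4 / Rabs (IZR m) ^ 2)%R with (/ (Rabs (IZR m) / 2) ^ 2)%R by (field; lra).
  apply Rinv_le_contravar; [apply pow_lt; lra|]. apply pow_incr. lra.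
Qed.

Lemma summable_inv_square (x : C) : summable (fun m : Z => / (x + RtoC (IZR m)) ^ 2).
Proof.
  destruct (strip_representative x) as [k Hk]. set (y := x + RtoC (IZR k)) in *.
  apply (summable_ext (fun m : Z => / (y + RtoC (IZR (m - k))) ^ 2)).
  { intros m. unfold y. rewrite minus_IZR, RtoC_minus. do 2 f_equal. ring. }
  apply (summable_reindex (fun m => m - k)%Z (fun m => / (y + RtoC (IZR m)) ^ 2)).
  { intros; lia. }
  apply (summable_cofinite _ inv_square_weight (0%Z :: nil)).
  - repeat constructor. tauto.
  - apply Rsummable_inv_square_weight.
  - intros m Hm. apply inv_square_bound; [exact Hk|]. intros ->. apply Hm. now left.
Qed.

Lemma has_sum_even_odd (f : Z -> C) s a b : has_sum f s ->
  has_sum (fun m => f (2 * m)%Z) a -> has_sum (fun m => f (2 * m + 1)%Z) b -> s = a + b.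
Proof.
  intros Hf Ha Hb.
  assert (Hf' : has_sum (fun p : bool * Z => f (2 * snd p + Z.b2z (fst p))%Z) s).
  { apply (has_sum_reindex (fun p : bool * Z => 2 * snd p + Z.b2z (fst p))%Z
             (fun n => (Z.odd n, Z.div2 n)) f); [| |exact Hf].
    - intros [c m]. cbn [fst snd]. f_equal.
      + rewrite Z.add_comm, Z.odd_add_mul_2. now destruct c.
      + rewrite Z.div2_div. symmetry. apply (Z.div_unique_pos _ 2 m (Z.b2z c)); destruct c; cbn; lia.
    - intros n. cbn [fst snd]. symmetry. apply Z.div2_odd. }
  set (g := fun c : bool => if c then b else a).
  assert (Hg : has_sum g s).
  { apply (has_sum_fubini _ _ _ Hf'). intros [|]; cbn [fst snd Z.b2z]; [exact Hb|].
    apply (has_sum_ext (fun m => f (2 * m)%Z)); [|exact Ha]. intros m. f_equal. ring. }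
  assert (Hg' : has_sum g (Csum g (false :: true :: nil))).
  { apply has_sum_finite.
    - constructor; [intros [E|[]]; discriminate|]. constructor; [intros [] | constructor].
    - intros [|] Hn; exfalso; apply Hn; cbn; auto. }
  rewrite (has_sum_unique _ _ _ Hg Hg'). unfold Csum. cbn [map fold_right g]. ring.
Qed.

Lemma sq_duplication (x : C) : qe x <> 1 -> qe (x / 2) <> 1 -> qe ((x + 1) / 2) <> 1 ->
  sq x = / 4 * (sq (x / 2) + sq ((x + 1) / 2)).
Proof.
  intros H1 H2 H3.
  assert (E1 : qe ((x + 1) / 2) = - qe (x / 2)).
  { replace ((x + 1) / 2) with (x / 2 + / 2) by field. rewrite qe_plus, qe_half. ring. }
  assert (E2 : qe x = qe (x / 2) ^ 2).
  { replace x with (x / 2 + x / 2) at 1 by field. rewrite qe_plus. ring. }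
  apply qe_minus_1 in H1, H2, H3. unfold sq. rewrite E1, E2 in *.
  assert (H3' : qe (x / 2) + 1 <> 0).
  { intros E. apply H3. replace (- qe (x / 2) - 1) with (- (qe (x / 2) + 1)) by ring. rewrite E. ring. }
  field. repeat split; auto.
Qed.

(** Herglotz' trick: the difference [h] of the two sides satisfies
    [4 h x = h (x/2) + h ((x+1)/2)] and is bounded on horizontal strips, so that
    each bound can be halved. *)
Lemma has_sum_sq (x : C) : qe x <> 1 -> has_sum (fun m : Z => / (x + RtoC (IZR m)) ^ 2) (sq x).
Proof.
  intros Hx. set (B := Rabs (Im x)).
  set (P := fun x s => has_sum (fun m : Z => / (x + RtoC (IZR m)) ^ 2) s).
  assert (Hshift : forall y s k, P y s -> P (y + RtoC (IZR k)) s).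
  { intros y s k H. apply (has_sum_ext (fun m : Z => / (y + RtoC (IZR (m + k))) ^ 2)).
    - intros m. rewrite plus_IZR, RtoC_plus. do 2 f_equal. ring.
    - now apply (has_sum_shift (fun m => / (y + RtoC (IZR m)) ^ 2)). }
  destruct (sq_pole B) as [K [HK HP]].
  destruct Rsummable_inv_square_weight as [W0 [W HW]].
  assert (W1 : (0 <= W)%R) by (specialize (HW nil (NoDup_nil _)); exact HW).
  assert (Base : forall y s, qe y <> 1 -> (Rabs (Im y) <= B)%R -> P y s -> (Cmod (s - sq y) <= W + K)%R).
  { intros y0 s Hy0 HI0 HS0. destruct (strip_representative y0) as [k Hk].
    assert (E : sq y0 = sq (y0 + RtoC (IZR k))) by (apply sq_qe; now rewrite qe_shift).
    rewrite E. apply (Hshift y0 s k) in HS0. rewrite <- (qe_shift y0 k) in Hy0.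
    assert (HI : (Rabs (Im (y0 + RtoC (IZR k))) <= B)%R) by (rewrite Im_plus, im_RtoC, Rplus_0_r; exact HI0).
    clear HI0 E. set (y := y0 + RtoC (IZR k)) in *.
    assert (Ny : y <> 0) by (intros Ey; apply Hy0; rewrite Ey; apply qe_0).
    assert (T : (Cmod (s - / y ^ 2) <= W)%R).
    { replace (/ y ^ 2) with (Csum (fun m : Z => / (y + RtoC (IZR m)) ^ 2) (0%Z :: nil)).
      2:{ unfold Csum. cbn [map fold_right]. replace (y + RtoC (IZR 0)) with y by ring. ring. }
      apply has_sum_tail; [exact HS0 | repeat constructor; tauto |].
      intros F HN HF. eapply Rle_trans; [|apply (HW F HN)]. apply Rsum_le.
      intros m Hm. apply inv_square_bound; [exact Hk|]. intros ->. apply (HF 0%Z Hm). now left. }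
    replace (s - sq y) with ((s - / y ^ 2) - (sq y - / y ^ 2)) by ring.
    eapply Rle_trans; [apply Cmod_triangle_minus|]. specialize (HP y Ny Hk HI). lra. }
  assert (Step : forall n y s, qe y <> 1 -> (Rabs (Im y) <= B)%R -> P y s ->
            (Cmod (s - sq y) <= (W + K) * (/ 2) ^ n)%R).
  { induction n as [|n IH]; intros y s Hy HI HS; [rewrite pow_O, Rmult_1_r; now apply Base|].
    assert (Hq : forall v, (v + v = y \/ v + v = y + 1) -> qe v <> 1).
    { intros v Hv E. apply Hy. assert (E2 : qe (v + v) = 1) by (rewrite qe_plus, E; ring).
      destruct Hv as [Hv|Hv]; rewrite Hv in E2; [exact E2|].
      rewrite qe_plus, qe_1 in E2. rewrite <- E2. ring. }
    assert (H1 : qe (y / 2) <> 1) by (apply Hq; left; field).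
    assert (H2 : qe ((y + 1) / 2) <> 1) by (apply Hq; right; field).
    assert (HIm : forall v : C, Im v = Im y -> (Rabs (Im (v / 2)) <= B)%R).
    { intros v Hv. unfold Cdiv. rewrite <- RtoC_inv by lra. rewrite im_scal_r, Hv.
      rewrite Rabs_mult, (Rabs_pos_eq (/ 2)) by lra. pose proof (Rabs_pos (Im y)). lra. }
    destruct (summable_has_sum _ (summable_inv_square (y / 2))) as [s1 S1].
    destruct (summable_has_sum _ (summable_inv_square ((y + 1) / 2))) as [s2 S2].
    pose proof (IH _ _ H1 (HIm y eq_refl) S1) as D1.
    assert (Hy1 : Im (y + 1) = Im y) by (rewrite Im_plus, im_RtoC; ring).
    pose proof (IH _ _ H2 (HIm _ Hy1) S2) as D2.
    assert (E : s = / 4 * s1 + / 4 * s2).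
    { apply (has_sum_even_odd _ _ _ _ HS).
      - apply (has_sum_ext (fun m : Z => / 4 * / (y / 2 + RtoC (IZR m)) ^ 2)); [|now apply has_sum_scal].
        intros m. rewrite mult_IZR, RtoC_mult.
        pose proof (qe_shift_neq _ m H1) as N.
        replace (y + RtoC 2 * RtoC (IZR m)) with (2 * (y / 2 + RtoC (IZR m))) by field.
        revert N. generalize (y / 2 + RtoC (IZR m)). intros v N. field. exact N.
      - apply (has_sum_ext (fun m : Z => / 4 * / ((y + 1) / 2 + RtoC (IZR m)) ^ 2)); [|now apply has_sum_scal].
        intros m. rewrite plus_IZR, mult_IZR, RtoC_plus, RtoC_mult.
        pose proof (qe_shift_neq _ m H2) as N.
        replace (y + (RtoC 2 * RtoC (IZR m) + RtoC 1)) with (2 * ((y + 1) / 2 + RtoC (IZR m))) by field.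
        revert N. generalize ((y + 1) / 2 + RtoC (IZR m)). intros v N. field. exact N. }
    rewrite E, (sq_duplication y Hy H1 H2).
    replace (/ 4 * s1 + / 4 * s2 - / 4 * (sq (y / 2) + sq ((y + 1) / 2)))
      with (/ 4 * ((s1 - sq (y / 2)) + (s2 - sq ((y + 1) / 2)))) by ring.
    rewrite Cmod_mult, <- RtoC_inv, Cmod_R, Rabs_pos_eq by lra.
    pose proof (Cmod_triangle (s1 - sq (y / 2)) (s2 - sq ((y + 1) / 2))).
    cbn [pow]. lra. }
  destruct (summable_has_sum _ (summable_inv_square x)) as [s HS].
  apply (has_sum_eq _ _ _ HS). apply Ceq_minus, Cmod_eq_0.
  destruct (Req_dec (Cmod (s - sq x)) 0) as [E|N]; [exact E|exfalso].
  pose proof (Cmod_ge_0 (s - sq x)) as P0.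
  destruct (pow_lt_1_zero (/ 2) ltac:(rewrite Rabs_pos_eq; lra) (Cmod (s - sq x) / (W + K + 1))%R) as [n Hn].
  { apply Rdiv_lt_0_compat; lra. }
  specialize (Hn n (Nat.le_refl n)). rewrite Rabs_pos_eq in Hn by (apply pow_le; lra).
  specialize (Step n x s Hx (Rle_refl _) HS).
  apply (Rmult_lt_compat_r (W + K + 1)) in Hn; [|lra].
  unfold Rdiv in Hn. rewrite Rmult_assoc, Rinv_l, Rmult_1_r in Hn by lra.
  assert (0 < (/ 2) ^ n)%R by (apply pow_lt; lra).
  set (t := ((/ 2) ^ n)%R) in *. set (c := Cmod (s - sq x)) in *. clearbody t c. lra.
Qed.

(** Euler's value of the sum of the inverse squares: the odd indices
    contribute a quarter of [sq (1/2)], which is pi^2. *)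
Lemma has_sum_inv_square_nonzero :
  has_sum (fun m : Z => if Z.eq_dec m 0 then RtoC 0 else / RtoC (IZR m) ^ 2) (- (pii ^ 2 / 3)).
Proof.
  set (f := fun m : Z => if Z.eq_dec m 0 then RtoC 0 else / RtoC (IZR m) ^ 2).
  assert (Hs : summable f).
  { apply (summable_le _ inv_square_weight 1); [|apply Rsummable_inv_square_weight].
    intros m. rewrite Rmult_1_l. unfold f. destruct (Z.eq_dec m 0) as [->|N].
    - rewrite Cmod_0. unfold inv_square_weight. destruct (Z.eq_dec 0 0); [lra | contradiction].
    - replace (RtoC (IZR m)) with (0 + RtoC (IZR m)) by ring.
      apply inv_square_bound; [|exact N]. rewrite re_RtoC, Rabs_R0. lra. }
  destruct (summable_has_sum f Hs) as [s H].
  assert (Hh : qe (/ 2) <> 1).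
  { rewrite qe_half. intros E. injection E. lra. }
  assert (E : s = / 4 * s + / 4 * sq (/ 2)).
  { apply (has_sum_even_odd f s _ _ H).
    - apply (has_sum_ext (fun m => / 4 * f m)); [|now apply has_sum_scal].
      intros m. unfold f. destruct (Z.eq_dec m 0) as [->|N]; [cbn; ring|].
      destruct (Z.eq_dec (2 * m) 0); [lia|]. rewrite mult_IZR, RtoC_mult. field.
      apply RtoC_neq. now apply not_0_IZR.
    - apply (has_sum_ext (fun m : Z => / 4 * / (/ 2 + RtoC (IZR m)) ^ 2)).
      2:{ apply has_sum_scal. now apply has_sum_sq. }
      intros m. unfold f. destruct (Z.eq_dec (2 * m + 1) 0); [lia|].
      rewrite plus_IZR, mult_IZR, RtoC_plus, RtoC_mult.
      pose proof (qe_shift_neq _ m Hh) as N.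
      replace (RtoC 2 * RtoC (IZR m) + RtoC 1) with (2 * (/ 2 + RtoC (IZR m))) by field.
      revert N. generalize (/ 2 + RtoC (IZR m)). intros v N. field. exact N. }
  assert (V : sq (/ 2) = - pii ^ 2).
  { unfold sq. rewrite qe_half. replace (- (1) - 1) with (- (2)) by ring. field. }
  apply (has_sum_eq f s _ H).
  replace s with (4 / 3 * (s - / 4 * s)) by field. rewrite E at 1. rewrite V. field.
Qed.

(** * Row sums over the lattice *)

Definition tsum {I : Type} (f : I -> C) : C := the_C (has_sum f).

Lemma the_C_eq (P : C -> Prop) (x : C) : P x -> (forall y, P y -> y = x) -> the_C P = x.
Proof. intros H U. now apply (iota_unique (V := C_CompleteNormedModule)). Qed.

Lemma tsum_eq {I : Type} (f : I -> C) s : has_sum f s -> tsum f = s.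
Proof. intros H. apply the_C_eq; [exact H|]. intros y Hy. now apply (has_sum_unique f). Qed.

Lemma has_sum_tsum {I : Type} (f : I -> C) : summable f -> has_sum f (tsum f).
Proof. intros H. destruct (summable_has_sum f H) as [s Hs]. now rewrite (tsum_eq f s Hs). Qed.

Local Notation zc n := (RtoC (IZR n)).

Definition row (tau z : C) (n : Z) : C := z + zc n * tau.

(** [eis1], [eis2] are the Eisenstein series of weights 1 and 2 attached to [z],
    summed by rows; [eis2'] and [eis2''] are the derivatives of the latter.
    Adding [pii * sgn n] makes the first sum absolutely convergent, without
    changing its symmetric value. *)
Definition eis1 (tau z : C) : C := tsum (fun n => ct (row tau z n) + pii * zc (Z.sgn n)).
Definition eis2 (tau z : C) : C := tsum (fun n => sq (row tau z n)).
Definition eis2' (tau z : C) : C := tsum (fun n => sq1 (row tau z n)).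
Definition eis2'' (tau z : C) : C := tsum (fun n => sq2 (row tau z n)).

Definition off_lattice (tau z : C) : Prop := forall n, qe (row tau z n) <> 1.

(** The quasi-period [eta1] as an Eisenstein series, and its derivative in [tau]. *)
Definition eis_term (tau : C) (n : Z) : C :=
  if Z.eq_dec n 0 then - (pii ^ 2 / 3) else sq (zc n * tau).
Definition eta (tau : C) : C := tsum (eis_term tau).
Definition deta (tau : C) : C := tsum (fun n => zc n * sq1 (zc n * tau)).

Lemma Im_scal (n : Z) (x : C) : Im (zc n * x) = (IZR n * Im x)%R.
Proof. apply im_scal_l. Qed.

Lemma off_lattice_iff tau z : off_lattice tau z <-> ~ lattice tau z.
Proof.
  split.
  - intros H [m [n E]]. apply (H (- n)%Z).
    unfold row. rewrite E, opp_IZR, RtoC_opp.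
    replace (zc m + zc n * tau + - zc n * tau) with (zc m) by ring. apply qe_IZR.
  - intros H n E. apply H. apply qe_eq_1 in E. destruct E as [m E].
    exists m, (- n)%Z. rewrite opp_IZR, RtoC_opp, <- E. unfold row. ring.
Qed.

Lemma lattice_plus tau v w : lattice tau v -> lattice tau w -> lattice tau (v + w).
Proof.
  intros [m [n ->]] [m' [n' ->]]. exists (m + m')%Z, (n + n')%Z. rewrite !plus_IZR, !RtoC_plus. ring.
Qed.

Lemma lattice_opp tau w : lattice tau w -> lattice tau (- w).
Proof. intros [m [n ->]]. exists (- m)%Z, (- n)%Z. rewrite !opp_IZR, !RtoC_opp. ring. Qed.

Lemma lattice_minus tau v w : lattice tau v -> lattice tau w -> lattice tau (v - w).
Proof. intros Hv Hw. apply lattice_plus; [exact Hv | now apply lattice_opp]. Qed.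

Lemma lattice_0 tau : lattice tau 0.
Proof. exists 0%Z, 0%Z. ring. Qed.

Lemma lattice_1 tau : lattice tau 1.
Proof. exists 1%Z, 0%Z. ring. Qed.

Lemma lattice_tau tau : lattice tau tau.
Proof. exists 0%Z, 1%Z. ring. Qed.

Lemma off_lattice_opp tau z : off_lattice tau z -> off_lattice tau (- z).
Proof.
  rewrite !off_lattice_iff. intros H L. apply H. apply lattice_opp in L.
  now replace (- - z) with z in L by ring.
Qed.

Lemma off_lattice_shift tau z w : lattice tau w -> off_lattice tau z -> off_lattice tau (z + w).
Proof.
  rewrite !off_lattice_iff. intros Hw H L. apply H.
  replace z with (z + w - w) by ring. now apply lattice_minus.
Qed.

Lemma row_opp tau z n : row tau (- z) (- n) = - row tau z n.
Proof. unfold row. rewrite opp_IZR, RtoC_opp. ring. Qed.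

Lemma row_add tau z n k : row tau z (n + k) = row tau z n + zc k * tau.
Proof. unfold row. rewrite plus_IZR, RtoC_plus. ring. Qed.

Lemma row_spread tau z B : (0 < Im tau)%R -> (Rabs (Im z) <= B)%R -> spread (Im tau) B (row tau z).
Proof.
  intros Ht Hz n. unfold row. rewrite Im_plus, Im_scal, abs_IZR.
  pose proof (Rabs_triang_inv (IZR n * Im tau) (- Im z)) as T.
  rewrite Rabs_Ropp, Rabs_mult, (Rabs_pos_eq (Im tau)) in T by lra.
  replace (IZR n * Im tau - - Im z)%R with (Im z + IZR n * Im tau)%R in T by ring. lra.
Qed.

Lemma decay_sq y : (1 <= Rabs (Im y))%R -> (Cmod (sq y) <= decay_const * decay y)%R.
Proof. intros H. apply (trig_decay y H). Qed.
Lemma decay_sq1 y : (1 <= Rabs (Im y))%R -> (Cmod (sq1 y) <= decay_const * decay y)%R.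
Proof. intros H. apply (trig_decay y H). Qed.
Lemma decay_sq2 y : (1 <= Rabs (Im y))%R -> (Cmod (sq2 y) <= decay_const * decay y)%R.
Proof. intros H. apply (trig_decay y H). Qed.

Lemma weight_ge_1 (n : Z) : (1 <= IZR (Z.abs n) + 1)%R.
Proof. assert (0 <= IZR (Z.abs n))%R by (apply (IZR_le 0); lia). lra. Qed.

Lemma weight_zc (n : Z) : (Cmod (zc n) <= IZR (Z.abs n) + 1)%R.
Proof. rewrite Cmod_R, <- abs_IZR. lra. Qed.

Section Rows.
Variable tau : C.
Hypothesis Htau : (0 < Im tau)%R.

Lemma summable_rows (g : C -> C) z :
  (forall y, (1 <= Rabs (Im y))%R -> (Cmod (g y) <= decay_const * decay y)%R) ->
  summable (fun n => g (row tau z n)).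
Proof.
  intros Hg. apply (summable_ext (fun n => 1 * g (row tau z n))); [intros; ring|].
  apply (row_summable g (Im tau) (Rabs (Im z)) (row tau z) (fun _ => 1)); auto.
  - apply row_spread; auto with real.
  - intros n. rewrite Cmod_1. apply weight_ge_1.
Qed.

Lemma summable_weighted_rows (g : C -> C) z :
  (forall y, (1 <= Rabs (Im y))%R -> (Cmod (g y) <= decay_const * decay y)%R) ->
  summable (fun n => zc n * g (row tau z n)).
Proof.
  intros Hg. apply (row_summable g (Im tau) (Rabs (Im z)) (row tau z) (fun n => zc n)); auto.
  - apply row_spread; auto with real.
  - apply weight_zc.
Qed.

Lemma summable_ct_rows z : summable (fun n => ct (row tau z n) + pii * zc (Z.sgn n)).
Proof.
  destruct (spread_exceptions (Im tau) (Rabs (Im z)) Htau) as [L [NL HL]].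
  apply (summable_cofinite _ (row_bound (Im tau) (Rabs (Im z))) L NL); [now apply Rsummable_row_bound|].
  intros n Hn. specialize (HL n Hn).
  pose proof (row_spread tau z _ Htau (Rle_refl _)) as S.
  assert (T : (Cmod (ct (row tau z n) + pii * zc (Z.sgn n)) <= decay_const * decay (row tau z n))%R).
  { destruct (trig_decay (row tau z n)) as [_ [_ [_ D]]]; [specialize (S n); lra|].
    assert (HIm : Im (row tau z n) = (Im z + IZR n * Im tau)%R) by (unfold row; now rewrite Im_plus, Im_scal).
    rewrite HIm in D.
    destruct (Rlt_dec 0 (Im z + IZR n * Im tau)) as [P|P]; destruct (Z.lt_total n 0) as [Q|[Q|Q]];
      pose proof (Rle_abs (Im z)) as A1; pose proof (Rle_abs (- Im z)) as A2; rewrite Rabs_Ropp in A2.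
    - exfalso. apply IZR_lt in Q. rewrite abs_IZR, Rabs_left in HL by lra. lra.
    - exfalso. subst n. rewrite Z.abs_0, Rmult_0_r in HL. lra.
    - replace (Z.sgn n) with 1%Z by lia. now rewrite Cmult_1_r.
    - replace (Z.sgn n) with (-1)%Z by lia.
      replace (ct (row tau z n) + pii * zc (-1)) with (ct (row tau z n) - pii) by ring. exact D.
    - exfalso. subst n. rewrite Z.abs_0, Rmult_0_r in HL. lra.
    - exfalso. apply IZR_lt in Q. rewrite abs_IZR, Rabs_pos_eq in HL by lra. lra. }
  eapply Rle_trans; [exact T|]. unfold row_bound. rewrite Rmult_assoc.
  apply Rmult_le_compat_l; [unfold decay_const; lra|].
  eapply Rle_trans; [apply (decay_row _ _ _ n S)|].
  apply Rmult_le_compat_l; [left; apply exp_pos|].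
  pose proof (weight_ge_1 n). pose proof (exp_pos (- (2 * PI * Im tau * IZR (Z.abs n)))). nra.
Qed.

Lemma has_sum_eis1 z : has_sum (fun n => ct (row tau z n) + pii * zc (Z.sgn n)) (eis1 tau z).
Proof. apply has_sum_tsum, summable_ct_rows. Qed.
Lemma has_sum_eis2 z : has_sum (fun n => sq (row tau z n)) (eis2 tau z).
Proof. apply has_sum_tsum, summable_rows, decay_sq. Qed.
Lemma has_sum_eis2' z : has_sum (fun n => sq1 (row tau z n)) (eis2' tau z).
Proof. apply has_sum_tsum, summable_rows, decay_sq1. Qed.
Lemma has_sum_eis2'' z : has_sum (fun n => sq2 (row tau z n)) (eis2'' tau z).
Proof. apply has_sum_tsum, summable_rows, decay_sq2. Qed.

Lemma row_0 n : row tau 0 n = zc n * tau.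
Proof. unfold row. ring. Qed.

Lemma eis_term_row n : n <> 0%Z -> eis_term tau n = sq (row tau 0 n).
Proof. intros H. unfold eis_term. destruct (Z.eq_dec n 0); [contradiction|]. now rewrite row_0. Qed.

Lemma summable_eis_term : summable (eis_term tau).
Proof.
  destruct (summable_rows sq 0 decay_sq) as [H0 HB].
  apply (summable_cofinite _ (fun n => Cmod (sq (row tau 0 n))) (0%Z :: nil)).
  - repeat constructor. tauto.
  - exact (summable_rows sq 0 decay_sq).
  - intros n Hn. rewrite eis_term_row; [lra|]. intros ->. apply Hn. now left.
Qed.

Lemma has_sum_eta : has_sum (eis_term tau) (eta tau).
Proof. apply has_sum_tsum, summable_eis_term. Qed.

Lemma has_sum_deta : has_sum (fun n => zc n * sq1 (zc n * tau)) (deta tau).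
Proof.
  apply has_sum_tsum. apply (summable_ext (fun n => zc n * sq1 (row tau 0 n))).
  - intros n. now rewrite row_0.
  - apply summable_weighted_rows, decay_sq1.
Qed.

Lemma eis_cderiv (g g' : C -> C) (k : Z -> C) (F : C -> C) z l :
  (forall y, qe y <> 1 -> cderiv g y (g' y)) ->
  (forall y, (1 <= Rabs (Im y))%R -> (Cmod (g' y) <= decay_const * decay y)%R) ->
  off_lattice tau z ->
  (forall z, has_sum (fun n => g (row tau z n) + k n) (F z)) ->
  has_sum (fun n => g' (row tau z n)) l -> cderiv F z l.
Proof.
  intros Hg Hg' Hz HF Hl.
  assert (E : forall t n, zc n * tau + 1 * t = row tau t n) by (intros; unfold row; ring).
  apply (row_cderiv g g' k (fun n => zc n * tau) (fun _ => 1) F z l (Im tau) (Rabs (Im z) + 1)); auto.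
  - intros n. rewrite Cmod_1. apply weight_ge_1.
  - exists 1%R. split; [lra|]. intros t Ht n. rewrite E. apply row_spread; auto.
    pose proof (im_le_Cmod (t - z)) as I. rewrite Im_minus in I.
    replace (Im t) with (Im z + (Im t - Im z))%R by ring.
    eapply Rle_trans; [apply Rabs_triang|]. lra.
  - intros n. rewrite E. apply Hz.
  - apply near_forall. intros t. apply (has_sum_ext (fun n => g (row tau t n) + k n)); auto.
    intros n. now rewrite E.
  - apply (has_sum_ext (fun n => g' (row tau z n))); auto. intros n. rewrite E. ring.
Qed.

Lemma cderiv_eis1 z : off_lattice tau z -> cderiv (eis1 tau) z (- eis2 tau z).
Proof.
  intros H. apply (eis_cderiv ct (fun y => - sq y) (fun n => pii * zc (Z.sgn n))); auto.
  - apply cderiv_ct.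
  - intros y Hy. rewrite Cmod_opp. now apply decay_sq.
  - apply has_sum_eis1.
  - apply has_sum_opp, has_sum_eis2.
Qed.

Lemma cderiv_eis2 z : off_lattice tau z -> cderiv (eis2 tau) z (eis2' tau z).
Proof.
  intros H. apply (eis_cderiv sq sq1 (fun n => 0)); auto using cderiv_sq, decay_sq1, has_sum_eis2'.
  intros t. apply (has_sum_ext (fun n => sq (row tau t n))); [intros; ring | apply has_sum_eis2].
Qed.

Lemma cderiv_eis2' z : off_lattice tau z -> cderiv (eis2' tau) z (eis2'' tau z).
Proof.
  intros H. apply (eis_cderiv sq1 sq2 (fun n => 0)); auto using cderiv_sq1, decay_sq2, has_sum_eis2''.
  intros t. apply (has_sum_ext (fun n => sq1 (row tau t n))); [intros; ring | apply has_sum_eis2'].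
Qed.

(** ** Parity and periods *)

Lemma eis1_opp z : off_lattice tau z -> eis1 tau (- z) = - eis1 tau z.
Proof.
  intros H. apply tsum_eq. pose proof (has_sum_opp _ _ (has_sum_neg _ _ (has_sum_eis1 z))) as S.
  refine (has_sum_ext _ _ _ _ S). intros n. cbv beta.
  rewrite <- (Z.opp_involutive n) at 3. rewrite row_opp, ct_opp by apply H.
  rewrite Z.sgn_opp, opp_IZR, RtoC_opp. ring.
Qed.

Lemma eis2'_opp z : off_lattice tau z -> eis2' tau (- z) = - eis2' tau z.
Proof.
  intros H. apply tsum_eq. pose proof (has_sum_opp _ _ (has_sum_neg _ _ (has_sum_eis2' z))) as S.
  refine (has_sum_ext _ _ _ _ S). intros n. cbv beta.
  rewrite <- (Z.opp_involutive n) at 2. rewrite row_opp, sq1_opp by apply H. ring.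
Qed.

Lemma qe_row_shift z m n k : qe (row tau (z + (zc m + zc n * tau)) k) = qe (row tau z (k + n)).
Proof.
  rewrite row_add. unfold row.
  replace (z + (zc m + zc n * tau) + zc k * tau) with (z + zc k * tau + zc n * tau + zc m) by ring.
  apply qe_shift.
Qed.

Lemma eis2_periodic z w : lattice tau w -> eis2 tau (z + w) = eis2 tau z.
Proof.
  intros [m [n ->]]. apply tsum_eq.
  refine (has_sum_ext _ _ _ _ (has_sum_shift _ n _ (has_sum_eis2 z))).
  intros k. apply sq_qe. now rewrite qe_row_shift.
Qed.

Lemma eis2'_periodic z w : lattice tau w -> eis2' tau (z + w) = eis2' tau z.
Proof.
  intros [m [n ->]]. apply tsum_eq.
  refine (has_sum_ext _ _ _ _ (has_sum_shift _ n _ (has_sum_eis2' z))).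
  intros k. apply sq1_qe. now rewrite qe_row_shift.
Qed.

Lemma eis1_period_1 z : eis1 tau (z + 1) = eis1 tau z.
Proof.
  apply tsum_eq. refine (has_sum_ext _ _ _ _ (has_sum_eis1 z)). intros k. f_equal. apply ct_qe.
  unfold row. replace (z + 1 + zc k * tau) with (z + zc k * tau + zc 1) by ring. now rewrite qe_shift.
Qed.

(** The odd periodic function [eis2'] vanishes where [z] and [-z] agree modulo periods. *)
Lemma eis2'_half_period w : lattice tau w -> off_lattice tau (w / 2) -> eis2' tau (w / 2) = 0.
Proof.
  intros Hw H.
  assert (E : eis2' tau (w / 2) = - eis2' tau (w / 2)).
  { replace (w / 2) with (- (w / 2) + w) at 1 by field.
    rewrite eis2'_periodic by exact Hw. now apply eis2'_opp. }
  replace (eis2' tau (w / 2)) with (/ 2 * (eis2' tau (w / 2) - - eis2' tau (w / 2))) by field.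
  rewrite <- E. ring.
Qed.

End Rows.

(** * The functions wp, zeta and eta1 as row sums *)

Lemma Rsummable_three_halves :
  Rsummable (fun m : Z => / ((IZR (Z.abs m) + 1) * sqrt (IZR (Z.abs m) + 1)))%R.
Proof.
  assert (W : forall m, (1 <= IZR (Z.abs m) + 1)%R) by apply weight_ge_1.
  assert (Q : forall n, (/ ((INR (S n) + 1) * sqrt (INR (S n) + 1)) <=
                         2 / sqrt (INR n + 1) - 2 / sqrt (INR (S n) + 1))%R).
  { intros n. rewrite S_INR. pose proof (pos_INR n) as N0. set (j := (INR n + 1)%R) in *.
    assert (J : (1 <= j)%R) by (unfold j; lra).
    pose proof (sqrt_lt_R0 j ltac:(lra)) as X0. pose proof (sqrt_lt_R0 (j + 1) ltac:(lra)) as Y0.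
    pose proof (sqrt_sqrt j ltac:(lra)) as X2. pose proof (sqrt_sqrt (j + 1) ltac:(lra)) as Y2.
    set (x := sqrt j) in *. set (y := sqrt (j + 1)) in *. rewrite <- Y2.
    assert (XY : (x <= y)%R) by (apply sqrt_le_1; lra).
    apply (Rmult_le_reg_r (x * (y * y * y))); [apply Rmult_lt_0_compat; [exact X0|]; repeat apply Rmult_lt_0_compat; exact Y0|].
    replace (/ (y * y * y) * (x * (y * y * y)))%R with x by (field; lra).
    replace ((2 / x - 2 / y) * (x * (y * y * y)))%R with (2 * (y - x) * (y * y))%R by (field; lra).
    assert (D : ((y - x) * (y + x) = 1)%R) by nra.
    assert (D2 : (1 <= 2 * (y - x) * y)%R) by nra. nra. }
  apply (Rsummable_telescope _ (fun n => 2 / sqrt (INR n + 1))%R).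
  - intros m. left. apply Rinv_0_lt_compat. specialize (W m).
    apply Rmult_lt_0_compat; [lra | apply sqrt_lt_R0; lra].
  - intros n. left. apply Rdiv_lt_0_compat; [lra|]. apply sqrt_lt_R0. pose proof (pos_INR n). lra.
  - intros n. specialize (Q n).
    replace (Z.abs (Z.of_nat (S n))) with (Z.of_nat (S n)) by lia.
    replace (Z.abs (- Z.of_nat (S n))) with (Z.of_nat (S n)) by lia.
    rewrite <- INR_IZR_INZ. auto.
Qed.

Section Lattice_sum.
Variable tau : C.
Hypothesis Htau : (0 < Im tau)%R.

Lemma lattice_point_injective m n m' n' :
  zc m + zc n * tau = zc m' + zc n' * tau -> m = m' /\ n = n'.
Proof.
  intros E.
  assert (EI : Im (zc m + zc n * tau) = Im (zc m' + zc n' * tau)) by now rewrite E.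
  rewrite !Im_plus, !im_RtoC, !Im_scal in EI.
  assert (n = n') as <- by (apply eq_IZR, (Rmult_eq_reg_r (Im tau)); lra).
  split; [|reflexivity]. apply eq_IZR.
  assert (E2 : zc m = zc m') by (replace (zc m) with (zc m + zc n * tau - zc n * tau) by ring; rewrite E; ring).
  now injection E2.
Qed.

(** The imaginary part controls [n], and then the modulus controls [m]. *)
Lemma lattice_point_lower : exists c, (0 < c)%R /\ forall m n : Z,
  (c * (IZR (Z.abs m) + IZR (Z.abs n)) <= Cmod (zc m + zc n * tau))%R.
Proof.
  set (k := Im tau) in *. set (A := (1 + (Cmod tau + 1) / k)%R).
  pose proof (Cmod_ge_0 tau) as T0.
  assert (HA : (0 < A)%R).
  { unfold A. assert (0 < (Cmod tau + 1) / k)%R by (apply Rdiv_lt_0_compat; lra). lra. }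
  exists (/ A)%R. split; [now apply Rinv_0_lt_compat|]. intros m n.
  set (w := zc m + zc n * tau).
  apply (Rmult_le_reg_l A); [exact HA|]. rewrite <- Rmult_assoc, Rinv_r, Rmult_1_l by lra.
  assert (Hn : (IZR (Z.abs n) * k <= Cmod w)%R).
  { eapply Rle_trans; [|apply im_le_Cmod]. unfold w. rewrite Im_plus, im_RtoC, Im_scal, Rplus_0_l.
    fold k. rewrite Rabs_mult, <- abs_IZR, (Rabs_pos_eq k) by lra. lra. }
  assert (Hm : (IZR (Z.abs m) <= Cmod w + IZR (Z.abs n) * Cmod tau)%R).
  { rewrite abs_IZR, <- Cmod_R. replace (zc m) with (w - zc n * tau) by (unfold w; ring).
    eapply Rle_trans; [apply Cmod_triangle_minus|]. rewrite Cmod_mult, Cmod_R, abs_IZR. lra. }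
  assert (Hn' : (IZR (Z.abs n) <= Cmod w / k)%R).
  { apply (Rmult_le_reg_r k); [exact Htau|]. unfold Rdiv. rewrite Rmult_assoc, Rinv_l by lra. lra. }
  assert (Hn2 : (IZR (Z.abs n) * Cmod tau <= Cmod w / k * Cmod tau)%R) by (apply Rmult_le_compat_r; lra).
  unfold A. replace ((1 + (Cmod tau + 1) / k) * Cmod w)%R
    with (Cmod w + Cmod w / k * Cmod tau + Cmod w / k)%R by (field; lra). lra.
Qed.

Definition wp_term (z : C) (p : Z * Z) : C :=
  let w := zc (fst p) + zc (snd p) * tau in
  if Ceq_dec w 0 then 0 else / (z - w) ^ 2 - / w ^ 2.

(** The terms decrease like the cubes of the lattice points. *)
Lemma summable_wp_term z : summable (wp_term z).
Proof.
  destruct lattice_point_lower as [c [Hc HL]].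
  destruct (archimed ((2 * Cmod z + 1) / c)) as [U _]. set (u := up ((2 * Cmod z + 1) / c)) in *.
  pose proof (Cmod_ge_0 z) as Z0.
  set (a := fun m : Z => (/ ((IZR (Z.abs m) + 1) * sqrt (IZR (Z.abs m) + 1)))%R).
  set (K := (10 * Cmod z * (27 / (8 * c ^ 3)))%R).
  apply (summable_cofinite _ (fun p => K * (a (fst p) * a (snd p)))%R
           (list_prod (zball (Z.to_nat u)) (zball (Z.to_nat u)))).
  - assert (P : forall (X Y : list Z), NoDup X -> NoDup Y -> NoDup (list_prod X Y)).
    { induction X as [|x X IH]; intros Y HX HY; [constructor|]. inversion_clear HX. cbn.
      apply NoDup_app; auto.
      - apply FinFun.Injective_map_NoDup; [|exact HY]. intros ? ? E. congruence.
      - intros [i j] Hi Hj. apply in_map_iff in Hi. destruct Hi as [y [E _]].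
        injection E as <- <-. apply in_prod_iff in Hj. tauto. }
    apply P; apply NoDup_zball.
  - assert (HK : (0 <= K)%R).
    { unfold K. apply Rmult_le_pos; [lra|]. left. apply Rdiv_lt_0_compat; [lra|].
      apply Rmult_lt_0_compat; [lra | now apply pow_lt]. }
    apply (Rsummable_le _ (fun p => a (fst p) * a (snd p))%R K).
    + intros [m n]. apply Rmult_le_pos; [exact HK|].
      apply Rmult_le_pos; apply Rsummable_three_halves.
    + intros; lra.
    + apply Rsummable_prod; apply Rsummable_three_halves.
  - intros [m n] Hmn. cbn [fst snd]. rewrite in_prod_iff, !in_zball in Hmn.
    specialize (HL m n). unfold wp_term. cbn [fst snd].
    set (w := zc m + zc n * tau) in *. set (S := (IZR (Z.abs m) + IZR (Z.abs n))%R) in *.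
    assert (Su : (IZR u <= S)%R).
    { unfold S. rewrite <- plus_IZR. apply IZR_le. lia. }
    assert (Sb : (2 * Cmod z + 1 <= c * S)%R).
    { apply Rle_trans with (c * ((2 * Cmod z + 1) / c))%R; [right; field; lra|].
      apply Rmult_le_compat_l; lra. }
    assert (Hw : (2 * Cmod z + 1 <= Cmod w)%R) by lra.
    assert (Nw : w <> 0) by (apply Cmod_pos_neq; lra).
    destruct (Ceq_dec w 0) as [|_]; [contradiction|].
    assert (Hzw : (Cmod w / 2 <= Cmod (z - w))%R).
    { rewrite Cmod_minus_sym. pose proof (Cmod_triangle_rev w z). lra. }
    assert (Nzw : z - w <> 0) by (apply Cmod_pos_neq; lra).
    assert (T : (Cmod (/ (z - w) ^ 2 - / w ^ 2) <= 10 * Cmod z * / Cmod w ^ 3)%R).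
    { replace (/ (z - w) ^ 2 - / w ^ 2) with (z * (w + (w - z)) / ((w * (z - w)) ^ 2)) by (field; auto).
      rewrite Cmod_div by (apply Cpow_nz, Cmult_neq_0; auto).
      rewrite Cmod_pow, !Cmod_mult.
      assert (B1 : (Cmod (w + (w - z)) <= 5 / 2 * Cmod w)%R).
      { eapply Rle_trans; [apply Cmod_triangle|]. pose proof (Cmod_triangle_minus w z). lra. }
      assert (W0 : (0 < Cmod w)%R) by lra.
      assert (B2 : (/ (Cmod w * Cmod (z - w)) ^ 2 <= 4 / Cmod w ^ 4)%R).
      { replace (4 / Cmod w ^ 4)%R with (/ (Cmod w * (Cmod w / 2)) ^ 2)%R by (field; lra).
        apply Rinv_le_contravar; [apply pow_lt; nra|]. apply pow_incr. split; [nra|].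
        apply Rmult_le_compat_l; lra. }
      unfold Rdiv at 1.
      apply Rle_trans with (Cmod z * (5 / 2 * Cmod w) * (4 / Cmod w ^ 4))%R; [|right; field; lra].
      apply Rmult_le_compat; [|left; apply Rinv_0_lt_compat, pow_lt; nra | | exact B2].
      - apply Rmult_le_pos; apply Cmod_ge_0.
      - apply Rmult_le_compat_l; assumption. }
    eapply Rle_trans; [exact T|]. unfold K. rewrite (Rmult_assoc (10 * Cmod z)).
    apply Rmult_le_compat_l; [lra|].
    (* arithmetic-geometric mean: the product of the two weights is at most (3/2 S)^2 *)
    unfold a. pose proof (weight_ge_1 m) as M1. pose proof (weight_ge_1 n) as N1.
    assert (HS : (IZR (Z.abs m) + 1 + (IZR (Z.abs n) + 1) <= 3 * S)%R).
    { assert (1 <= S)%R; [|unfold S in *; lra].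
      unfold S. rewrite <- plus_IZR. apply IZR_le.
      assert (S <> 0%R) by (intros E; rewrite E in Sb; lra). assert (Z.abs m + Z.abs n <> 0)%Z; [|lia].
      intros E. apply H. unfold S. rewrite <- plus_IZR, E. reflexivity. }
    set (p := (IZR (Z.abs m) + 1)%R) in *. set (q := (IZR (Z.abs n) + 1)%R) in *.
    pose proof (sqrt_lt_R0 p ltac:(lra)) as P0. pose proof (sqrt_lt_R0 q ltac:(lra)) as Q0.
    pose proof (sqrt_sqrt p ltac:(lra)) as P2. pose proof (sqrt_sqrt q ltac:(lra)) as Q2.
    set (x := sqrt p) in *. set (y := sqrt q) in *.
    assert (XY : (2 * (x * y) <= 3 * S)%R).
    { pose proof (Rle_0_sqr (x - y)) as Q. unfold Rsqr in Q. lra. }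
    assert (XY0 : (0 < x * y)%R) by nra.
    assert (SW : (2 / 3 * c * (x * y) <= Cmod w)%R) by nra.
    replace (27 / (8 * c ^ 3) * (/ (p * x) * / (q * y)))%R with (/ (2 / 3 * c * (x * y)) ^ 3)%R.
    2:{ rewrite <- P2, <- Q2. field. repeat split; lra. }
    apply Rinv_le_contravar.
    + apply pow_lt. apply Rmult_lt_0_compat; [lra | exact XY0].
    + apply pow_incr. split; [|exact SW]. apply Rmult_le_pos; [lra|]. lra.
Qed.

(** Summation by rows; the row of index 0 lacks the term [1 / z^2] and contributes
    Euler's constant instead of a value of [sq]. *)
Lemma has_sum_wp_term z : off_lattice tau z ->
  has_sum (wp_term z) (eis2 tau z - eta tau - / z ^ 2).
Proof.
  intros Hz. destruct (summable_has_sum _ (summable_wp_term z)) as [s Hs].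
  apply (has_sum_eq _ _ _ Hs).
  apply (has_sum_unique (fun n : Z => sq (row tau z (- n)) - eis_term tau n - (if Z.eq_dec n 0 then / z ^ 2 else 0))).
  - assert (Hs' : has_sum (fun p : Z * Z => wp_term z (snd p, fst p)) s).
    { apply (has_sum_reindex (fun p : Z * Z => (snd p, fst p)) (fun p => (snd p, fst p)) (wp_term z));
        [now intros [] | now intros [] | exact Hs]. }
    apply (has_sum_fubini _ _ _ Hs'). intros n. cbn [fst snd].
    assert (A : has_sum (fun m => / (z - (zc m + zc n * tau)) ^ 2) (sq (row tau z (- n)))).
    { pose proof (has_sum_neg _ _ (has_sum_sq _ (Hz (- n)%Z))) as S.
      refine (has_sum_ext _ _ _ _ S). intros m. cbv beta. unfold row.
      rewrite !opp_IZR, !RtoC_opp. do 2 f_equal. ring. }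
    destruct (Z.eq_dec n 0) as [->|N].
    + assert (B : has_sum (fun m : Z => if Z.eq_dec m 0 then RtoC 0 else / zc m ^ 2) (eis_term tau 0)).
      { exact has_sum_inv_square_nonzero. }
      assert (D : has_sum (fun m : Z => if Z.eq_dec m 0 then / z ^ 2 else 0) (/ z ^ 2)).
      { apply (has_sum_single (fun m : Z => if Z.eq_dec m 0 then / z ^ 2 else 0) 0%Z).
        intros m Hm. now destruct (Z.eq_dec m 0). }
      refine (has_sum_ext _ _ _ _ (has_sum_minus _ _ _ _ (has_sum_minus _ _ _ _ A B) D)).
      intros m. cbv beta. unfold wp_term. cbn [fst snd].
      replace (zc m + RtoC 0 * tau) with (zc m) by ring.
      destruct (Z.eq_dec m 0) as [->|M].
      * destruct (Ceq_dec (RtoC 0) 0) as [_|]; [|congruence]. replace (z - RtoC 0) with z by ring. ring.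
      * destruct (Ceq_dec (zc m) 0) as [E|_]; [|ring].
        exfalso. apply M, eq_IZR. now injection E.
    + assert (Hn : qe (zc n * tau) <> 1).
      { apply qe_neq_1_Im. rewrite Im_scal. apply Rmult_integral_contrapositive_currified; [now apply not_0_IZR | lra]. }
      assert (B : has_sum (fun m => / (zc m + zc n * tau) ^ 2) (eis_term tau n)).
      { unfold eis_term. destruct (Z.eq_dec n 0); [contradiction|].
        refine (has_sum_ext _ _ _ _ (has_sum_sq _ Hn)). intros m. do 2 f_equal. ring. }
      apply (has_sum_eq _ (sq (row tau z (- n)) - eis_term tau n)); [|ring].
      refine (has_sum_ext _ _ _ _ (has_sum_minus _ _ _ _ A B)).
      intros m. unfold wp_term. cbn [fst snd].
      destruct (Ceq_dec (zc m + zc n * tau) 0) as [E|_]; [|reflexivity].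
      exfalso. apply N. apply (lattice_point_injective m n 0 0). rewrite E. ring.
  - apply has_sum_minus; [apply has_sum_minus|].
    + apply (has_sum_neg (fun n => sq (row tau z n))). now apply has_sum_eis2.
    + now apply has_sum_eta.
    + apply (has_sum_single (fun n : Z => if Z.eq_dec n 0 then / z ^ 2 else 0) 0%Z).
      intros m Hm. now destruct (Z.eq_dec m 0).
Qed.

Lemma is_sum_over_unique (D : C -> Prop) f s s' : is_sum_over D f s -> is_sum_over D f s' -> s = s'.
Proof.
  intros H H'. apply Ceq_minus, Cmod_eq_0.
  destruct (Req_dec (Cmod (s - s')) 0) as [E|N]; [exact E|exfalso].
  pose proof (Cmod_ge_0 (s - s')).
  destruct (H (Cmod (s - s') / 2)%R ltac:(lra)) as [F [HD HF]].
  destruct (H' (Cmod (s - s') / 2)%R ltac:(lra)) as [F' [HD' HF']].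
  destruct (dedup (F ++ F')) as [G [G1 G2]].
  assert (GD : forall w, In w G -> D w).
  { intros w Hw. apply G2, in_app_or in Hw. destruct Hw; auto. }
  specialize (HF G G1 GD ltac:(intros w Hw; apply G2, in_or_app; now left)).
  specialize (HF' G G1 GD ltac:(intros w Hw; apply G2, in_or_app; now right)).
  fold (Csum f G) in HF, HF'.
  replace (s - s') with ((Csum f G - s') - (Csum f G - s)) in HF, HF', N, H0 by ring.
  pose proof (Cmod_triangle_minus (Csum f G - s') (Csum f G - s)). lra.
Qed.

Lemma is_sum_over_lattice (f : C -> C) s :
  has_sum (fun p : Z * Z => let w := zc (fst p) + zc (snd p) * tau in if Ceq_dec w 0 then 0 else f w) s ->
  is_sum_over (fun w => lattice tau w /\ w <> RtoC 0) f s.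
Proof.
  set (phi := fun p : Z * Z => zc (fst p) + zc (snd p) * tau).
  set (g := fun p => if Ceq_dec (phi p) 0 then RtoC 0 else f (phi p)).
  intros H eps Heps. change (has_sum g s) in H.
  assert (Inj : forall p p', phi p = phi p' -> p = p').
  { intros [m n] [m' n'] E. unfold phi in E. cbn [fst snd] in E.
    apply lattice_point_injective in E. now destruct E as [-> ->]. }
  assert (P0 : phi (0%Z, 0%Z) = 0) by (unfold phi; cbn; ring).
  destruct (H eps Heps) as [F0 [N0 H0]].
  exists (map phi (filter (fun p => if Ceq_dec (phi p) 0 then false else true) F0)). split.
  - intros w Hw. apply in_map_iff in Hw. destruct Hw as [[m n] [<- Hp]].
    apply filter_In in Hp. destruct Hp as [_ Hp]. split.
    + now exists m, n.
    + now destruct (Ceq_dec (phi (m, n)) 0).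
  - intros F NF HF Hi. fold (Csum f F).
    assert (HG : exists G, F = map phi G).
    { clear - HF. induction F as [|w F IH]; [now exists nil|].
      destruct IH as [G ->]; [intros v Hv; apply HF; now right|].
      destruct (HF w (or_introl eq_refl)) as [[m [n E]] _].
      exists ((m, n) :: G). cbn. now rewrite E. }
    destruct HG as [G ->].
    assert (Gnz : forall p, In p G -> phi p <> 0).
    { intros p Hp. apply (HF (phi p)). now apply in_map. }
    specialize (H0 ((0%Z, 0%Z) :: G)).
    rewrite Csum_cons in H0. unfold g at 1 in H0. rewrite P0 in H0.
    destruct (Ceq_dec 0 0) as [_|]; [|congruence]. rewrite Cplus_0_l in H0.
    rewrite Csum_map. rewrite <- (Csum_ext_in g).
    2:{ intros p Hp. unfold g. destruct (Ceq_dec (phi p) 0); [|reflexivity]. now apply Gnz in Hp. }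
    apply H0.
    + constructor; [|now apply NoDup_map_inv in NF]. intros Hin. now apply (Gnz _ Hin).
    + intros p Hp. destruct (Ceq_dec (phi p) 0) as [E|N].
      * left. apply Inj. now rewrite E.
      * right. assert (Hin : In (phi p) (map phi G)).
        { apply Hi, in_map, filter_In. split; [exact Hp|]. now destruct (Ceq_dec (phi p) 0). }
        apply in_map_iff in Hin. destruct Hin as [p' [E Hp']]. now rewrite <- (Inj _ _ E).
Qed.

Lemma wp_eis2 z : off_lattice tau z -> wp z tau = eis2 tau z - eta tau.
Proof.
  intros Hz. unfold wp, sum_over.
  assert (H : is_sum_over (fun w => lattice tau w /\ w <> RtoC 0)
            (fun w => / ((z - w) ^ 2) - / (w ^ 2)) (eis2 tau z - eta tau - / z ^ 2)).
  { apply is_sum_over_lattice. exact (has_sum_wp_term z Hz). }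
  rewrite (the_C_eq _ _ H); [ring|]. intros y Hy. eapply is_sum_over_unique; eauto.
Qed.

(** ** The zeta function *)

Lemma coordinates z : exists x y : R, z = RtoC x + RtoC y * tau.
Proof.
  exists (Re z - Im z / Im tau * Re tau)%R, (Im z / Im tau)%R.
  apply C_eq.
  - rewrite re_plus, re_RtoC, re_scal_l. ring.
  - rewrite Im_plus, im_RtoC, im_scal_l. field. lra.
Qed.

Lemma lattice_coordinates x y : lattice tau (RtoC x + RtoC y * tau) ->
  exists m n : Z, x = IZR m /\ y = IZR n.
Proof.
  intros [m [n E]]. exists m, n.
  assert (EI : Im (RtoC x + RtoC y * tau) = Im (zc m + zc n * tau)) by now rewrite E.
  rewrite !Im_plus, !im_RtoC, !im_scal_l in EI.
  assert (y = IZR n) as -> by (apply (Rmult_eq_reg_r (Im tau)); lra).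
  split; [|reflexivity].
  assert (E2 : RtoC x = zc m) by (replace (RtoC x) with (RtoC x + zc n * tau - zc n * tau) by ring; rewrite E; ring).
  now injection E2.
Qed.

Definition is_integer (x : R) : Prop := exists m : Z, x = IZR m.

Lemma half_not_integer (m : Z) : (1 / 2)%R <> IZR m.
Proof.
  intros E. assert (E2 : IZR 1 = IZR (2 * m)) by (rewrite mult_IZR; lra). apply eq_IZR in E2. lia.
Qed.

(** A function with zero derivative off the lattice has one value: from [x + y tau]
    move to [(1 + tau) / 2], changing first the coordinate whose partner is not
    an integer. *)
Lemma constant_off_lattice (f : C -> C) :
  (forall z, off_lattice tau z -> cderiv f z 0) ->
  forall z, off_lattice tau z -> f z = f ((1 + tau) / 2).
Proof.
  intros Hd.
  assert (Hx : forall x x' y, ~ is_integer y -> f (RtoC x + RtoC y * tau) = f (RtoC x' + RtoC y * tau)).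
  { intros x x' y Hy. apply constant_on_segment. intros t _. apply Hd, off_lattice_iff.
    replace (RtoC x + RtoC y * tau + RtoC t * (RtoC x' + RtoC y * tau - (RtoC x + RtoC y * tau)))
      with (RtoC (x + t * (x' - x)) + RtoC y * tau) by (rewrite RtoC_plus, RtoC_mult, RtoC_minus; ring).
    intros L. apply lattice_coordinates in L. destruct L as [m [n [_ E]]]. apply Hy. now exists n. }
  assert (Hy : forall x y y', ~ is_integer x -> f (RtoC x + RtoC y * tau) = f (RtoC x + RtoC y' * tau)).
  { intros x y y' Hx'. apply constant_on_segment. intros t _. apply Hd, off_lattice_iff.
    replace (RtoC x + RtoC y * tau + RtoC t * (RtoC x + RtoC y' * tau - (RtoC x + RtoC y * tau)))
      with (RtoC x + RtoC (y + t * (y' - y)) * tau) by (rewrite RtoC_plus, RtoC_mult, RtoC_minus; ring).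
    intros L. apply lattice_coordinates in L. destruct L as [m [n [E _]]]. apply Hx'. now exists m. }
  assert (H2 : ~ is_integer (1 / 2)) by (intros [m E]; now apply (half_not_integer m)).
  intros z Hz. apply off_lattice_iff in Hz. destruct (coordinates z) as [x [y ->]].
  assert (E : (1 + tau) / 2 = RtoC (1 / 2) + RtoC (1 / 2) * tau) by (rewrite RtoC_div by lra; field).
  rewrite E. destruct (classic (is_integer y)) as [Iy|Ny].
  - assert (Nx : ~ is_integer x).
    { intros [m ->]. destruct Iy as [n ->]. apply Hz. now exists m, n. }
    rewrite (Hy x y (1 / 2)%R Nx). now apply Hx.
  - rewrite (Hx x (1 / 2)%R y Ny). now apply Hy.
Qed.

Lemma half_period_off_lattice (a b : Z) : (Z.odd a = true \/ Z.odd b = true) ->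
  off_lattice tau ((zc a + zc b * tau) / 2).
Proof.
  intros H. apply off_lattice_iff. intros L.
  replace ((zc a + zc b * tau) / 2) with (RtoC (IZR a / 2) + RtoC (IZR b / 2) * tau) in L
    by (rewrite !RtoC_div by lra; field).
  apply lattice_coordinates in L. destruct L as [m [n [Ea Eb]]].
  assert (Ea' : IZR a = IZR (2 * m)) by (rewrite mult_IZR; lra).
  assert (Eb' : IZR b = IZR (2 * n)) by (rewrite mult_IZR; lra).
  apply eq_IZR in Ea', Eb'. subst a b. rewrite !Z.odd_mul in H. cbn in H. destruct H; discriminate.
Qed.

Lemma cderiv_zeta_candidate z : off_lattice tau z ->
  cderiv (fun z => eis1 tau z + eta tau * z) z (- wp z tau).
Proof.
  intros Hz. rewrite (wp_eis2 z Hz). eapply cderiv_eq.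
  - apply cderiv_plus; [now apply cderiv_eis1 | apply cderiv_scal, cderiv_id].
  - ring.
Qed.

(** Two candidates for zeta differ by a function that is constant off the lattice
    and odd, hence 0. *)
Lemma zeta_eis1 z : off_lattice tau z -> zeta z tau = eis1 tau z + eta tau * z.
Proof.
  intros Hz. set (Z0 := fun z => eis1 tau z + eta tau * z).
  assert (W : is_weierstrass_zeta tau Z0).
  { intros v Hv. apply off_lattice_iff in Hv. split.
    - unfold Z0. rewrite eis1_opp by auto. ring.
    - apply cderiv_is_derive. now apply cderiv_zeta_candidate. }
  apply the_C_eq; [now exists Z0|]. intros v [Z1 [W1 <-]].
  set (D := fun z => Z1 z - Z0 z).
  assert (HD : forall v, off_lattice tau v -> cderiv D v 0).
  { intros v Hv. eapply cderiv_eq.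
    - apply cderiv_minus; [|now apply cderiv_zeta_candidate].
      apply cderiv_is_derive. apply W1. now apply off_lattice_iff.
    - ring. }
  assert (E : D z = D (- z)).
  { rewrite (constant_off_lattice D HD z Hz). symmetry.
    now apply constant_off_lattice, off_lattice_opp. }
  apply off_lattice_iff in Hz. unfold D in E.
  rewrite (proj1 (W1 z Hz)), (proj1 (W z Hz)) in E.
  apply Ceq_minus. fold (Z0 z).
  replace (Z1 z - Z0 z) with (/ 2 * ((Z1 z - Z0 z) - (- Z1 z - - Z0 z))) by field.
  rewrite <- E. ring.
Qed.

Lemma eta1_eta : eta1 tau = eta tau.
Proof.
  assert (H : forall z, ~ lattice tau z -> zeta (z + 1) tau - zeta z tau = eta tau).
  { intros z Hz. apply off_lattice_iff in Hz.
    rewrite !zeta_eis1, eis1_period_1; auto; [ring|].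
    apply off_lattice_shift; [apply lattice_1 | exact Hz]. }
  apply the_C_eq; [exact H|]. intros c Hc.
  assert (N : ~ lattice tau ((1 + tau) / 2)).
  { apply off_lattice_iff. replace (1 + tau) with (zc 1 + zc 1 * tau) by ring.
    apply half_period_off_lattice. now left. }
  now rewrite <- (Hc _ N), (H _ N).
Qed.

End Lattice_sum.

(** * The differential equations *)

Lemma has_sum_at_0 (v : C) : has_sum (fun k : Z => if Z.eq_dec k 0 then v else 0) v.
Proof.
  apply (has_sum_single (fun k : Z => if Z.eq_dec k 0 then v else 0) 0%Z).
  intros k Hk. now destruct (Z.eq_dec k 0).
Qed.

Section Products.
Variable tau : C.
Hypothesis Htau : (0 < Im tau)%R.

Lemma has_sum_sgn_step : has_sum (fun n : Z => zc (Z.sgn (n + 1)) - zc (Z.sgn n)) 2.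
Proof.
  set (f := fun n : Z => zc (Z.sgn (n + 1)) - zc (Z.sgn n)).
  apply (has_sum_eq _ (Csum f (0%Z :: (-1)%Z :: nil))).
  - apply has_sum_finite.
    + constructor; [intros [E|[]]; discriminate|]. constructor; [intros [] | constructor].
    + intros n Hn. unfold f. cbn [In] in Hn.
      replace (Z.sgn (n + 1)) with (Z.sgn n) by lia. ring.
  - unfold f, Csum. cbn [map fold_right Z.add Z.sgn Z.pos_sub]. ring.
Qed.

Lemma has_sum_sgn (k : Z) : has_sum (fun n : Z => zc (Z.sgn (n + k)) - zc (Z.sgn n)) (2 * zc k).
Proof.
  assert (P : forall j : nat, has_sum (fun n : Z => zc (Z.sgn (n + Z.of_nat j)) - zc (Z.sgn n)) (2 * zc (Z.of_nat j))).
  { induction j as [|j IH].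
    - apply (has_sum_eq _ 0); [|cbn; ring]. apply (has_sum_ext (fun _ => RtoC 0)); [|apply has_sum_zero].
      intros n. replace (n + Z.of_nat 0)%Z with n by lia. ring.
    - pose proof (has_sum_plus _ _ _ _ (has_sum_shift _ (Z.of_nat j) _ has_sum_sgn_step) IH) as T.
      apply (has_sum_eq _ _ (2 * zc (Z.of_nat (S j)))) in T.
      + refine (has_sum_ext _ _ _ _ T). intros n. cbv beta.
        replace (n + Z.of_nat j + 1)%Z with (n + Z.of_nat (S j))%Z by lia. ring.
      + rewrite Nat2Z.inj_succ, succ_IZR, RtoC_plus. ring. }
  destruct (Z_le_gt_dec 0 k) as [H|H].
  - rewrite <- (Z2Nat.id k H). apply P.
  - specialize (P (Z.to_nat (- k))). rewrite Z2Nat.id in P by lia.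
    pose proof (has_sum_opp _ _ (has_sum_shift _ k _ P)) as S.
    apply (has_sum_eq _ _ (2 * zc k)) in S.
    + refine (has_sum_ext _ _ _ _ S). intros n. cbv beta.
      replace (n + k + - k)%Z with n by lia. ring.
    + rewrite opp_IZR, RtoC_opp. ring.
Qed.

Lemma row_diff z n k : row tau z n - row tau z (n + k) = - (zc k * tau).
Proof. rewrite row_add. ring. Qed.

Lemma qe_multiple_tau k : k <> 0%Z -> qe (zc k * tau) <> 1.
Proof.
  intros H. apply qe_neq_1_Im. rewrite Im_scal.
  apply Rmult_integral_contrapositive_currified; [now apply not_0_IZR | lra].
Qed.

(** Telescoping: the cotangent runs from [pii] at the bottom of the rows to [-pii] at the top. *)
Lemma has_sum_ct_telescope z k :
  has_sum (fun n => ct (row tau z (n + k)) - ct (row tau z n)) (- 2 * pii * zc k).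
Proof.
  pose proof (has_sum_eis1 tau Htau z) as S.
  pose proof (has_sum_minus _ _ _ _ (has_sum_minus _ _ _ _ (has_sum_shift _ k _ S) S)
    (has_sum_scal pii _ _ (has_sum_sgn k))) as T.
  apply (has_sum_eq _ _ (- 2 * pii * zc k)) in T; [|ring].
  refine (has_sum_ext _ _ _ _ T). intros n. cbv beta. ring.
Qed.

(** The sum of the products of two values of [sq] that lie [k] rows apart. *)
Definition row_product (z : C) (k : Z) : C :=
  2 * eis2 tau z * eis_term tau k + 2 * pii * (zc k * sq1 (zc k * tau)) +
  (if Z.eq_dec k 0 then eis2'' tau z / 6 else 0).

(** For [k <> 0] the partial fractions of [sq_mult_sq] separate the two rows, and the
    cotangents telescope; for [k = 0] the square is expressed by [sq2]. *)
Lemma has_sum_row_product z k : off_lattice tau z ->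
  has_sum (fun n => sq (row tau z n) * sq (row tau z (n + k))) (row_product z k).
Proof.
  intros Hz. unfold row_product, eis_term. destruct (Z.eq_dec k 0) as [->|Hk].
  - pose proof (has_sum_plus _ _ _ _ (has_sum_scal (/ 6) _ _ (has_sum_eis2'' tau Htau z))
      (has_sum_scal (- (2 / 3) * pii ^ 2) _ _ (has_sum_eis2 tau Htau z))) as S.
    eapply has_sum_eq; [refine (has_sum_ext _ _ _ _ S)|].
    + intros n. cbv beta. replace (n + 0)%Z with n by lia. unfold sq2. field.
    + field.
  - pose proof (has_sum_eis2 tau Htau z) as S.
    pose proof (has_sum_plus _ _ _ _
      (has_sum_scal (sq (zc k * tau)) _ _ (has_sum_plus _ _ _ _ S (has_sum_shift _ k _ S)))
      (has_sum_scal (- sq1 (zc k * tau)) _ _ (has_sum_ct_telescope z k))) as T.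
    eapply has_sum_eq; [refine (has_sum_ext _ _ _ _ T)|ring].
    intros n. cbv beta. pose proof (qe_multiple_tau k Hk) as Q.
    rewrite sq_mult_sq; [|apply Hz|apply Hz|rewrite row_diff; now apply qe_opp_neq].
    rewrite row_diff, sq_opp, sq1_opp by exact Q. reflexivity.
Qed.

Lemma summable_row_products z :
  summable (fun p : Z * Z => sq (row tau z (fst p)) * sq (row tau z (fst p + snd p))).
Proof.
  pose proof (summable_rows tau Htau sq z decay_sq) as S.
  apply (summable_reindex (fun p : Z * Z => (fst p, fst p + snd p)%Z)
    (fun p => sq (row tau z (fst p)) * sq (row tau z (snd p)))).
  - intros [a b] [c d] E. cbn [fst snd] in E. injection E. intros. f_equal; lia.
  - now apply (summable_prod (fun n => sq (row tau z n)) (fun n => sq (row tau z n))).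
Qed.

Lemma has_sum_row_products z : off_lattice tau z -> has_sum (row_product z) (eis2 tau z ^ 2).
Proof.
  intros Hz. pose proof (has_sum_eis2 tau Htau z) as S.
  assert (T : summable (row_product z)).
  { unfold row_product.
    apply (summable_plus (fun k => 2 * eis2 tau z * eis_term tau k + 2 * pii * (zc k * sq1 (zc k * tau)))).
    - apply (summable_plus (fun k => 2 * eis2 tau z * eis_term tau k)).
      + apply (summable_le _ (fun k => Cmod (eis_term tau k)) (Cmod (2 * eis2 tau z))).
        * intros k. rewrite Cmod_mult. lra.
        * now apply summable_eis_term.
      + apply (summable_le _ (fun k => Cmod (zc k * sq1 (row tau 0 k))) (Cmod (2 * pii))).
        * intros k. rewrite row_0, (Cmod_mult (2 * pii)). lra.
        * apply (summable_weighted_rows tau Htau sq1 0 decay_sq1).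
    - apply (summable_cofinite _ (fun _ => 0%R) (0%Z :: nil)).
      + repeat constructor. tauto.
      + split; [intros; lra|]. exists 0%R. intros F _. induction F as [|a F IH]; [cbn; lra|].
        rewrite Rsum_cons. lra.
      + intros k Hk. destruct (Z.eq_dec k 0) as [->|]; [exfalso; apply Hk; now left | rewrite Cmod_0; lra]. }
  destruct (summable_has_sum _ T) as [t Ht].
  apply (has_sum_eq _ _ _ Ht). symmetry.
  apply (has_sum_fubini_exchange (fun n k => sq (row tau z n) * sq (row tau z (n + k)))
           (fun n => sq (row tau z n) * eis2 tau z) (row_product z)).
  - apply summable_row_products.
  - intros n. apply has_sum_scal.
    refine (has_sum_ext _ _ _ _ (has_sum_shift _ n _ S)). intros k. cbv beta. now rewrite Z.add_comm.
  - intros k. now apply has_sum_row_product.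
  - apply (has_sum_eq _ (eis2 tau z * eis2 tau z)); [|ring].
    refine (has_sum_ext _ _ _ _ (has_sum_scal (eis2 tau z) _ _ S)). intros n. cbv beta. ring.
  - exact Ht.
Qed.

(** [eis2^2] is the double sum over two rows, arranged by their distance. *)
Lemma eis2_square z : off_lattice tau z ->
  eis2 tau z ^ 2 = eis2'' tau z / 6 + 2 * eta tau * eis2 tau z + 2 * pii * deta tau.
Proof.
  intros Hz. apply (has_sum_unique (row_product z)); [now apply has_sum_row_products|].
  pose proof (has_sum_plus _ _ _ _ (has_sum_plus _ _ _ _
    (has_sum_scal (2 * eis2 tau z) _ _ (has_sum_eta tau Htau))
    (has_sum_scal (2 * pii) _ _ (has_sum_deta tau Htau))) (has_sum_at_0 (eis2'' tau z / 6))) as S.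
  eapply has_sum_eq; [exact S|]. ring.
Qed.

(** ** The heat equation *)

(** The pair of rows [n], [n + k] in the product of [eis2'] and [eis1], the latter
    summed symmetrically about the [n]-th row. *)
Definition heat_term (z : C) (n k : Z) : C :=
  if Z.eq_dec k 0 then 0 else sq1 (row tau z n) * (ct (row tau z (n + k)) + pii * zc (Z.sgn k)).

Lemma length_zball n : length (zball n) = (2 * n + 1)%nat.
Proof. induction n as [|n IH]; [reflexivity|]. cbn [zball length]. rewrite IH. lia. Qed.

Lemma sgn_difference_sum (n : Z) (F : list Z) : NoDup F ->
  (Rsum (fun k => Rabs (IZR (Z.sgn k - Z.sgn (n + k)))) F <= 4 * (IZR (Z.abs n) + 1))%R.
Proof.
  intros HN. set (g := fun k => Rabs (IZR (Z.sgn k - Z.sgn (n + k)))).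
  set (L := zball (Z.to_nat (Z.abs n))).
  assert (Z0 : forall k, ~ In k L -> g k = 0%R).
  { intros k Hk. unfold L in Hk. rewrite in_zball in Hk. unfold g.
    replace (Z.sgn k - Z.sgn (n + k))%Z with 0%Z by lia. apply Rabs_R0. }
  destruct (union_list F L) as [G [G1 [G2 G3]]].
  eapply Rle_trans; [apply (Rsum_incl g F G); auto; intros; apply Rabs_pos|].
  destruct (incl_complement L G (NoDup_zball _) G3) as [F' HF'].
  rewrite (Rsum_perm _ _ _ HF'), Rsum_app.
  assert (N' : NoDup (L ++ F')) by (eapply Permutation_NoDup; eauto).
  assert (E1 : (Rsum g F' <= 0)%R).
  { assert (Hd : forall k, In k F' -> g k = 0%R).
    { intros k Hk. apply Z0. now apply (NoDup_app_not_in L F'). }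
    clear - Hd. induction F' as [|k F' IH]; [unfold Rsum; cbn; lra|].
    rewrite Rsum_cons, Hd by now left. rewrite Rplus_0_l. apply IH. intros; apply Hd. now right. }
  assert (E2 : forall l : list Z, (Rsum g l <= 2 * INR (length l))%R).
  { induction l as [|k l IH]; [cbn; lra|]. rewrite Rsum_cons. cbn [length]. rewrite S_INR.
    assert (g k <= 2)%R; [|lra]. unfold g. rewrite <- abs_IZR. apply IZR_le. lia. }
  specialize (E2 L). unfold L in E2. rewrite length_zball, plus_INR, mult_INR in E2.
  rewrite (INR_IZR_INZ (Z.to_nat (Z.abs n))), Z2Nat.id in E2 by lia. cbn [INR] in E2. fold L in E2. lra.
Qed.

(** In the [n]-th row the signs [sgn k] and [sgn (n + k)] differ at most [2 |n| + 1] times; the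
    decay of [sq1] compensates for this linear growth. *)
Lemma summable_heat_term z : summable (fun p : Z * Z => heat_term z (fst p) (snd p)).
Proof.
  destruct (summable_ct_rows tau Htau z) as [_ [B HB]].
  assert (B0 : (0 <= B)%R) by (specialize (HB nil (NoDup_nil _)); exact HB).
  pose proof PI_RGT_0 as HP.
  set (b := fun n : Z => (Cmod (sq1 (row tau z n)) * ((B + 4 * PI) * (IZR (Z.abs n) + 1)))%R).
  apply (Rsummable_fibres _ b).
  - intros p. apply Cmod_ge_0.
  - pose proof (row_summable sq1 (Im tau) (Rabs (Im z)) (row tau z) (fun n => RtoC (IZR (Z.abs n) + 1))
      decay_sq1 Htau (row_spread tau z _ Htau (Rle_refl _))) as S.
    specialize (S ltac:(intros n; cbv beta; rewrite Cmod_R, Rabs_pos_eq; pose proof (weight_ge_1 n); lra)).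
    refine (Rsummable_le _ _ (B + 4 * PI) _ _ S).
    + intros n. unfold b. pose proof (weight_ge_1 n).
      apply Rmult_le_pos; [apply Cmod_ge_0|]. apply Rmult_le_pos; lra.
    + intros n. unfold b. rewrite (Cmod_mult (RtoC (IZR (Z.abs n) + 1))), Cmod_R, Rabs_pos_eq by (pose proof (weight_ge_1 n); lra).
      right. ring.
  - intros n F HN. cbn [fst snd]. unfold b.
    set (A := Cmod (sq1 (row tau z n))). assert (A0 : (0 <= A)%R) by apply Cmod_ge_0.
    set (c := fun m => ct (row tau z m) + pii * zc (Z.sgn m)) in *.
    apply Rle_trans with (Rsum (fun k => A * (Cmod (c (n + k)%Z) + PI * Rabs (IZR (Z.sgn k - Z.sgn (n + k)))))%R F).
    + apply Rsum_le. intros k _. unfold heat_term. destruct (Z.eq_dec k 0).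
      * rewrite Cmod_0. apply Rmult_le_pos; [exact A0|].
        apply Rplus_le_le_0_compat; [apply Cmod_ge_0|]. apply Rmult_le_pos; [lra | apply Rabs_pos].
      * rewrite Cmod_mult. fold A. apply Rmult_le_compat_l; [exact A0|].
        replace (ct (row tau z (n + k)) + pii * zc (Z.sgn k))
          with (c (n + k)%Z + pii * zc (Z.sgn k - Z.sgn (n + k)))
          by (unfold c; rewrite minus_IZR, RtoC_minus; ring).
        eapply Rle_trans; [apply Cmod_triangle|]. rewrite Cmod_mult, Cmod_pii, Cmod_R. lra.
    + rewrite Rsum_scal. apply Rmult_le_compat_l; [exact A0|].
      apply Rle_trans with (Rsum (fun k => Cmod (c (n + k)%Z)) F +
         PI * Rsum (fun k => Rabs (IZR (Z.sgn k - Z.sgn (n + k)))) F)%R.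
      * right. clear. induction F as [|k F IH]; [cbn; ring|]. rewrite !Rsum_cons, IH. ring.
      * pose proof (sgn_difference_sum n F HN) as S.
        assert (S2 : (Rsum (fun k => Cmod (c (n + k)%Z)) F <= B)%R).
        { rewrite <- (Rsum_map (fun k => n + k)%Z (fun m => Cmod (c m))). apply HB.
          apply FinFun.Injective_map_NoDup; [|exact HN]. intros x y E. lia. }
        apply (Rmult_le_compat_l PI) in S; [|lra].
        pose proof (weight_ge_1 n). nra.
Qed.

Definition ct_multiple (k : Z) : C := if Z.eq_dec k 0 then 0 else ct (zc k * tau) + pii * zc (Z.sgn k).

Lemma has_sum_ct_multiple : has_sum ct_multiple 0.
Proof.
  assert (S : summable ct_multiple).
  { apply (summable_le _ (fun k => Cmod (ct (row tau 0 k) + pii * zc (Z.sgn k))) 1).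
    - intros k. unfold ct_multiple. rewrite Rmult_1_l, row_0. destruct (Z.eq_dec k 0); [|lra].
      rewrite Cmod_0. apply Cmod_ge_0.
    - exact (summable_ct_rows tau Htau 0). }
  destruct (summable_has_sum _ S) as [s Hs].
  apply (has_sum_eq _ _ _ Hs). apply (has_sum_odd ct_multiple); [|exact Hs].
  intros k. unfold ct_multiple. destruct (Z.eq_dec k 0) as [->|N].
  - destruct (Z.eq_dec (- 0) 0); [ring | contradiction].
  - destruct (Z.eq_dec (- k) 0); [lia|].
    rewrite Z.sgn_opp, !opp_IZR, !RtoC_opp.
    replace (- zc k * tau) with (- (zc k * tau)) by ring.
    rewrite ct_opp by now apply qe_multiple_tau. ring.
Qed.

(** [zc n * sq1 (row tau z n)] is the [tau]-derivative of the [n]-th term of [eis2];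
    multiplying [eis2'] by [eis1] row against row produces the factor [n], because
    moving the centre of symmetric summation of the cotangents to the [n]-th row costs [2 pii n]. *)
Lemma heat_equation z D : off_lattice tau z ->
  has_sum (fun n => zc n * sq1 (row tau z n)) D ->
  2 * pii * D = eis1 tau z * eis2' tau z + eis2'' tau z / 2 - eis2 tau z ^ 2.
Proof.
  intros Hz HD.
  set (g := fun n => sq1 (row tau z n) * (eis1 tau z - 2 * pii * zc n - ct (row tau z n))).
  set (h := fun k => row_product z k - (if Z.eq_dec k 0 then row_product z 0 else 0) + eis2' tau z * ct_multiple k).
  assert (E : eis1 tau z * eis2' tau z - 2 * pii * D + (eis2'' tau z / 3 + 2 / 3 * pii ^ 2 * eis2 tau z)
              = eis2 tau z ^ 2 - row_product z 0 + eis2' tau z * 0).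
  { apply (has_sum_fubini_exchange (heat_term z) g h).
    - apply summable_heat_term.
    - intros n. unfold g.
      pose proof (has_sum_scal (sq1 (row tau z n)) _ _ (has_sum_minus _ _ _ _
        (has_sum_minus _ _ _ _ (has_sum_shift _ n _ (has_sum_eis1 tau Htau z))
          (has_sum_scal pii _ _ (has_sum_sgn n)))
        (has_sum_at_0 (ct (row tau z n))))) as S.
      eapply has_sum_eq; [refine (has_sum_ext _ _ _ _ S)|].
      + intros k. cbv beta. unfold heat_term. destruct (Z.eq_dec k 0) as [->|N].
        * cbn [Z.add Z.sgn]. ring.
        * rewrite (Z.add_comm n k). ring.
      + ring.
    - intros k. unfold h, ct_multiple. destruct (Z.eq_dec k 0) as [->|N].
      + apply (has_sum_eq _ 0); [|ring].
        apply (has_sum_ext (fun _ => RtoC 0)); [|apply has_sum_zero].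
        intros n. unfold heat_term. now destruct (Z.eq_dec 0 0).
      + pose proof (has_sum_eis2 tau Htau z) as S.
        pose proof (has_sum_plus _ _ _ _ (has_sum_plus _ _ _ _ (has_sum_row_product z k Hz)
          (has_sum_scal (sq (zc k * tau)) _ _ (has_sum_minus _ _ _ _ S (has_sum_shift _ k _ S))))
          (has_sum_scal (ct (zc k * tau) + pii * zc (Z.sgn k)) _ _ (has_sum_eis2' tau Htau z))) as T.
        eapply has_sum_eq; [refine (has_sum_ext _ _ _ _ T)|ring].
        intros n. cbv beta. unfold heat_term. destruct (Z.eq_dec k 0); [contradiction|].
        pose proof (qe_multiple_tau k N) as Q.
        rewrite Cmult_plus_distr_l.
        rewrite sq1_mult_ct; [|apply Hz|apply Hz|rewrite row_diff; now apply qe_opp_neq].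
        rewrite row_diff, sq_opp, ct_opp by exact Q. ring.
    - unfold g.
      pose proof (has_sum_plus _ _ _ _ (has_sum_minus _ _ _ _
        (has_sum_scal (eis1 tau z) _ _ (has_sum_eis2' tau Htau z))
        (has_sum_scal (2 * pii) _ _ HD))
        (has_sum_plus _ _ _ _ (has_sum_scal (/ 3) _ _ (has_sum_eis2'' tau Htau z))
          (has_sum_scal (2 / 3 * pii ^ 2) _ _ (has_sum_eis2 tau Htau z)))) as S.
      eapply has_sum_eq; [refine (has_sum_ext _ _ _ _ S)|field].
      intros n. cbv beta.
      assert (Q : sq1 (row tau z n) * ct (row tau z n) = - 2 * ct (row tau z n) ^ 2 * sq (row tau z n))
        by (unfold sq1; ring).
      rewrite (ct_square _ (Hz n)) in Q.
      transitivity (sq1 (row tau z n) * (eis1 tau z - 2 * pii * zc n) - sq1 (row tau z n) * ct (row tau z n)); [|ring].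
      rewrite Q. unfold sq2. field.
    - unfold h. apply has_sum_plus; [|apply has_sum_scal, has_sum_ct_multiple].
      apply has_sum_minus; [now apply has_sum_row_products|].
      apply has_sum_at_0. }
  unfold row_product, eis_term in E. destruct (Z.eq_dec 0 0) as [_|]; [|contradiction].
  replace (2 * pii * D) with (eis1 tau z * eis2' tau z - (eis1 tau z * eis2' tau z - 2 * pii * D + (eis2'' tau z / 3 + 2 / 3 * pii ^ 2 * eis2 tau z)) + (eis2'' tau z / 3 + 2 / 3 * pii ^ 2 * eis2 tau z)) by ring.
  rewrite E. field.
Qed.

End Products.

(** ** The Weierstrass equation *)

(** The invariant of the equation, before it is identified with [g2]. *)
Definition gam (tau : C) : C := 12 * (eta tau ^ 2 + 2 * pii * deta tau).

(** The formula of [wp_eis2], used as a function on all of [C]. *)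
Definition pe (tau z : C) : C := eis2 tau z - eta tau.

Lemma cderiv_pe tau z : (0 < Im tau)%R -> off_lattice tau z -> cderiv (pe tau) z (eis2' tau z).
Proof.
  intros Ht Hz. eapply cderiv_eq; [apply cderiv_minus; [now apply cderiv_eis2 | apply cderiv_const]|]. ring.
Qed.

Lemma eis2''_pe tau z : (0 < Im tau)%R -> off_lattice tau z ->
  eis2'' tau z = 6 * pe tau z ^ 2 - gam tau / 2.
Proof.
  intros Ht Hz. pose proof (eis2_square tau Ht z Hz) as E. unfold pe, gam.
  replace (eis2'' tau z) with (6 * (eis2'' tau z / 6 + 2 * eta tau * eis2 tau z + 2 * pii * deta tau)
     - 12 * eta tau * eis2 tau z - 12 * pii * deta tau) by field.
  rewrite <- E. field.
Qed.

(** ** Differentiation with respect to [tau] *)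

Lemma Im_near tau (k K : R) : (k < Im tau < K)%R -> near tau (fun t => (k < Im t < K)%R).
Proof.
  intros H. exists (Rmin (Im tau - k) (K - Im tau)). split; [apply Rmin_glb_lt; lra|].
  intros t Ht. pose proof (im_le_Cmod (t - tau)) as I. rewrite Im_minus in I.
  pose proof (Rmin_l (Im tau - k) (K - Im tau)). pose proof (Rmin_r (Im tau - k) (K - Im tau)).
  apply Rabs_le_between in I. lra.
Qed.

Lemma upper_half_plane_near tau : (0 < Im tau)%R -> near tau (fun t => (0 < Im t)%R).
Proof.
  intros H. refine (near_imp _ _ _ _ (Im_near tau 0 (Im tau + 1) _)); [intros y [Hy _]; exact Hy | lra].
Qed.

Lemma cderiv_eta tau : (0 < Im tau)%R -> cderiv eta tau (deta tau).
Proof.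
  intros Ht.
  (* the summand of index 0 is constant, written as a constant plus [sq (1/2)] *)
  set (a := fun n : Z => if Z.eq_dec n 0 then / 2 else RtoC 0).
  set (k := fun n : Z => if Z.eq_dec n 0 then - (pii ^ 2 / 3) - sq (/ 2) else RtoC 0).
  apply (row_cderiv sq sq1 k a (fun n => zc n) eta tau (deta tau) (Im tau / 2) 0).
  - apply cderiv_sq.
  - apply decay_sq1.
  - lra.
  - apply weight_zc.
  - refine (near_imp _ _ _ _ (Im_near tau (Im tau / 2) (Im tau + 1) _)); [|lra].
    intros t [H _] n. replace (Im (a n + zc n * t)) with (IZR n * Im t)%R.
    + rewrite Rabs_mult, <- abs_IZR, (Rabs_pos_eq (Im t)) by lra.
      pose proof (weight_ge_1 n). nra.
    + rewrite Im_plus, Im_scal. unfold a. destruct (Z.eq_dec n 0).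
      * rewrite <- RtoC_inv, im_RtoC by lra. ring.
      * rewrite im_RtoC. ring.
  - intros n. unfold a. destruct (Z.eq_dec n 0) as [->|N].
    + replace (/ 2 + RtoC 0 * tau) with (/ 2) by ring. rewrite qe_half. intros E. injection E. lra.
    + replace (RtoC 0 + zc n * tau) with (zc n * tau) by ring. now apply qe_multiple_tau.
  - refine (near_imp _ _ _ _ (upper_half_plane_near tau Ht)). intros t H.
    refine (has_sum_ext _ _ _ _ (has_sum_eta t H)). intros n. unfold a, k, eis_term.
    destruct (Z.eq_dec n 0) as [->|N].
    + replace (/ 2 + RtoC 0 * t) with (/ 2) by ring. ring.
    + replace (RtoC 0 + zc n * t) with (zc n * t) by ring. ring.
  - refine (has_sum_ext _ _ _ _ (has_sum_deta tau Ht)). intros n. unfold a.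
    destruct (Z.eq_dec n 0) as [->|N]; [ring|].
    now replace (RtoC 0 + zc n * tau) with (zc n * tau) by ring.
Qed.

Definition half_period (a b : Z) (tau : C) : C := (zc a + zc b * tau) / 2.

Lemma row_half_period a b n t : row t (half_period a b t) n = zc a / 2 + (zc n + zc b / 2) * t.
Proof. unfold row, half_period. field. Qed.

(** The half period moves with [tau], so that the [n]-th row moves with speed
    [n + b / 2]; the shift by [b / 2] contributes a multiple of [eis2'], which is 0
    at half periods. *)
Lemma cderiv_eis2_half_period a b tau : (0 < Im tau)%R -> (b = 0 \/ b = 1)%Z ->
  off_lattice tau (half_period a b tau) ->
  cderiv (fun t => eis2 t (half_period a b t)) tau
    ((eis2'' tau (half_period a b tau) / 2 - eis2 tau (half_period a b tau) ^ 2) / (2 * pii)).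
Proof.
  intros Ht Hb Hz. set (z := half_period a b tau) in *.
  assert (V : eis2' tau z = 0).
  { unfold z, half_period. apply eis2'_half_period; [exact Ht | | exact Hz]. now exists a, b. }
  assert (S : has_sum (fun n => zc n * sq1 (row tau z n)) (tsum (fun n => zc n * sq1 (row tau z n)))).
  { apply has_sum_tsum. apply summable_weighted_rows; [exact Ht | apply decay_sq1]. }
  set (D := tsum (fun n => zc n * sq1 (row tau z n))) in *.
  pose proof (heat_equation tau Ht z D Hz S) as E. rewrite V in E.
  replace ((eis2'' tau z / 2 - eis2 tau z ^ 2) / (2 * pii)) with D.
  2:{ pose proof pii_neq. replace (eis2'' tau z / 2 - eis2 tau z ^ 2)
        with (eis1 tau z * 0 + eis2'' tau z / 2 - eis2 tau z ^ 2) by ring.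
      rewrite <- E. field. assumption. }
  assert (Hb2 : (0 <= IZR b / 2 <= 1 / 2)%R) by (destruct Hb as [-> | ->]; lra).
  assert (Eb : zc b / 2 = RtoC (IZR b / 2)) by (rewrite RtoC_div; [reflexivity | lra]).
  apply (row_cderiv sq sq1 (fun _ => 0) (fun _ => zc a / 2) (fun n => zc n + zc b / 2) _ tau D
           (Im tau / 2) (Im tau)).
  - apply cderiv_sq.
  - apply decay_sq1.
  - lra.
  - intros n. rewrite Eb, <- RtoC_plus, Cmod_R. eapply Rle_trans; [apply Rabs_triang|].
    rewrite <- abs_IZR, (Rabs_pos_eq (IZR b / 2)) by lra. lra.
  - refine (near_imp _ _ _ _ (Im_near tau (Im tau / 2) (2 * Im tau) _)); [|lra].
    intros t [H1 H2] n.
    replace (Im (zc a / 2 + (zc n + zc b / 2) * t)) with ((IZR n + IZR b / 2) * Im t)%R.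
    + rewrite Rabs_mult, (Rabs_pos_eq (Im t)) by lra.
      pose proof (Rabs_triang_inv (IZR n) (- (IZR b / 2))) as T.
      replace (IZR n - - (IZR b / 2))%R with (IZR n + IZR b / 2)%R in T by ring.
      rewrite Rabs_Ropp, (Rabs_pos_eq (IZR b / 2)), <- abs_IZR in T by lra.
      pose proof (weight_ge_1 n). nra.
    + rewrite Im_plus, Eb, <- RtoC_plus, im_scal_l.
      replace (zc a / 2) with (RtoC (IZR a / 2)) by (rewrite RtoC_div; [reflexivity | lra]).
      rewrite im_RtoC. ring.
  - intros n. rewrite <- row_half_period. apply Hz.
  - refine (near_imp _ _ _ _ (upper_half_plane_near tau Ht)). intros t H.
    refine (has_sum_ext _ _ _ _ (has_sum_eis2 t H (half_period a b t))). intros n.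
    rewrite row_half_period. ring.
  - pose proof (has_sum_plus _ _ _ _ S (has_sum_scal (zc b / 2) _ _ (has_sum_eis2' tau Ht z))) as T.
    rewrite V in T. apply (has_sum_eq _ _ D) in T; [|ring].
    refine (has_sum_ext _ _ _ _ T). intros n. cbv beta. unfold z. rewrite row_half_period. ring.
Qed.

Lemma cderiv_eta_gam tau : (0 < Im tau)%R ->
  cderiv eta tau ((gam tau / 12 - eta tau ^ 2) / (2 * pii)).
Proof.
  intros Ht. eapply cderiv_eq; [now apply cderiv_eta|]. unfold gam. pose proof pii_neq. field. assumption.
Qed.

Lemma cderiv_pe_half_period a b tau : (0 < Im tau)%R -> (b = 0 \/ b = 1)%Z ->
  off_lattice tau (half_period a b tau) ->
  let v := pe tau (half_period a b tau) in
  cderiv (fun t => pe t (half_period a b t)) tau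
    ((2 * v ^ 2 - 2 * v * eta tau - gam tau / 3) / (2 * pii)).
Proof.
  intros Ht Hb Hz v. eapply cderiv_eq.
  - apply cderiv_minus; [now apply cderiv_eis2_half_period | now apply cderiv_eta_gam].
  - rewrite (eis2''_pe tau _ Ht Hz). fold v.
    assert (E : eis2 tau (half_period a b tau) = v + eta tau) by (unfold v, pe; ring).
    rewrite E. pose proof pii_neq. field. assumption.
Qed.

(** ** Behaviour near and away from the lattice *)

Lemma near_list {I} (x : C) (P : I -> C -> Prop) (L : list I) :
  (forall i, In i L -> near x (P i)) -> near x (fun y => forall i, In i L -> P i y).
Proof.
  induction L as [|a L IH]; intros H; [apply near_forall; intros y i []|].
  refine (near_imp _ _ _ _ (near_and _ _ _ (H a (or_introl eq_refl)) (IH (fun i Hi => H i (or_intror Hi))))).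
  intros y [H1 H2] i [<-|Hi]; auto.
Qed.

Lemma off_lattice_near tau z : (0 < Im tau)%R -> off_lattice tau z -> near z (off_lattice tau).
Proof.
  intros Ht Hz. set (B := (Rabs (Im z) + 1)%R).
  destruct (spread_exceptions (Im tau) B Ht) as [L [_ HL]].
  assert (N1 : near z (fun y => forall n, In n L -> qe (row tau y n) <> 1)).
  { apply (near_list z (fun n y => qe (row tau y n) <> 1)). intros n _.
    apply (ccont_near (fun y => row tau y n) z (fun v => qe v <> 1)).
    - apply ccont_plus; [apply ccont_id | apply ccont_const].
    - apply qe_neq_1_near, Hz. }
  assert (N2 : near z (fun y => (Rabs (Im y) <= B)%R)).
  { refine (near_imp _ _ _ _ (near_ball z 1 Rlt_0_1)). intros y Hy.
    pose proof (im_le_Cmod (y - z)) as I. rewrite Im_minus in I. unfold B.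
    replace (Im y) with (Im z + (Im y - Im z))%R by ring.
    eapply Rle_trans; [apply Rabs_triang|]. lra. }
  refine (near_imp _ _ _ _ (near_and _ _ _ N1 N2)). intros y [Y1 Y2] n.
  destruct (in_dec Z.eq_dec n L) as [Hn|Hn]; [now apply Y1|].
  apply qe_neq_1_Im. intros E. pose proof (row_spread tau y B Ht Y2 n) as S.
  rewrite E, Rabs_R0 in S. specialize (HL n Hn). lra.
Qed.

(** Apart from the row through 0, whose term [sq] has a double pole, the sum is holomorphic
    at 0. *)
Lemma eis2_pole_0 tau M : (0 < Im tau)%R ->
  near 0 (fun z => off_lattice tau z -> (M < Cmod (eis2 tau z))%R).
Proof.
  intros Ht.
  (* the sum over the rows that do not contain 0, holomorphic at 0 *)
  set (a := fun n : Z => if Z.eq_dec n 0 then / 2 else zc n * tau).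
  set (p := fun n : Z => if Z.eq_dec n 0 then RtoC 0 else RtoC 1).
  set (k := fun n : Z => if Z.eq_dec n 0 then - sq (/ 2) else RtoC 0).
  set (F := fun z => eis2 tau z - sq z).
  set (l := tsum (fun n => p n * sq1 (a n + p n * 0))).
  assert (Hsp : near 0 (fun t => spread (Im tau) 1 (fun n => a n + p n * t))).
  { refine (near_imp _ _ _ _ (near_ball 0 1 Rlt_0_1)). intros t H n. unfold a, p.
    destruct (Z.eq_dec n 0) as [->|N].
    - rewrite Z.abs_0, Rmult_0_r. pose proof (Rabs_pos (Im (/ 2 + RtoC 0 * t))). lra.
    - replace (zc n * tau + RtoC 1 * t) with (row tau t n) by (unfold row; ring).
      apply row_spread; [exact Ht|]. replace (t - 0) with t in H by ring.
      pose proof (im_le_Cmod t). lra. }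
  assert (Hp : forall n, (Cmod (p n) <= IZR (Z.abs n) + 1)%R).
  { intros n. pose proof (weight_ge_1 n). unfold p. destruct (Z.eq_dec n 0); rewrite ?Cmod_0, ?Cmod_1; lra. }
  assert (D : cderiv F 0 l).
  { apply (row_cderiv sq sq1 k a p F 0 l (Im tau) 1); auto.
    - apply cderiv_sq.
    - apply decay_sq1.
    - intros n. unfold a, p. destruct (Z.eq_dec n 0) as [->|N].
      + replace (/ 2 + RtoC 0 * 0) with (/ 2) by ring. rewrite qe_half. intros E. injection E. lra.
      + replace (zc n * tau + RtoC 1 * 0) with (zc n * tau) by ring. now apply qe_multiple_tau.
    - apply near_forall. intros t. unfold F.
      refine (has_sum_ext _ _ _ _ (has_sum_minus _ _ _ _ (has_sum_eis2 tau Ht t) (has_sum_at_0 (sq t)))).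
      intros n. cbv beta. unfold a, p, k. destruct (Z.eq_dec n 0) as [->|N].
      + replace (row tau t 0) with t by (unfold row; ring). replace (/ 2 + RtoC 0 * t) with (/ 2) by ring. ring.
      + replace (zc n * tau + RtoC 1 * t) with (row tau t n) by (unfold row; ring). ring.
    - apply has_sum_tsum. apply (row_summable sq1 (Im tau) 1 (fun n => a n + p n * 0) p); auto.
      + apply decay_sq1.
      + exact (near_self _ _ Hsp). }
  apply cderiv_ccont in D. destruct (D 1%R Rlt_0_1) as [d1 H1].
  destruct (sq_pole 1) as [K [HK HS]].
  set (Q := (K + Cmod (F 0) + 1 + Rabs M + 1)%R).
  assert (HQ : (1 <= Q)%R) by (unfold Q; pose proof (Cmod_ge_0 (F 0)); pose proof (Rabs_pos M); lra).
  refine (near_imp _ _ _ _ (near_and _ _ _ (ex_intro _ d1 H1) (near_ball 0 (/ (2 * Q)) _))).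
  2:{ apply Rinv_0_lt_compat. lra. }
  intros z [Z1 Z2] Hz.
  replace (z - 0) with z in Z2 by ring.
  assert (Nz : z <> 0).
  { intros E. apply (proj1 (off_lattice_iff tau z) Hz). rewrite E. apply lattice_0. }
  assert (Cz : (0 < Cmod z)%R) by now apply Cmod_gt_0.
  assert (I2 : (/ (2 * Q) <= / 2)%R) by (apply Rinv_le_contravar; lra).
  pose proof (re_le_Cmod z). pose proof (im_le_Cmod z).
  specialize (HS z Nz ltac:(lra) ltac:(lra)).
  assert (L : (Q <= Cmod (/ z ^ 2))%R).
  { rewrite Cmod_inv by (now apply Cpow_nz). rewrite Cmod_pow.
    rewrite <- (Rinv_inv Q). apply Rinv_le_contravar; [now apply pow_lt|].
    assert (Cmod z <= / Q)%R.
    { eapply Rle_trans; [left; exact Z2|]. apply Rinv_le_contravar; lra. }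
    assert (Cmod z <= 1)%R by lra. nra. }
  assert (L2 : (Cmod (/ z ^ 2) <= K + (Cmod (eis2 tau z) + (1 + Cmod (F 0))))%R).
  { replace (/ z ^ 2) with (eis2 tau z - (F z - F 0 + F 0) - (sq z - / z ^ 2)) by (unfold F at 1; ring).
    eapply Rle_trans; [apply Cmod_triangle_minus|]. rewrite Rplus_comm. apply Rplus_le_compat; [exact HS|].
    eapply Rle_trans; [apply Cmod_triangle_minus|]. apply Rplus_le_compat_l.
    eapply Rle_trans; [apply Cmod_triangle|]. apply Rplus_le_compat_r. lra. }
  unfold Q in L. pose proof (Rle_abs M). lra.
Qed.

Lemma pe_pole tau w M : (0 < Im tau)%R -> lattice tau w ->
  near w (fun z => off_lattice tau z -> (M < Cmod (pe tau z))%R).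
Proof.
  intros Ht Hw. destruct (eis2_pole_0 tau (M + Cmod (eta tau)) Ht) as [d [Hd H]].
  exists d. split; [exact Hd|]. intros z Hz Oz.
  assert (O2 : off_lattice tau (z - w)) by (apply off_lattice_shift; [now apply lattice_opp | exact Oz]).
  specialize (H (z - w)). replace (z - w - 0) with (z - w) in H by ring. specialize (H Hz O2).
  assert (E : eis2 tau (z - w) = eis2 tau z) by (apply eis2_periodic; [exact Ht | now apply lattice_opp]).
  rewrite E in H. unfold pe. pose proof (Cmod_triangle_rev (eis2 tau z) (eta tau)). lra.
Qed.

(** * Rigidity of solutions of the Weierstrass equation *)

Lemma nonincreasing (g g' : R -> R) (T : R) : (0 <= T)%R ->
  (forall t, (0 <= t <= T)%R -> is_derive g t (g' t)) ->
  (forall t, (0 <= t <= T)%R -> (g' t <= 0)%R) -> (g T <= g 0)%R.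
Proof.
  intros HT Hd Hn. destruct (MVT_gen g 0 T g') as [c [Hc E]].
  - intros x Hx. rewrite Rmin_left, Rmax_right in Hx by lra. apply Hd. lra.
  - intros x Hx. rewrite Rmin_left, Rmax_right in Hx by lra.
    apply derivable_continuous_pt. exists (g' x). apply is_derive_Reals, Hd. lra.
  - rewrite Rmin_left, Rmax_right in Hc by lra. specialize (Hn c Hc). nra.
Qed.

Lemma Re_real_derive (f : C -> C) (t : R) l :
  cderiv f (RtoC t) l -> is_derive (fun t : R => Re (f (RtoC t))) t (Re l).
Proof.
  intros H. replace l with (l * 1) by ring.
  apply (is_derive_ext (fun t : R => Re (f (0 + RtoC t * 1)))).
  { intros s. do 2 f_equal. ring. }
  apply Re_path_derive. now replace (0 + RtoC t * 1) with (RtoC t) by ring.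
Qed.

Lemma Im_real_derive (f : C -> C) (t : R) l :
  cderiv f (RtoC t) l -> is_derive (fun t : R => Im (f (RtoC t))) t (Im l).
Proof.
  intros H. assert (E : forall v : C, Im v = Re (- Ci * v)) by (intros [x y]; cbn; ring).
  rewrite E. apply (is_derive_ext (fun t : R => Re (- Ci * f (RtoC t)))); [intros; now rewrite E|].
  apply (Re_real_derive (fun z => - Ci * f z)). now apply cderiv_scal.
Qed.

(** Uniqueness for [y'' = q] with [|q| <= K |y|]: the energy [|y|^2 + |y'|^2]
    grows at most exponentially and is 0 at time 0. *)
Lemma linear_ode_zero (y v q : C -> C) (K T : R) : (0 <= K)%R -> (0 <= T)%R ->
  (forall t, (0 <= t <= T)%R -> cderiv y (RtoC t) (v (RtoC t)) /\ cderiv v (RtoC t) (q (RtoC t)) /\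
     (Cmod (q (RtoC t)) <= K * Cmod (y (RtoC t)))%R) ->
  y 0 = 0 -> v 0 = 0 -> y (RtoC T) = 0.
Proof.
  intros HK HT H Hy Hv.
  set (E := fun t : R => (Re (y (RtoC t)) * Re (y (RtoC t)) + Im (y (RtoC t)) * Im (y (RtoC t)) +
                         (Re (v (RtoC t)) * Re (v (RtoC t)) + Im (v (RtoC t)) * Im (v (RtoC t))))%R).
  set (E' := fun t : R => (2 * (Re (y (RtoC t)) * Re (v (RtoC t)) + Im (y (RtoC t)) * Im (v (RtoC t))) +
                         2 * (Re (v (RtoC t)) * Re (q (RtoC t)) + Im (v (RtoC t)) * Im (q (RtoC t))))%R).
  assert (HE : forall t, E t = (Cmod (y (RtoC t)) ^ 2 + Cmod (v (RtoC t)) ^ 2)%R).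
  { intros t. unfold E. rewrite !Cmod2_alt. ring. }
  assert (HdE : forall t, (0 <= t <= T)%R -> is_derive E t (E' t)).
  { intros t Ht. destruct (H t Ht) as [D1 [D2 _]].
    pose proof (Re_real_derive y t _ D1) as A1. pose proof (Im_real_derive y t _ D1) as A2.
    pose proof (Re_real_derive v t _ D2) as A3. pose proof (Im_real_derive v t _ D2) as A4.
    apply is_derive_Reals in A1, A2, A3, A4. apply is_derive_Reals.
    pose proof (derivable_pt_lim_plus _ _ _ _ _
      (derivable_pt_lim_plus _ _ _ _ _ (derivable_pt_lim_mult _ _ _ _ _ A1 A1) (derivable_pt_lim_mult _ _ _ _ _ A2 A2))
      (derivable_pt_lim_plus _ _ _ _ _ (derivable_pt_lim_mult _ _ _ _ _ A3 A3) (derivable_pt_lim_mult _ _ _ _ _ A4 A4))) as B.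
    match type of B with derivable_pt_lim _ _ ?x => replace (E' t) with x; [exact B|] end.
    unfold E'. ring. }
  assert (HB : forall t, (0 <= t <= T)%R -> (E' t <= (1 + K) * E t)%R).
  { intros t Ht. destruct (H t Ht) as [_ [_ B]].
    assert (CS : forall a b : C, (2 * (Re a * Re b + Im a * Im b) <= 2 * (Cmod a * Cmod b))%R).
    { intros a b. pose proof (re_le_Cmod (a * Cconj b)) as X. rewrite Cmod_mult, Cmod_conj in X.
      pose proof (Rle_abs (Re (a * Cconj b))) as X2.
      replace (Re (a * Cconj b)) with (Re a * Re b + Im a * Im b)%R in X, X2 by (destruct a, b; cbn; ring). lra. }
    rewrite HE. unfold E'.
    pose proof (CS (y (RtoC t)) (v (RtoC t))) as C1. pose proof (CS (v (RtoC t)) (q (RtoC t))) as C2.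
    pose proof (Cmod_ge_0 (y (RtoC t))) as P1. pose proof (Cmod_ge_0 (v (RtoC t))) as P2.
    set (a := Cmod (y (RtoC t))) in *. set (b := Cmod (v (RtoC t))) in *. set (d := Cmod (q (RtoC t))) in *.
    assert (F : (b * d <= b * (K * a))%R) by (apply Rmult_le_compat_l; lra).
    assert (G : (0 <= (1 + K) * ((a - b) * (a - b)))%R) by (apply Rmult_le_pos; [lra | apply Rle_0_sqr]).
    lra. }
  set (L := (1 + K)%R).
  set (g := fun t : R => (E t * exp (- (L * t)))%R).
  assert (HgT : (g T <= g 0)%R).
  { apply (nonincreasing g (fun t => E' t * exp (- (L * t)) + E t * (exp (- (L * t)) * - L))%R T HT).
    - intros t Ht. apply is_derive_Reals. apply (derivable_pt_lim_mult E (fun t => exp (- (L * t)))); [now apply is_derive_Reals, HdE|].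
      apply is_derive_Reals. auto_derive; [exact I | ring].
    - intros t Ht. specialize (HB t Ht). fold L in HB. pose proof (exp_pos (- (L * t))).
      replace (E' t * exp (- (L * t)) + E t * (exp (- (L * t)) * - L))%R
        with ((E' t - L * E t) * exp (- (L * t)))%R by ring. nra. }
  assert (E0 : E 0%R = 0%R) by (rewrite HE, Hy, Hv, Cmod_0; ring).
  unfold g in HgT. rewrite E0, Rmult_0_l in HgT.
  pose proof (exp_pos (- (L * T))) as XP.
  assert (ET : (E T <= 0)%R) by nra.
  rewrite HE in ET. apply Cmod_eq_0. pose proof (Cmod_ge_0 (y (RtoC T))). pose proof (pow2_ge_0 (Cmod (v (RtoC T)))). nra.
Qed.

Lemma bounded_on_interval (f : C -> C) (T : R) : (0 <= T)%R ->
  (forall t : R, (0 <= t <= T)%R -> ccont f (RtoC t)) ->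
  exists M, forall t : R, (0 <= t <= T)%R -> (Cmod (f (RtoC t)) <= M)%R.
Proof.
  intros HT H.
  destruct (continuity_ab_maj (fun t => Cmod (f (RtoC t))) 0 T HT) as [m [Hm _]].
  - intros t Ht eps Heps. destruct (H t Ht eps Heps) as [d [Hd Hf]].
    exists d. split; [exact Hd|]. intros s [_ Hs]. unfold dist in *. cbn in *. unfold Rdist in *.
    specialize (Hf (RtoC s)). rewrite <- RtoC_minus, Cmod_R in Hf. specialize (Hf Hs).
    pose proof (Cmod_triangle_rev (f (RtoC s)) (f (RtoC t))).
    pose proof (Cmod_triangle_rev (f (RtoC t)) (f (RtoC s))) as X. rewrite Cmod_minus_sym in X.
    apply Rabs_def1; lra.
  - exists (Cmod (f (RtoC m))). exact Hm.
Qed.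

Lemma off_lattice_segment_near tau (a b : C) (t : R) : (0 < Im tau)%R ->
  off_lattice tau (a + RtoC t * b) ->
  exists d, (0 < d)%R /\ forall s : R, (Rabs (s - t) < d)%R -> off_lattice tau (a + RtoC s * b).
Proof.
  intros Ht H. 
  assert (N : near (RtoC t) (fun s => off_lattice tau (a + s * b))).
  { apply (ccont_near (fun s => a + s * b) (RtoC t) (off_lattice tau)); [|now apply off_lattice_near].
    apply ccont_plus; [apply ccont_const|]. apply ccont_mult; [apply ccont_id | apply ccont_const]. }
  destruct N as [d [Hd N]]. exists d. split; [exact Hd|]. intros s Hs. apply N.
  now rewrite <- RtoC_minus, Cmod_R.
Qed.

(** A path ending in the lattice and another one that does not cannot carry
    proportional values of [pe] up to the end: only the first values are unbounded. *)
Lemma pole_mismatch tau (a b a' b' lam : C) (T : R) : (0 < Im tau)%R -> (0 < T)%R ->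
  lattice tau (a + RtoC T * b) -> off_lattice tau (a' + RtoC T * b') ->
  (forall t : R, (0 <= t < T)%R -> off_lattice tau (a + RtoC t * b)) ->
  (forall t : R, (0 <= t < T)%R -> pe tau (a + RtoC t * b) = lam * pe tau (a' + RtoC t * b')) -> False.
Proof.
  intros Ht HT HL HO Hreg Heq.
  set (f := fun s : C => lam * pe tau (a' + s * b')).
  assert (Cf : ccont f (RtoC T)).
  { apply ccont_mult; [apply ccont_const|].
    apply (ccont_comp (fun s => a' + s * b') (pe tau)).
    - apply ccont_plus; [apply ccont_const|]. apply ccont_mult; [apply ccont_id | apply ccont_const].
    - eapply cderiv_ccont. now apply cderiv_pe. }
  assert (Np : near (RtoC T) (fun s => off_lattice tau (a + s * b) -> (Cmod (f (RtoC T)) + 1 < Cmod (pe tau (a + s * b)))%R)).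
  { apply (ccont_near (fun s => a + s * b) (RtoC T)
      (fun z => off_lattice tau z -> (Cmod (f (RtoC T)) + 1 < Cmod (pe tau z))%R)); [|now apply pe_pole].
    apply ccont_plus; [apply ccont_const|]. apply ccont_mult; [apply ccont_id | apply ccont_const]. }
  destruct (near_and _ _ _ (Cf 1%R Rlt_0_1) Np) as [d [Hd N]].
  set (t := (T - Rmin T d / 2)%R).
  pose proof (Rmin_l T d) as M1. pose proof (Rmin_r T d) as M2.
  assert (M0 : (0 < Rmin T d)%R) by (apply Rmin_glb_lt; lra).
  assert (Hin : (0 <= t < T)%R) by (unfold t; lra).
  destruct (N (RtoC t)) as [A B].
  { rewrite <- RtoC_minus, Cmod_R. unfold t. rewrite Rabs_left; lra. }
  specialize (B (Hreg t Hin)). rewrite (Heq t Hin) in B. fold (f (RtoC t)) in B.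
  pose proof (Cmod_triangle_rev (f (RtoC t)) (f (RtoC T))). lra.
Qed.

(** Two solutions of [y'' = 6 y^2 - gam/2] with the same initial values coincide
    as long as both are regular, hence reach their first pole together.  The
    second solution is a rescaled translate of the first, with scaling compatible
    with the equation. *)
Lemma pole_transfer tau (a a' b lam mu : C) : (0 < Im tau)%R ->
  mu ^ 2 = lam -> lam <> 0 -> lam ^ 2 * gam tau = gam tau ->
  off_lattice tau a' ->
  pe tau a = lam * pe tau a' -> eis2' tau a = lam * mu * eis2' tau a' ->
  (forall t : R, (0 <= t < 1)%R -> off_lattice tau (a + RtoC t * b)) ->
  lattice tau (a + b) -> lattice tau (a' + mu * b).
Proof.
  intros Ht Hmu Hlam Hgam Oa' V0 V1 Hreg Hend.
  set (b' := mu * b).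
  set (reg := fun t : R => off_lattice tau (a + RtoC t * b) /\ off_lattice tau (a' + RtoC t * b')).
  set (U := fun t : R => (0 <= t <= 1)%R /\ forall s : R, (0 <= s <= t)%R -> reg s).
  assert (R0 : reg 0%R).
  { split; [apply Hreg; lra|]. now replace (a' + RtoC 0 * b') with a' by ring. }
  assert (U0 : U 0%R).
  { split; [lra|]. intros s Hs. now replace s with 0%R by lra. }
  destruct (completeness U) as [T [T1 T2]].
  { exists 1%R. intros t [H _]. lra. }
  { now exists 0%R. }
  assert (T01 : (0 <= T <= 1)%R).
  { split; [now apply T1|]. apply T2. intros t [H _]. lra. }
  assert (Hbelow : forall s, (0 <= s < T)%R -> reg s).
  { intros s Hs. apply NNPP. intros N. assert (T <= s)%R; [|lra].
    apply T2. intros t [Ht1 Ht2]. apply Rnot_lt_le. intros L. apply N, Ht2. lra. }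
  (* the difference satisfies [y'' = 6 b^2 (f + h) y], with a bounded coefficient *)
  assert (Heq : forall t : R, (0 <= t < T)%R -> pe tau (a + RtoC t * b) = lam * pe tau (a' + RtoC t * b')).
  { intros t Hin.
    set (f := fun s : C => pe tau (a + b * s)). set (h := fun s : C => lam * pe tau (a' + b' * s)).
    assert (Hr : forall s : R, (0 <= s <= t)%R -> off_lattice tau (a + b * RtoC s) /\ off_lattice tau (a' + b' * RtoC s)).
    { intros s Hs. rewrite (Cmult_comm b), (Cmult_comm b'). apply Hbelow. lra. }
    destruct (bounded_on_interval (fun s => 6 * b ^ 2 * (f s + h s)) t) as [M HM]; [lra| |].
    { intros s Hs. destruct (Hr s Hs) as [O1 O2].
      apply ccont_mult; [apply ccont_const|]. apply ccont_plus.
      - eapply cderiv_ccont. apply (cderiv_comp_affine (pe tau)). now apply cderiv_pe.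
      - apply ccont_mult; [apply ccont_const|].
        eapply cderiv_ccont. apply (cderiv_comp_affine (pe tau)). now apply cderiv_pe. }
    assert (Z : f (RtoC t) - h (RtoC t) = 0).
    { apply (linear_ode_zero (fun s => f s - h s) (fun s => b * eis2' tau (a + b * s) - lam * (b' * eis2' tau (a' + b' * s)))
              (fun s => b * (b * eis2'' tau (a + b * s)) - lam * (b' * (b' * eis2'' tau (a' + b' * s)))) (Rmax M 0) t).
      - apply Rmax_r.
      - lra.
      - intros s Hs. destruct (Hr s Hs) as [O1 O2]. repeat split.
        + apply cderiv_minus.
          * apply (cderiv_comp_affine (pe tau)). now apply cderiv_pe.
          * apply cderiv_scal, (cderiv_comp_affine (pe tau)). now apply cderiv_pe.
        + apply cderiv_minus.
          * apply cderiv_scal, (cderiv_comp_affine (eis2' tau)). now apply cderiv_eis2'.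
          * apply cderiv_scal, cderiv_scal, (cderiv_comp_affine (eis2' tau)). now apply cderiv_eis2'.
        + rewrite !eis2''_pe by auto.
          replace (b * (b * (6 * pe tau (a + b * RtoC s) ^ 2 - gam tau / 2)) -
                   lam * (b' * (b' * (6 * pe tau (a' + b' * RtoC s) ^ 2 - gam tau / 2))))
            with (6 * b ^ 2 * (f (RtoC s) + h (RtoC s)) * (f (RtoC s) - h (RtoC s))).
          * rewrite Cmod_mult. apply Rmult_le_compat_r; [apply Cmod_ge_0|].
            eapply Rle_trans; [apply (HM s Hs) | apply Rmax_l].
          * unfold f, h. set (P := pe tau (a + b * RtoC s)). set (P' := pe tau (a' + b' * RtoC s)).
            transitivity (b ^ 2 * (6 * P ^ 2 - gam tau / 2) - (b ^ 2 * (6 * lam ^ 2 * P' ^ 2) - b ^ 2 * (gam tau / 2))); [ring|].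
            rewrite <- Hgam at 2. unfold b'. rewrite <- Hmu. field.
      - unfold f, h. rewrite !Cmult_0_r, !Cplus_0_r, V0. ring.
      - rewrite !Cmult_0_r, !Cplus_0_r, V1. unfold b'. ring. }
    apply Ceq_minus in Z. unfold f, h in Z.
    now rewrite (Cmult_comm b), (Cmult_comm b') in Z. }
  destruct (classic (lattice tau (a + RtoC T * b))) as [A|A];
    destruct (classic (lattice tau (a' + RtoC T * b'))) as [A'|A'].
  - assert (T = 1%R) as ->.
    { apply NNPP. intros N. apply (proj1 (off_lattice_iff tau _) (Hreg T ltac:(lra))), A. }
    replace (a' + b') with (a' + RtoC 1 * b') by ring. exact A'.
  - exfalso. apply off_lattice_iff in A'.
    assert (T0 : T <> 0%R).
    { intros ->. now apply (proj1 (off_lattice_iff tau _) (proj1 R0)). }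
    apply (pole_mismatch tau a b a' b' lam T Ht); auto; [lra|].
    intros t Hin. now apply Hbelow.
  - exfalso. apply off_lattice_iff in A.
    assert (T0 : T <> 0%R).
    { intros ->. now apply (proj1 (off_lattice_iff tau _) (proj2 R0)). }
    apply (pole_mismatch tau a' b' a b (/ lam) T Ht); auto; [lra| |].
    + intros t Hin. now apply Hbelow.
    + intros t Hin. rewrite (Heq t Hin). field. exact Hlam.
  - exfalso. apply off_lattice_iff in A, A'.
    destruct (off_lattice_segment_near tau a b T Ht A) as [d [Hd D]].
    destruct (off_lattice_segment_near tau a' b' T Ht A') as [d' [Hd' D']].
    destruct (Req_dec T 1) as [E|N].
    + subst T. apply (proj1 (off_lattice_iff tau _) A). now replace (a + RtoC 1 * b) with (a + b) by ring.
    + set (e := Rmin (Rmin d d' / 2) (1 - T)).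
      assert (He : (0 < e)%R) by (repeat apply Rmin_glb_lt; try lra; apply Rdiv_lt_0_compat; [apply Rmin_glb_lt|]; lra).
      assert (E1 : (e <= Rmin d d' / 2)%R) by apply Rmin_l. assert (E2 : (e <= 1 - T)%R) by apply Rmin_r.
      pose proof (Rmin_l d d'). pose proof (Rmin_r d d').
      assert (UT : U (T + e)%R).
      { split; [lra|]. intros s Hs. destruct (Rlt_or_le s T) as [L|L]; [apply Hbelow; lra|].
        split; [apply D | apply D']; rewrite Rabs_pos_eq; lra. }
      apply T1 in UT. lra.
Qed.

(** * The half-period values *)

Lemma half_period_off a b tau : (0 < Im tau)%R -> (Z.odd a = true \/ Z.odd b = true) ->
  off_lattice tau (half_period a b tau).
Proof. intros Ht H. now apply half_period_off_lattice. Qed.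

Lemma eis2'_at_half_period a b tau : (0 < Im tau)%R -> (Z.odd a = true \/ Z.odd b = true) ->
  eis2' tau (half_period a b tau) = 0.
Proof.
  intros Ht H. apply eis2'_half_period; [exact Ht | now exists a, b | now apply half_period_off].
Qed.

Lemma ratio_not_integer (t : R) : (0 < t < 1)%R -> forall m : Z, t <> IZR m.
Proof. intros [H1 H2] m ->. apply lt_IZR in H1, H2. lia. Qed.

(** Two equal half-period values would, by rigidity along the segment from the
    first half period to 0, make their difference a period. *)
Lemma half_period_values_distinct a b a' b' tau : (0 < Im tau)%R ->
  (a = 0 \/ a = 1)%Z -> (b = 0 \/ b = 1)%Z -> (a + b <> 0)%Z ->
  (Z.odd a' = true \/ Z.odd b' = true) -> (Z.odd (a' - a) = true \/ Z.odd (b' - b) = true) ->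
  pe tau (half_period a b tau) <> pe tau (half_period a' b' tau).
Proof.
  intros Ht Ha Hb Hab Ho' Hd E.
  assert (Ho : Z.odd a = true \/ Z.odd b = true) by (destruct Ha as [-> | ->], Hb as [-> | ->]; auto; lia).
  apply (proj1 (off_lattice_iff tau _) (half_period_off (a' - a) (b' - b) tau Ht Hd)).
  replace (half_period (a' - a) (b' - b) tau) with (half_period a' b' tau + 1 * (- half_period a b tau))
    by (unfold half_period; rewrite !minus_IZR, !RtoC_minus; field).
  apply (pole_transfer tau (half_period a b tau) _ _ 1 1 Ht).
  - ring.
  - cnum.
  - ring.
  - now apply half_period_off.
  - rewrite E. ring.
  - rewrite !eis2'_at_half_period by auto. ring.
  - intros t Hin. apply off_lattice_iff. intros L.
    replace (half_period a b tau + RtoC t * (- half_period a b tau))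
      with (RtoC ((1 - t) * IZR a / 2) + RtoC ((1 - t) * IZR b / 2) * tau) in L
      by (unfold half_period; rewrite !RtoC_div, !RtoC_mult, RtoC_minus by lra; field).
    apply (lattice_coordinates tau Ht) in L. destruct L as [m [n [Em En]]].
    destruct Ho as [Ho|Ho].
    + destruct Ha as [-> | ->]; [discriminate|]. apply (ratio_not_integer ((1 - t) * 1 / 2)) in Em; [exact Em | lra].
    + destruct Hb as [-> | ->]; [discriminate|]. apply (ratio_not_integer ((1 - t) * 1 / 2)) in En; [exact En | lra].
  - replace (half_period a b tau + - half_period a b tau) with (RtoC 0) by ring. apply lattice_0.
Qed.

(** [4 y^3 - gam y - y'^2] is a first integral of the equation, and [y'] vanishes at half periods. *)
Lemma half_period_value_cubic tau : (0 < Im tau)%R -> exists g3, forall a b,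
  (Z.odd a = true \/ Z.odd b = true) ->
  4 * pe tau (half_period a b tau) ^ 3 - gam tau * pe tau (half_period a b tau) = g3.
Proof.
  intros Ht.
  set (Q := fun z => 4 * (pe tau z * (pe tau z * pe tau z)) - gam tau * pe tau z - eis2' tau z * eis2' tau z).
  assert (HQ : forall z, off_lattice tau z -> cderiv Q z 0).
  { intros z Hz. pose proof (cderiv_pe tau z Ht Hz) as D. pose proof (cderiv_eis2' tau Ht z Hz) as D'.
    eapply cderiv_eq.
    - apply cderiv_minus; [apply cderiv_minus|].
      + apply cderiv_scal, cderiv_mult; [exact D|]. apply cderiv_mult; exact D.
      + apply cderiv_scal, D.
      + apply cderiv_mult; exact D'.
    - cbv beta. rewrite (eis2''_pe tau z Ht Hz). field. }
  exists (Q ((1 + tau) / 2)). intros a b Hab.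
  rewrite <- (constant_off_lattice tau Ht Q HQ _ (half_period_off a b tau Ht Hab)).
  unfold Q. rewrite eis2'_at_half_period by auto. ring.
Qed.

Lemma Cmult_integral (x y : C) : x * y = 0 -> x = 0 \/ y = 0.
Proof.
  intros H. destruct (Ceq_dec x 0) as [E|N]; [now left|right].
  replace y with (/ x * (x * y)) by (field; exact N). rewrite H. ring.
Qed.

Lemma Cmult_cancel (x y : C) : x * y = 0 -> x <> 0 -> y = 0.
Proof. intros H N. destruct (Cmult_integral x y H); [contradiction | assumption]. Qed.

Definition half_value (k : nat) (tau : C) : C :=
  match k with
  | 1%nat => pe tau (half_period 1 0 tau)
  | 2%nat => pe tau (half_period 0 1 tau)
  | _ => pe tau (half_period 1 1 tau)
  end.

Lemma e_half_value k tau : (0 < Im tau)%R -> e k tau = half_value k tau.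
Proof.
  intros Ht. unfold e. 
  assert (H : forall a b, (Z.odd a = true \/ Z.odd b = true) -> wp (half_period a b tau) tau = pe tau (half_period a b tau)).
  { intros a b Hab. apply wp_eis2; [exact Ht | now apply half_period_off]. }
  destruct k as [|[|[|k]]]; cbn [omega half_value]; rewrite <- H by (cbn; auto); f_equal; unfold half_period; field.
Qed.

Lemma half_value_distinct tau : (0 < Im tau)%R ->
  half_value 1 tau <> half_value 2 tau /\ half_value 1 tau <> half_value 3 tau /\ half_value 2 tau <> half_value 3 tau.
Proof.
  intros Ht. cbn [half_value].
  repeat split; apply half_period_values_distinct; auto; lia.
Qed.

(** Vieta's formulas for the three distinct roots of the cubic. *)
Lemma half_value_sum_gam tau : (0 < Im tau)%R ->
  half_value 1 tau + half_value 2 tau + half_value 3 tau = 0 /\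
  gam tau = - 4 * (half_value 1 tau * half_value 2 tau + half_value 1 tau * half_value 3 tau + half_value 2 tau * half_value 3 tau).
Proof.
  intros Ht. destruct (half_value_distinct tau Ht) as [D12 [D13 D23]].
  destruct (half_period_value_cubic tau Ht) as [g3 H].
  assert (H1 := H 1%Z 0%Z (or_introl eq_refl)). assert (H2 := H 0%Z 1%Z (or_intror eq_refl)).
  assert (H3 := H 1%Z 1%Z (or_introl eq_refl)).
  change (pe tau (half_period 1 0 tau)) with (half_value 1 tau) in H1.
  change (pe tau (half_period 0 1 tau)) with (half_value 2 tau) in H2.
  change (pe tau (half_period 1 1 tau)) with (half_value 3 tau) in H3.
  set (x := half_value 1 tau) in *. set (y := half_value 2 tau) in *. set (z := half_value 3 tau) in *. set (g := gam tau) in *.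
  clearbody x y z g.
  assert (A : 4 * (x ^ 2 + x * y + y ^ 2) - g = 0).
  { apply (Cmult_cancel (x - y)); [|now apply Cminus_eq_contra].
    transitivity ((4 * x ^ 3 - g * x) - (4 * y ^ 3 - g * y)); [ring|]. rewrite H1, H2. ring. }
  assert (B : 4 * (x ^ 2 + x * z + z ^ 2) - g = 0).
  { apply (Cmult_cancel (x - z)); [|now apply Cminus_eq_contra].
    transitivity ((4 * x ^ 3 - g * x) - (4 * z ^ 3 - g * z)); [ring|]. rewrite H1, H3. ring. }
  assert (S : x + y + z = 0).
  { apply (Cmult_cancel (4 * (y - z))).
    - transitivity ((4 * (x ^ 2 + x * y + y ^ 2) - g) - (4 * (x ^ 2 + x * z + z ^ 2) - g)); [ring|].
      rewrite A, B. ring.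
    - apply Cmult_neq_0; [cnum | now apply Cminus_eq_contra]. }
  split; [exact S|].
  assert (Z : z = - (x + y)) by (replace z with (x + y + z - (x + y)) by ring; rewrite S; ring).
  subst z. replace g with (4 * (x ^ 2 + x * y + y ^ 2) - (4 * (x ^ 2 + x * y + y ^ 2) - g)) by ring.
  rewrite A. ring.
Qed.

Lemma g2_gam tau : (0 < Im tau)%R -> g2 tau = gam tau.
Proof.
  intros Ht. unfold g2. rewrite !e_half_value by exact Ht. now destruct (half_value_sum_gam tau Ht) as [_ ->].
Qed.

(** * The zeros of g2 *)

Lemma rho_square : rho * rho = rho - 1.
Proof.
  unfold rho. rewrite cos_PI3, sin_PI3. apply C_eq; unfold Cmult, Cminus, Cplus, Copp, RtoC; cbn;
    pose proof (sqrt_sqrt 3 ltac:(lra)); lra.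
Qed.

Lemma Re_rho : Re rho = (1 / 2)%R.
Proof. unfold rho. cbn. apply cos_PI3. Qed.

Lemma Im_rho : Im rho = (sqrt 3 / 2)%R.
Proof. unfold rho. cbn. apply sin_PI3. Qed.

Lemma Im_rho_pos : (0 < Im rho)%R.
Proof. rewrite Im_rho. pose proof (sqrt_lt_R0 3 ltac:(lra)). lra. Qed.

Lemma Cmod_rho_combination (x y : R) :
  (Cmod (RtoC x + RtoC y * rho) ^ 2 = x * x + x * y + y * y)%R.
Proof.
  rewrite Cmod2_alt, re_plus, Im_plus, re_RtoC, im_RtoC, re_scal_l, im_scal_l, Re_rho, Im_rho.
  pose proof (sqrt_sqrt 3 ltac:(lra)). nra.
Qed.

(** ** A lattice stable under [rho] is similar to Z[rho] *)

Lemma least_positive_value {I : Type} (P : I -> Prop) (f : I -> Z) :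
  (exists i, P i) -> (forall i, P i -> (0 <= f i)%Z) -> exists i, P i /\ forall j, P j -> (f i <= f j)%Z.
Proof.
  intros [i0 Hi0] Hpos.
  assert (H : forall N : nat, forall i, P i -> (f i <= Z.of_nat N)%Z -> exists i, P i /\ forall j, P j -> (f i <= f j)%Z).
  { induction N as [|N IH]; intros i Hi Hf.
    - exists i. split; [exact Hi|]. intros j Hj. specialize (Hpos j Hj). lia.
    - destruct (classic (exists j, P j /\ (f j <= Z.of_nat N)%Z)) as [[j [Hj Hfj]]|Hn].
      + now apply (IH j).
      + exists i. split; [exact Hi|]. intros j Hj. apply Z.nlt_ge. intros L. apply Hn.
        exists j. split; [exact Hj | lia]. }
  apply (H (Z.to_nat (f i0)) i0 Hi0). lia.
Qed.

Lemma nearest_integer (x : R) : exists k : Z, (Rabs (x - IZR k) <= / 2)%R.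
Proof.
  destruct (archimed (x - / 2)) as [A B]. exists (up (x - / 2)). apply Rabs_le. lra.
Qed.

Section Rho_lattice.
Variable tau : C.
Hypothesis Htau : (0 < Im tau)%R.
Variables p r q s : Z.
Hypothesis Hrho1 : rho = zc p + zc r * tau.
Hypothesis Hrho2 : rho * tau = zc q + zc s * tau.

Lemma rho_lattice w : lattice tau w -> lattice tau (rho * w).
Proof.
  intros [m [n ->]]. replace (rho * (zc m + zc n * tau)) with (zc m * rho + zc n * (rho * tau)) by ring.
  rewrite Hrho2, Hrho1. exists (m * p + n * q)%Z, (m * r + n * s)%Z.
  rewrite !plus_IZR, !mult_IZR, !RtoC_plus, !RtoC_mult. ring.
Qed.

Lemma zc_lattice k w : lattice tau w -> lattice tau (zc k * w).
Proof.
  intros [m [n ->]]. exists (k * m)%Z, (k * n)%Z. rewrite !mult_IZR, !RtoC_mult. ring.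
Qed.

Lemma r_neq_0 : r <> 0%Z.
Proof.
  intros E. pose proof Im_rho_pos as H. rewrite Hrho1, E, Im_plus, im_RtoC, Im_scal in H. lra.
Qed.

(** Scaled by [r^2], the squared length is an integer, so that there is a
    shortest vector. *)
Lemma shortest_vector : exists w0, lattice tau w0 /\ w0 <> 0 /\
  forall w, lattice tau w -> w <> 0 -> (Cmod w0 <= Cmod w)%R.
Proof.
  set (f := fun x : Z * Z => let A := (r * fst x - snd x * p)%Z in (A * A + A * snd x + snd x * snd x)%Z).
  assert (Hf : forall m n, IZR (f (m, n)) = (IZR r ^ 2 * Cmod (zc m + zc n * tau) ^ 2)%R).
  { intros m n. unfold f. cbn [fst snd]. rewrite !plus_IZR, !mult_IZR.
    rewrite <- Cmod_rho_combination. rewrite <- (pow2_abs (IZR r)), <- Cmod_R, <- Rpow_mult_distr, <- Cmod_mult.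
    do 2 f_equal. rewrite Hrho1, minus_IZR, !mult_IZR, RtoC_minus, !RtoC_mult. ring. }
  assert (Hr : (0 < IZR r ^ 2)%R) by (apply pow2_gt_0, not_0_IZR, r_neq_0).
  destruct (least_positive_value (fun x : Z * Z => zc (fst x) + zc (snd x) * tau <> 0) f) as [[m n] [H1 H2]].
  - exists (1%Z, 0%Z). cbn [fst snd]. replace (RtoC 1 + RtoC 0 * tau) with (RtoC 1) by ring. apply C1_nz.
  - intros [m n] _. apply le_IZR. rewrite Hf. apply Rmult_le_pos; [lra | apply pow2_ge_0].
  - exists (zc m + zc n * tau). split; [now exists m, n|]. split; [exact H1|].
    intros w [m' [n' ->]] Hw. specialize (H2 (m', n') Hw). apply IZR_le in H2. rewrite !Hf in H2.
    apply Rmult_le_reg_l in H2; [|exact Hr].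
    apply Rsqr_incr_0_var; [|apply Cmod_ge_0]. unfold Rsqr. lra.
Qed.

(** Division with remainder in Z[rho]: rounding coordinates leaves a remainder of norm at
    most 3/4 of the norm of [w0]. *)
Lemma shortest_vector_generates w0 : lattice tau w0 -> w0 <> 0 ->
  (forall w, lattice tau w -> w <> 0 -> (Cmod w0 <= Cmod w)%R) ->
  forall v, lattice tau v -> exists k l : Z, v = (zc k + zc l * rho) * w0.
Proof.
  intros L0 N0 Hmin v Hv.
  destruct (coordinates rho Im_rho_pos (v / w0)) as [x [y E]].
  destruct (nearest_integer x) as [k Hk]. destruct (nearest_integer y) as [l Hl].
  exists k, l. apply Ceq_minus. apply NNPP. intros N.
  set (v' := v - (zc k + zc l * rho) * w0) in *.
  assert (Lv : lattice tau v').
  { apply lattice_minus; [exact Hv|].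
    replace ((zc k + zc l * rho) * w0) with (zc k * w0 + zc l * (rho * w0)) by ring.
    apply lattice_plus; apply zc_lattice; [exact L0 | now apply rho_lattice]. }
  specialize (Hmin v' Lv N).
  assert (Ev : v' = (RtoC (x - IZR k) + RtoC (y - IZR l) * rho) * w0).
  { unfold v'. rewrite !RtoC_minus. replace v with (v / w0 * w0) by (field; exact N0). rewrite E. ring. }
  rewrite Ev, Cmod_mult in Hmin.
  pose proof (Cmod_rho_combination (x - IZR k) (y - IZR l)) as Nf.
  set (d := Cmod (RtoC (x - IZR k) + RtoC (y - IZR l) * rho)) in *.
  set (a := (x - IZR k)%R) in *. set (b := (y - IZR l)%R) in *.
  apply Rabs_le_between in Hk, Hl.
  assert (D : (d ^ 2 < 1)%R) by (rewrite Nf; nra).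
  assert (D0 : (0 <= d)%R) by apply Cmod_ge_0.
  assert (W : (0 < Cmod w0)%R) by now apply Cmod_gt_0.
  assert (d < 1)%R by nra. nra.
Qed.

Lemma rho_stable_frak_S : frak_S tau.
Proof.
  destruct shortest_vector as [w0 [L0 [N0 Hmin]]].
  pose proof (shortest_vector_generates w0 L0 N0 Hmin) as G.
  destruct (G tau (lattice_tau tau)) as [b [a Ea]].
  destruct (G 1 (lattice_1 tau)) as [d [c Ec]].
  set (u := zc c * rho + zc d). set (v := zc a * rho + zc b).
  assert (Hu : u * w0 = 1) by (unfold u; rewrite Ec; ring).
  assert (Hv : v * w0 = tau) by (unfold v; rewrite Ea; ring).
  assert (Nu : u <> 0) by (intros E; rewrite E in Hu; apply C1_nz; rewrite <- Hu; ring).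
  assert (Et : tau = v / u).
  { rewrite <- Hv. replace w0 with (/ u * (u * w0)) by (field; exact Nu). rewrite Hu. field. exact Nu. }
  exists a, b, c, d. split; [|exact Et].
  (* Im tau |u|^2 = (ad - bc) Im rho *)
  assert (Pos : (0 < a * d - b * c)%Z).
  { apply lt_IZR. rewrite minus_IZR, !mult_IZR.
    assert (I : (Im tau * Cmod u ^ 2 = (IZR a * IZR d - IZR b * IZR c) * Im rho)%R).
    { assert (E : tau * RtoC (Cmod u ^ 2) = v * Cconj u).
      { rewrite Et, Cmod2_conj. field. exact Nu. }
      rewrite <- im_scal_r, E. unfold u, v, RtoC, rho, Cconj, Cmult, Cplus. cbn. ring. }
    pose proof Im_rho_pos. assert (0 < Cmod u ^ 2)%R by (apply pow_lt; now apply Cmod_gt_0).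
    assert (0 < Im tau * Cmod u ^ 2)%R by (now apply Rmult_lt_0_compat). nra. }
  (* the coordinates of w0 and rho w0 give the inverse matrix *)
  assert (Inv : forall w x y, lattice tau w -> w = (zc y + zc x * rho) * w0 ->
     exists m n : Z, (m * c + n * a = x)%Z /\ (m * d + n * b = y)%Z).
  { intros w x y [m [n E]] Ew. exists m, n.
    assert (E2 : zc (m * d + n * b) + zc (m * c + n * a) * rho = zc y + zc x * rho).
    { rewrite !plus_IZR, !mult_IZR, !RtoC_plus, !RtoC_mult.
      transitivity ((zc m * u + zc n * v) * (w0 * u)); [rewrite (Cmult_comm w0), Hu; unfold u, v; ring|].
      transitivity ((zc m * (u * w0) + zc n * (v * w0)) * u); [ring|].
      rewrite Hu, Hv. replace (zc m * 1 + zc n * tau) with w by (rewrite E; ring). rewrite Ew.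
      transitivity ((zc y + zc x * rho) * (u * w0)); [ring|]. rewrite Hu. ring. }
    apply (lattice_point_injective rho Im_rho_pos) in E2. tauto. }
  destruct (Inv w0 0%Z 1%Z L0) as [m [n [A1 A2]]]; [ring|].
  destruct (Inv (rho * w0) 1%Z 0%Z (rho_lattice w0 L0)) as [m' [n' [B1 B2]]]; [ring|].
  assert (Det : ((a * d - b * c) * (m * n' - n * m') = 1)%Z).
  { transitivity ((m * d + n * b) * (m' * c + n' * a) - (m * c + n * a) * (m' * d + n' * b))%Z; [ring|].
    rewrite A1, A2, B1. ring. }
  apply Z.eq_mul_1 in Det. lia.
Qed.

End Rho_lattice.

Lemma frak_S_of_rho_period tau : (0 < Im tau)%R ->
  lattice tau rho -> lattice tau (rho * tau) -> frak_S tau.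
Proof.
  intros Ht [p [r E1]] [q [s E2]]. exact (rho_stable_frak_S tau Ht p r q s E1 E2).
Qed.

(** If the invariant vanishes, [mu^2 y (mu z)] solves [y'' = 6 y^2] whenever [y] does,
    and the half-period values are distinct roots of [4 x^3 = g3].  The ratio of two
    of them is a cube root of unity [lam = mu^2], so that a rescaled solution starts at
    one half period like the original one at another.  Matching their poles shows
    that [mu] and [mu tau] are periods. *)
Lemma gam_zero_frak_S tau : (0 < Im tau)%R -> gam tau = 0 -> frak_S tau.
Proof.
  intros Ht Hg. destruct (half_value_distinct tau Ht) as [D12 _].
  destruct (half_period_value_cubic tau Ht) as [g3 H].
  assert (H1 := H 1%Z 0%Z (or_introl eq_refl)). assert (H2 := H 0%Z 1%Z (or_intror eq_refl)).
  rewrite Hg in H1, H2. cbn [half_value] in D12.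
  assert (O1 : off_lattice tau (half_period 1 0 tau)) by (apply half_period_off; auto).
  assert (O2 : off_lattice tau (half_period 0 1 tau)) by (apply half_period_off; auto).
  set (x := pe tau (half_period 1 0 tau)) in *. set (y := pe tau (half_period 0 1 tau)) in *.
  assert (H3 : x ^ 3 = y ^ 3).
  { transitivity (/ 4 * (4 * x ^ 3 - 0 * x)); [field|]. rewrite H1, <- H2. field. }
  assert (Ny : y <> 0).
  { intros E. apply D12. rewrite E in *.
    assert (X3 : x * (x * x) = 0) by (transitivity (x ^ 3); [ring|]; rewrite H3; ring).
    destruct (Cmult_integral _ _ X3) as [X|X]; [exact X|].
    now destruct (Cmult_integral _ _ X). }
  set (lam := x / y).
  assert (L3 : lam * (lam * lam) = 1).
  { unfold lam. transitivity (x ^ 3 / y ^ 3); [field; exact Ny|]. rewrite H3. field. exact Ny. }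
  assert (L1 : lam - 1 <> 0).
  { apply Cminus_eq_contra. intros E. apply D12. transitivity (lam * y); [unfold lam; field; exact Ny|].
    rewrite E. ring. }
  assert (L2 : lam * lam + lam + 1 = 0).
  { apply (Cmult_cancel (lam - 1)); [|exact L1]. transitivity (lam * (lam * lam) - 1); [ring|]. rewrite L3. ring. }
  assert (L0 : lam <> 0) by (intros E; rewrite E in L3; apply C1_nz; rewrite <- L3; ring).
  set (mu := lam * lam).
  assert (M2 : mu ^ 2 = lam).
  { unfold mu. transitivity (lam * (lam * (lam * lam))); [ring|]. rewrite L3. ring. }
  assert (M1 : mu * mu + mu + 1 = 0).
  { transitivity (mu ^ 2 + mu + 1); [ring|]. rewrite M2. unfold mu. rewrite <- L2. ring. }
  assert (T : forall b, (forall t : R, (0 <= t < 1)%R -> off_lattice tau (half_period 1 0 tau + RtoC t * b)) ->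
     lattice tau (half_period 1 0 tau + b) -> lattice tau (half_period 0 1 tau + mu * b)).
  { intros b Hb Hend.
    apply (pole_transfer tau (half_period 1 0 tau) (half_period 0 1 tau) b lam mu Ht); auto.
    - rewrite Hg. ring.
    - fold x y. unfold lam. field. exact Ny.
    - rewrite !eis2'_at_half_period by auto. ring. }
  (* the poles 0, 1 and tau are reached along segments from 1/2 *)
  assert (T0 : lattice tau (half_period 0 1 tau + mu * (- (1) / 2))).
  { apply T.
    - intros t Hin. apply off_lattice_iff. intros L.
      replace (half_period 1 0 tau + RtoC t * (- (1) / 2)) with (RtoC ((1 - t) / 2) + RtoC 0 * tau) in L
        by (unfold half_period; rewrite RtoC_div, RtoC_minus by lra; field).
      apply (lattice_coordinates tau Ht) in L. destruct L as [m [n [Em _]]].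
      apply (ratio_not_integer ((1 - t) / 2)) in Em; [exact Em | lra].
    - replace (half_period 1 0 tau + - (1) / 2) with (RtoC 0) by (unfold half_period; field). apply lattice_0. }
  assert (T1 : lattice tau (half_period 0 1 tau + mu * (1 / 2))).
  { apply T.
    - intros t Hin. apply off_lattice_iff. intros L.
      replace (half_period 1 0 tau + RtoC t * (1 / 2)) with (RtoC ((1 + t) / 2) + RtoC 0 * tau) in L
        by (unfold half_period; rewrite RtoC_div, RtoC_plus by lra; field).
      apply (lattice_coordinates tau Ht) in L. destruct L as [m [n [Em _]]].
      apply (ratio_not_integer ((1 + t) / 2)) in Em; [exact Em | lra].
    - replace (half_period 1 0 tau + 1 / 2) with (RtoC 1) by (unfold half_period; field). apply lattice_1. }
  assert (T2 : lattice tau (half_period 0 1 tau + mu * (tau - 1 / 2))).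
  { apply T.
    - intros t Hin. apply off_lattice_iff. intros L.
      replace (half_period 1 0 tau + RtoC t * (tau - 1 / 2)) with (RtoC ((1 - t) / 2) + RtoC t * tau) in L
        by (unfold half_period; rewrite RtoC_div, RtoC_minus by lra; field).
      apply (lattice_coordinates tau Ht) in L. destruct L as [m [n [Em En]]].
      destruct (Req_dec t 0) as [->|N].
      + apply (ratio_not_integer ((1 - 0) / 2)) in Em; [exact Em | lra].
      + apply (ratio_not_integer t) in En; [exact En | lra].
    - replace (half_period 1 0 tau + (tau - 1 / 2)) with tau by (unfold half_period; field). apply lattice_tau. }
  assert (P1 : lattice tau mu).
  { replace mu with (half_period 0 1 tau + mu * (1 / 2) - (half_period 0 1 tau + mu * (- (1) / 2))) by field.
    now apply lattice_minus. }
  assert (Pt : lattice tau (mu * tau)).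
  { replace (mu * tau) with (half_period 0 1 tau + mu * (tau - 1 / 2) - (half_period 0 1 tau + mu * (- (1) / 2))) by field.
    now apply lattice_minus. }
  assert (F : (mu - (rho - 1)) * (mu + rho) = 0).
  { transitivity (mu * mu + mu - (rho * rho - rho)); [ring|]. rewrite rho_square, <- M1. ring. }
  destruct (Cmult_integral _ _ F) as [E|E].
  - apply frak_S_of_rho_period; [exact Ht| |].
    + replace rho with (mu + 1 - (mu - (rho - 1))) by ring. rewrite E.
      replace (mu + 1 - 0) with (mu + 1) by ring. apply lattice_plus; [exact P1 | apply lattice_1].
    + replace (rho * tau) with (mu * tau + tau - (mu - (rho - 1)) * tau) by ring. rewrite E.
      replace (mu * tau + tau - 0 * tau) with (mu * tau + tau) by ring.
      apply lattice_plus; [exact Pt | apply lattice_tau].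
  - apply frak_S_of_rho_period; [exact Ht| |].
    + replace rho with (- mu + (mu + rho)) by ring. rewrite E.
      replace (- mu + 0) with (- mu) by ring. now apply lattice_opp.
    + replace (rho * tau) with (- (mu * tau) + (mu + rho) * tau) by ring. rewrite E.
      replace (- (mu * tau) + 0 * tau) with (- (mu * tau)) by ring. now apply lattice_opp.
Qed.

(** [Z + Z tau] is similar to [Z (c rho + d) + Z (a rho + b)], which is Z[rho]; the
    coefficients are computed with the inverse matrix. *)
Lemma frak_S_rho_period tau : frak_S tau ->
  exists p r q s : Z, rho = zc p + zc r * tau /\ rho * tau = zc q + zc s * tau.
Proof.
  intros [a [b [c [d [Hdet Et]]]]].
  set (u := zc c * rho + zc d) in *. set (v := zc a * rho + zc b) in *.
  assert (Dc : zc a * zc d - zc b * zc c = 1) by (rewrite <- !RtoC_mult, <- RtoC_minus, <- !mult_IZR, <- minus_IZR, Hdet; reflexivity).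
  assert (Nu : u <> 0).
  { intros E. assert (E2 : zc d + zc c * rho = zc 0 + zc 0 * rho) by (transitivity u; [unfold u; ring | rewrite E; ring]).
    apply (lattice_point_injective rho Im_rho_pos) in E2. destruct E2 as [-> ->]. lia. }
  assert (Eu : rho * u = (zc c + zc d) * rho - zc c).
  { unfold u. transitivity (zc c * (rho * rho) + zc d * rho); [ring|]. rewrite rho_square. ring. }
  assert (Ev : rho * v = (zc a + zc b) * rho - zc a).
  { unfold v. transitivity (zc a * (rho * rho) + zc b * rho); [ring|]. rewrite rho_square. ring. }
  exists (- c * a - (c + d) * b)%Z, ((c + d) * d + c * c)%Z, (- a * a - (a + b) * b)%Z, ((a + b) * d + a * c)%Z.
  repeat rewrite ?plus_IZR, ?minus_IZR, ?mult_IZR, ?opp_IZR, ?RtoC_plus, ?RtoC_minus, ?RtoC_mult, ?RtoC_opp.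
  rewrite Et. split.
  - transitivity (rho * u / u); [field; exact Nu|]. rewrite Eu.
    transitivity ((((zc c + zc d) * rho - zc c) * (zc a * zc d - zc b * zc c)) / u); [rewrite Dc; field; exact Nu|].
    unfold v. transitivity (((- zc c * zc a - (zc c + zc d) * zc b) * u + ((zc c + zc d) * zc d + zc c * zc c) * (zc a * rho + zc b)) / u);
      [unfold u at 2; field; exact Nu | field; exact Nu].
  - transitivity (rho * v / u); [field; exact Nu|]. rewrite Ev.
    transitivity ((((zc a + zc b) * rho - zc a) * (zc a * zc d - zc b * zc c)) / u); [rewrite Dc; field; exact Nu|].
    unfold v. transitivity (((- zc a * zc a - (zc a + zc b) * zc b) * u + ((zc a + zc b) * zc d + zc a * zc c) * (zc a * rho + zc b)) / u);
      [unfold u at 2; field; exact Nu | field; exact Nu].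
Qed.

Lemma rho_neq_0 : rho <> 0.
Proof. intros E. pose proof Im_rho_pos as H. rewrite E, im_RtoC in H. lra. Qed.

(** Multiplication by [rho] permutes the lattice and scales each term of the sum by [rho^-2]. *)
Lemma pe_rho tau p r q s z : (0 < Im tau)%R ->
  rho = zc p + zc r * tau -> rho * tau = zc q + zc s * tau ->
  off_lattice tau z -> off_lattice tau (rho * z) ->
  pe tau (rho * z) = / rho ^ 2 * pe tau z.
Proof.
  intros Ht E1 E2 Hz Hrz. pose proof rho_neq_0 as Nr.
  set (h := fun x : Z * Z => (fst x * p + snd x * q, fst x * r + snd x * s)%Z).
  set (phi := fun x : Z * Z => zc (fst x) + zc (snd x) * tau).
  assert (Hh : forall x, phi (h x) = rho * phi x).
  { intros [m n]. unfold phi, h. cbn [fst snd]. rewrite !plus_IZR, !mult_IZR, !RtoC_plus, !RtoC_mult.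
    transitivity (zc m * (zc p + zc r * tau) + zc n * (zc q + zc s * tau)); [ring|]. rewrite <- E1, <- E2. ring. }
  assert (Inj : forall x x', phi x = phi x' -> x = x').
  { intros [m n] [m' n'] E. unfold phi in E. cbn [fst snd] in E.
    apply (lattice_point_injective tau Ht) in E. now destruct E as [-> ->]. }
  (* the inverse of rho is 1 - rho *)
  set (k := fun x : Z * Z => (fst x - fst (h x), snd x - snd (h x))%Z).
  assert (Hk : forall x, phi (k x) = phi x - rho * phi x).
  { intros x. rewrite <- Hh. unfold k, phi. cbn [fst snd]. rewrite !minus_IZR, !RtoC_minus. ring. }
  pose proof (has_sum_wp_term tau Ht (rho * z) Hrz) as S.
  apply (has_sum_reindex h k) in S.
  2:{ intros x. apply Inj. rewrite Hk, Hh. transitivity (rho * phi x - rho * rho * phi x); [ring|]. rewrite rho_square. ring. }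
  2:{ intros x. apply Inj. rewrite Hh, Hk. transitivity (rho * phi x - rho * rho * phi x); [ring|]. rewrite rho_square. ring. }
  pose proof (has_sum_scal (/ rho ^ 2) _ _ (has_sum_wp_term tau Ht z Hz)) as S2.
  assert (Nz : z <> 0).
  { intros E. apply (proj1 (off_lattice_iff tau z) Hz). rewrite E. apply lattice_0. }
  assert (E : eis2 tau (rho * z) - eta tau - / (rho * z) ^ 2 = / rho ^ 2 * (eis2 tau z - eta tau - / z ^ 2)).
  { apply (has_sum_unique _ _ _ S). refine (has_sum_ext _ _ _ _ S2). intros x. cbv beta.
    unfold wp_term. fold (phi (h x)) (phi x). rewrite Hh.
    destruct (Ceq_dec (phi x) 0) as [P|P]; destruct (Ceq_dec (rho * phi x) 0) as [Q|Q].
    - ring.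
    - exfalso. apply Q. rewrite P. ring.
    - exfalso. apply P. now apply (Cmult_cancel rho).
    - assert (Nw : z - phi x <> 0).
      { apply Cminus_eq_contra. intros E. apply (proj1 (off_lattice_iff tau z) Hz). rewrite E.
        now exists (fst x), (snd x). }
      replace (rho * z - rho * phi x) with (rho * (z - phi x)) by ring.
      revert Nw. generalize (z - phi x). intros w Nw. field. auto. }
  unfold pe. replace (eis2 tau (rho * z) - eta tau)
    with (eis2 tau (rho * z) - eta tau - / (rho * z) ^ 2 + / (rho * z) ^ 2) by ring.
  rewrite E. field. auto.
Qed.

(** Differentiating [pe (rho z) = rho^-2 pe z] twice and comparing with the
    equation for [pe] leaves [gam * (1 - rho^4) = 0]. *)
Lemma frak_S_gam_zero tau : (0 < Im tau)%R -> frak_S tau -> gam tau = 0.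
Proof.
  intros Ht HS. destruct (frak_S_rho_period tau HS) as [p [r [q [s [E1 E2]]]]].
  pose proof rho_neq_0 as Nr.
  assert (Off : forall z, off_lattice tau z -> off_lattice tau (rho * z)).
  { intros z Hz. apply off_lattice_iff. intros L. apply (proj1 (off_lattice_iff tau z) Hz).
    replace z with (rho * z - rho * (rho * z)).
    - apply lattice_minus; [exact L|]. exact (rho_lattice tau p r q s E1 E2 _ L).
    - transitivity (rho * z - rho * rho * z); [ring|]. rewrite rho_square. ring. }
  assert (P0 : forall z, off_lattice tau z -> pe tau (rho * z) = / rho ^ 2 * pe tau z).
  { intros z Hz. apply (pe_rho tau p r q s); auto. }
  assert (P1 : forall z, off_lattice tau z -> rho * eis2' tau (rho * z) = / rho ^ 2 * eis2' tau z).
  { intros z Hz. apply (cderiv_unique (fun z => pe tau (0 + rho * z)) z).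
    - replace (rho * z) with (0 + rho * z) by ring.
      apply (cderiv_comp_affine (pe tau)). apply cderiv_pe; [exact Ht|].
      replace (0 + rho * z) with (rho * z) by ring. now apply Off.
    - apply (cderiv_ext_near (fun z => / rho ^ 2 * pe tau z)).
      + refine (near_imp _ _ _ _ (off_lattice_near tau z Ht Hz)). intros y Hy.
        rewrite Cplus_0_l. symmetry. now apply P0.
      + apply cderiv_scal. now apply cderiv_pe. }
  set (z := half_period 1 1 tau).
  assert (Hz : off_lattice tau z) by (apply half_period_off; auto).
  assert (P2 : rho * (rho * eis2'' tau (rho * z)) = / rho ^ 2 * eis2'' tau z).
  { apply (cderiv_unique (fun z => rho * eis2' tau (0 + rho * z)) z).
    - replace (rho * z) with (0 + rho * z) by ring.
      apply cderiv_scal, (cderiv_comp_affine (eis2' tau)). apply cderiv_eis2'; [exact Ht|].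
      replace (0 + rho * z) with (rho * z) by ring. now apply Off.
    - apply (cderiv_ext_near (fun z => / rho ^ 2 * eis2' tau z)).
      + refine (near_imp _ _ _ _ (off_lattice_near tau z Ht Hz)). intros y Hy.
        rewrite Cplus_0_l. symmetry. now apply P1.
      + apply cderiv_scal. now apply cderiv_eis2'. }
  rewrite (eis2''_pe tau z Ht Hz), (eis2''_pe tau (rho * z) Ht (Off z Hz)), (P0 z Hz) in P2.
  assert (F : (1 - rho * rho * (rho * rho)) * gam tau = 0).
  { transitivity (2 * rho ^ 2 * (rho * (rho * (6 * (/ rho ^ 2 * pe tau z) ^ 2 - gam tau / 2)) - / rho ^ 2 * (6 * pe tau z ^ 2 - gam tau / 2)));
      [field; exact Nr|]. rewrite P2. ring. }
  apply (Cmult_cancel _ _ F). rewrite rho_square.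
  replace (1 - (rho - 1) * (rho - 1)) with (rho - (rho * rho - rho)) by ring. rewrite rho_square.
  intros E. pose proof Im_rho_pos as H.
  assert (E3 : rho = - (1)) by (replace rho with (rho - (rho - 1 - rho) - 1) by ring; rewrite E; ring).
  rewrite E3, Im_opp, im_RtoC in H. lra.
Qed.

Lemma g2_zero_iff tau : (0 < Im tau)%R -> (g2 tau = 0 <-> frak_S tau).
Proof.
  intros Ht. rewrite (g2_gam tau Ht). split; [now apply gam_zero_frak_S | now apply frak_S_gam_zero].
Qed.

(** * The derivatives of eta1, the half-period values and g2 *)

Lemma near_half_value_eta1 tau k : (0 < Im tau)%R ->
  near tau (fun t => e k t = half_value k t) /\ near tau (fun t => eta1 t = eta t).
Proof.
  intros Ht. split; refine (near_imp _ _ _ _ (upper_half_plane_near tau Ht)); intros t H.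
  - now apply e_half_value.
  - now apply eta1_eta.
Qed.

Definition eta1' (tau : C) : C := (g2 tau / 12 - eta1 tau ^ 2) / (2 * pii).
Definition e' (k : nat) (tau : C) : C :=
  (2 * e k tau ^ 2 - 2 * e k tau * eta1 tau - g2 tau / 3) / (2 * pii).
Definition g2' (tau : C) : C :=
  - 4 * ((e' 1 tau * e 2 tau + e 1 tau * e' 2 tau) + (e' 1 tau * e 3 tau + e 1 tau * e' 3 tau) +
         (e' 2 tau * e 3 tau + e 2 tau * e' 3 tau)).

Lemma cderiv_eta1 tau : (0 < Im tau)%R -> cderiv eta1 tau (eta1' tau).
Proof.
  intros Ht. apply (cderiv_ext_near eta).
  - refine (near_imp _ _ _ _ (proj2 (near_half_value_eta1 tau 1 Ht))). auto.
  - unfold eta1'. rewrite g2_gam, eta1_eta by exact Ht. now apply cderiv_eta_gam.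
Qed.

Lemma cderiv_e k tau : (0 < Im tau)%R -> cderiv (e k) tau (e' k tau).
Proof.
  intros Ht. apply (cderiv_ext_near (half_value k)).
  - refine (near_imp _ _ _ _ (proj1 (near_half_value_eta1 tau k Ht))). auto.
  - unfold e'. rewrite g2_gam, eta1_eta, e_half_value by exact Ht.
    destruct k as [|[|[|k]]]; cbn [half_value]; apply cderiv_pe_half_period; auto; apply half_period_off; auto.
Qed.

Lemma cderiv_g2 tau : (0 < Im tau)%R -> cderiv g2 tau (g2' tau).
Proof.
  intros Ht. unfold g2, g2'. apply cderiv_scal.
  apply cderiv_plus; [apply cderiv_plus|]; apply cderiv_mult; now apply cderiv_e.
Qed.

Lemma ccont_square f x : ccont f x -> ccont (fun y => f y ^ 2) x.
Proof.
  intros H. apply (ccont_ext (fun y => f y * f y)); [intros; ring | now apply ccont_mult].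
Qed.

Lemma ccont_e k tau : (0 < Im tau)%R -> ccont (e k) tau.
Proof. intros Ht. eapply cderiv_ccont. now apply cderiv_e. Qed.

Lemma ccont_eta1 tau : (0 < Im tau)%R -> ccont eta1 tau.
Proof. intros Ht. eapply cderiv_ccont. now apply cderiv_eta1. Qed.

Lemma ccont_g2 tau : (0 < Im tau)%R -> ccont g2 tau.
Proof. intros Ht. eapply cderiv_ccont. now apply cderiv_g2. Qed.

(* the defined functions are matched before the operations, which would unfold them *)
Ltac ccont_tac :=
  repeat match goal with
    | |- ccont (e _) _ => now apply ccont_e
    | |- ccont eta1 _ => now apply ccont_eta1
    | |- ccont g2 _ => now apply ccont_g2
    | |- ccont (fun t => _ + _) _ => apply ccont_plus
    | |- ccont (fun t => _ - _) _ => apply ccont_minus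
    | |- ccont (fun t => _ ^ 2) _ => apply ccont_square
    | |- ccont (fun t => _ * _) _ => apply ccont_mult
    | |- ccont (fun t => _) _ => apply ccont_const
    end.

Lemma ccont_e' k tau : (0 < Im tau)%R -> ccont (e' k) tau.
Proof. intros Ht. unfold e', Cdiv. ccont_tac. Qed.

Lemma ccont_eta1' tau : (0 < Im tau)%R -> ccont eta1' tau.
Proof. intros Ht. unfold eta1', Cdiv. ccont_tac. Qed.

Lemma ccont_g2' tau : (0 < Im tau)%R -> ccont g2' tau.
Proof. intros Ht. unfold g2'. ccont_tac; now apply ccont_e'. Qed.

(** * Local injectivity of quotients *)

Lemma Some_injective {A : Type} (x y : A) : Some x = Some y -> x = y.
Proof. congruence. Qed.

(** The function [tau - N / D] has derivative [W / D^2], and at a zero of [D] its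
    inverse [D / (tau D - N)] has derivative [- W / N^2], where
    [W = D^2 - N' D + N D']. *)
Lemma sub_quot_locally_injective (N D N' D' : C -> C) (x0 : C) :
  near x0 (fun x => cderiv N x (N' x) /\ cderiv D x (D' x)) ->
  ccont N' x0 -> ccont D' x0 ->
  D x0 ^ 2 - N' x0 * D x0 + N x0 * D' x0 <> 0 ->
  exists V : C -> Prop, locally (T := C_UniformSpace) x0 V /\
    forall x y, V x -> V y -> sub_quot x (N x) (D x) = sub_quot y (N y) (D y) -> x = y.
Proof.
  intros Hn CN' CD' W. destruct (near_self _ _ Hn) as [DN DD].
  pose proof (cderiv_ccont _ _ _ DN) as CN. pose proof (cderiv_ccont _ _ _ DD) as CD.
  destruct (Ceq_dec (D x0) 0) as [D0|D0].
  - assert (N0 : x0 * D x0 - N x0 <> 0).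
    { rewrite D0. intros E. apply W. rewrite D0.
      replace (N x0) with (- (x0 * 0 - N x0)) by ring. rewrite E. ring. }
    assert (CM : ccont (fun x => x * D x - N x) x0).
    { apply ccont_minus; [|exact CN]. apply ccont_mult; [apply ccont_id | exact CD]. }
    pose proof (near_neq _ x0 0 CM N0) as NM.
    destruct (injective_near (fun x => D x * / (x * D x - N x))
      (fun x => D' x * / (x * D x - N x) + D x * (- (1 * D x + x * D' x - N' x) * (/ (x * D x - N x) * / (x * D x - N x)))) x0)
      as [d [Hd HI]].
    + refine (near_imp _ _ _ _ (near_and _ _ _ Hn NM)). intros x [[A B] M].
      apply (cderiv_mult D (fun x => / (x * D x - N x))); [exact B|]. eapply cderiv_eq.
      * apply (cderiv_inv (fun x => x * D x - N x)); [exact M|].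
        apply cderiv_minus; [|exact A]. apply cderiv_mult; [apply cderiv_id | exact B].
      * cbv beta. field. exact M.
    + assert (CI : ccont (fun x => / (x * D x - N x)) x0) by now apply ccont_inv.
      repeat first [exact CI | exact CD | exact CD' | exact CN' | apply ccont_plus | apply ccont_minus
        | apply ccont_opp | apply ccont_mult | apply ccont_const | apply ccont_id].
    + intros E. apply W. rewrite D0 in *.
      set (m := x0 * 0 - N x0) in *.
      assert (ED : D' x0 = 0).
      { apply (Cmult_cancel (/ m)); [rewrite <- E; ring|]. intros E2. apply C1_nz.
        rewrite <- (Cinv_r m N0), E2. ring. }
      rewrite ED. ring.
    + exists (fun x => (Cmod (x - x0) < d)%R /\ x * D x - N x <> 0). split.
      { apply near_locally. apply near_and; [now apply near_ball | exact NM]. }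
      intros x y [X1 X2] [Y1 Y2] E. apply HI; auto. unfold sub_quot in E.
      destruct (Ceq_dec (D x) 0) as [Dx|Dx]; destruct (Ceq_dec (D y) 0) as [Dy|Dy]; try discriminate.
      * rewrite Dx, Dy. ring.
      * apply Some_injective in E.
        assert (Inv : forall t, D t <> 0 -> t * D t - N t <> 0 -> D t * / (t * D t - N t) = / (t - N t / D t)).
        { intros t T1 T2. field. auto. }
        rewrite !Inv, E by auto. reflexivity.
  - pose proof (near_neq _ x0 0 CD D0) as ND.
    destruct (injective_near (fun x => x - N x * / D x)
      (fun x => 1 - (N' x * / D x + N x * (- D' x * (/ D x * / D x)))) x0) as [d [Hd HI]].
    + refine (near_imp _ _ _ _ (near_and _ _ _ Hn ND)). intros x [[A B] M].
      apply (cderiv_minus (fun x => x) (fun x => N x * / D x)); [apply cderiv_id|].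
      apply (cderiv_mult N (fun x => / D x)); [exact A|]. eapply cderiv_eq.
      * apply (cderiv_inv D); [exact M | exact B].
      * cbv beta. field. exact M.
    + assert (CI : ccont (fun x => / D x) x0) by now apply ccont_inv.
      repeat first [exact CI | exact CD' | exact CN' | exact CN | apply ccont_plus | apply ccont_minus
        | apply ccont_opp | apply ccont_mult | apply ccont_const | apply ccont_id].
    + intros E. apply W.
      transitivity (D x0 ^ 2 * (1 - (N' x0 * / D x0 + N x0 * (- D' x0 * (/ D x0 * / D x0))))); [field; exact D0|].
      rewrite E. ring.
    + exists (fun x => (Cmod (x - x0) < d)%R /\ D x <> 0). split.
      { apply near_locally. apply near_and; [now apply near_ball | exact ND]. }
      intros x y [X1 X2] [Y1 Y2] E. apply HI; auto. unfold sub_quot in E.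
      destruct (Ceq_dec (D x) 0) as [Dx|Dx]; [contradiction|].
      destruct (Ceq_dec (D y) 0) as [Dy|Dy]; [contradiction|]. now apply Some_injective.
Qed.

(** * Square roots *)

Lemma square_root_exists (z : C) : exists w, w ^ 2 = z /\ ((0 < Re z)%R -> (0 < Re w)%R).
Proof.
  pose proof (re_le_Cmod z) as HR. pose proof (Rle_abs (Re z)) as A1. pose proof (Rle_abs (- Re z)) as A2.
  rewrite Rabs_Ropp in A2.
  set (x := sqrt ((Cmod z + Re z) / 2)). set (y := sqrt ((Cmod z - Re z) / 2)).
  assert (X2 : (x * x = (Cmod z + Re z) / 2)%R) by (apply sqrt_sqrt; lra).
  assert (Y2 : (y * y = (Cmod z - Re z) / 2)%R) by (apply sqrt_sqrt; lra).
  assert (XY : (2 * (x * y) = Rabs (Im z))%R).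
  { unfold x, y. rewrite <- sqrt_mult by lra.
    replace ((Cmod z + Re z) / 2 * ((Cmod z - Re z) / 2))%R with ((Im z / 2) * (Im z / 2))%R.
    - change ((Im z / 2) * (Im z / 2))%R with (Rsqr (Im z / 2)). rewrite sqrt_Rsqr_abs.
      unfold Rdiv. rewrite Rabs_mult, (Rabs_pos_eq (/ 2)) by lra. field.
    - pose proof (Cmod2_alt z). nra. }
  assert (P : (0 < Re z -> 0 < x)%R) by (intros H; apply sqrt_lt_R0; lra).
  destruct (Rle_or_lt 0 (Im z)) as [H|H].
  - rewrite Rabs_pos_eq in XY by lra. exists (x, y). split; [|exact P].
    apply C_eq; unfold Cpow, Cmult, RtoC; cbn; unfold Re, Im in *; lra.
  - rewrite Rabs_left in XY by lra. exists (x, (- y)%R). split; [|exact P].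
    apply C_eq; unfold Cpow, Cmult, RtoC; cbn; unfold Re, Im in *; lra.
Qed.

Definition principal_sqrt (z : C) : C :=
  the_C (fun w => w ^ 2 = z /\ (0 < Re w)%R).

Lemma principal_sqrt_spec (z : C) : (0 < Re z)%R ->
  principal_sqrt z ^ 2 = z /\ (0 < Re (principal_sqrt z))%R.
Proof.
  intros H. destruct (square_root_exists z) as [w [W1 W2]]. specialize (W2 H).
  assert (E : principal_sqrt z = w).
  { apply the_C_eq; [auto|]. intros v [V1 V2].
    assert (F : (v - w) * (v + w) = 0).
    { transitivity (v ^ 2 - w ^ 2); [ring|]. rewrite V1, W1. ring. }
    destruct (Cmult_integral _ _ F) as [G|G]; [now apply Ceq_minus|].
    assert (R : Re (v + w) = 0%R) by (rewrite G; apply re_RtoC). rewrite re_plus in R. lra. }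
  rewrite E. auto.
Qed.

Lemma Re_pos_near (z : C) : (0 < Re z)%R -> near z (fun y => (0 < Re y)%R).
Proof.
  intros H. exists (Re z). split; [exact H|]. intros y Hy.
  pose proof (re_le_Cmod (y - z)) as A. unfold Cminus in A. rewrite re_plus, Re_opp in A.
  apply Rabs_le_between in A. fold (y - z) in A. lra.
Qed.

(** [w^2 - w0^2 = (w - w0) (w + w0)], and [w + w0] stays away from 0 in the right half
    plane; this gives continuity and then the slope. *)
Lemma cderiv_principal_sqrt (z : C) : (0 < Re z)%R -> exists l, cderiv principal_sqrt z l.
Proof.
  intros H. destruct (principal_sqrt_spec z H) as [E0 R0].
  set (w := principal_sqrt z) in *.
  pose proof (Re_pos_near z H) as Nr.
  assert (Slope : forall y, (0 < Re y)%R -> principal_sqrt y + w <> 0 /\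
            principal_sqrt y - w = / (principal_sqrt y + w) * (y - z) /\ (Re w <= Cmod (principal_sqrt y + w))%R).
  { intros y Hy. destruct (principal_sqrt_spec y Hy) as [E R].
    assert (L : (Re w <= Cmod (principal_sqrt y + w))%R).
    { eapply Rle_trans; [|apply re_le_Cmod]. rewrite re_plus, Rabs_pos_eq; lra. }
    assert (N : principal_sqrt y + w <> 0) by (apply Cmod_pos_neq; lra).
    split; [exact N|]. split; [|exact L].
    transitivity (/ (principal_sqrt y + w) * (principal_sqrt y ^ 2 - w ^ 2)); [field; exact N|].
    now rewrite E, E0. }
  assert (Cw : ccont principal_sqrt z).
  { intros eps Heps.
    destruct (near_and _ _ _ Nr (near_ball z (eps * Re w) (Rmult_lt_0_compat _ _ Heps R0))) as [d [Hd Hy]].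
    exists d. split; [exact Hd|]. intros y Y. destruct (Hy y Y) as [Y1 Y2].
    destruct (Slope y Y1) as [S1 [S2 S3]]. fold w. rewrite S2, Cmod_mult, Cmod_inv by exact S1.
    apply (Rmult_lt_reg_l (Cmod (principal_sqrt y + w))); [lra|].
    rewrite <- Rmult_assoc, Rinv_r by lra. nra. }
  exists (/ (w + w)). apply (cderiv_of_slope _ _ _ (fun y => / (principal_sqrt y + w))).
  - refine (near_imp _ _ _ _ Nr). intros y Hy. apply (Slope y Hy).
  - reflexivity.
  - apply (ccont_inv (fun y => principal_sqrt y + w)).
    + apply (Slope z H).
    + apply ccont_plus; [exact Cw | apply ccont_const].
Qed.

(** On the open set where [g2 / g2 tau0] has positive real part, [g2] does not vanish, so
    that the set avoids [frak_S]. *)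
Lemma sqrt_branch_exists tau0 : upper_half_plane tau0 -> ~ frak_S tau0 ->
  exists (U : C -> Prop) (s : C -> C), open (T := C_UniformSpace) U /\ U tau0 /\
    (forall tau, U tau -> upper_half_plane tau /\ ~ frak_S tau) /\ is_sqrt_branch U s.
Proof.
  intros Ht HS. unfold upper_half_plane in *.
  set (a := g2 tau0 / 12).
  assert (Na : a <> 0).
  { intros E. apply HS, g2_zero_iff; [exact Ht|].
    transitivity (12 * a); [unfold a; field|]. rewrite E. ring. }
  destruct (square_root_exists a) as [a0 [A0 _]].
  set (f := fun tau => / (12 * a) * g2 tau).
  set (U := fun tau => (0 < Im tau)%R /\ (0 < Re (f tau))%R).
  exists U, (fun tau => a0 * principal_sqrt (f tau)).
  assert (Df : forall tau, (0 < Im tau)%R -> cderiv f tau (/ (12 * a) * g2' tau)).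
  { intros tau H. apply cderiv_scal. now apply cderiv_g2. }
  split; [|split; [|split]].
  - intros tau [H1 H2]. apply near_locally. apply near_and; [now apply upper_half_plane_near|].
    apply (ccont_near f tau (fun v => (0 < Re v)%R)); [eapply cderiv_ccont; now apply Df|].
    now apply Re_pos_near.
  - split; [exact Ht|]. unfold f. replace (/ (12 * a) * g2 tau0) with (RtoC 1); [rewrite re_RtoC; lra|].
    replace (g2 tau0) with (12 * a) by (unfold a; field). field. exact Na.
  - intros tau [H1 H2]. split; [exact H1|]. intros HS'. apply g2_zero_iff in HS'; [|exact H1].
    unfold f in H2. rewrite HS', Cmult_0_r, re_RtoC in H2. lra.
  - intros tau [H1 H2]. split.
    + destruct (cderiv_principal_sqrt (f tau) H2) as [l Hl].
      exists (a0 * (l * (/ (12 * a) * g2' tau))). apply cderiv_is_derive.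
      apply cderiv_scal. apply (cderiv_comp f principal_sqrt); [now apply Df | exact Hl].
    + destruct (principal_sqrt_spec (f tau) H2) as [E _].
      transitivity (a0 ^ 2 * principal_sqrt (f tau) ^ 2); [ring|]. rewrite E, A0. unfold f. field. exact Na.
Qed.

(** * Local injectivity of the functions phi *)

Lemma e_distinct_sum tau : (0 < Im tau)%R ->
  e 1 tau <> e 2 tau /\ e 1 tau <> e 3 tau /\ e 2 tau <> e 3 tau /\ e 3 tau = - (e 1 tau + e 2 tau).
Proof.
  intros Ht. rewrite !e_half_value by exact Ht. destruct (half_value_distinct tau Ht) as [A [B D]].
  destruct (half_value_sum_gam tau Ht) as [S _]. repeat split; auto.
  transitivity (half_value 1 tau + half_value 2 tau + half_value 3 tau - (half_value 1 tau + half_value 2 tau)); [ring|]. rewrite S. ring.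
Qed.

(** With [W] as in [sub_quot_locally_injective] and [g3 = 4 e_1 e_2 e_3] one has
    [s W = 2 s^3 + g3 / 4].  If this were 0, then [64 s^6 = g3^2], which is the
    vanishing of the discriminant [g2^3 - 27 g3^2]. *)
Lemma phi_plus_locally_one_to_one (U : C -> Prop) (s : C -> C) :
  open (T := C_UniformSpace) U ->
  (forall tau, U tau -> upper_half_plane tau /\ ~ frak_S tau) ->
  is_sqrt_branch U s -> locally_one_to_one U (phi_plus s).
Proof.
  intros HO HU Hs tau0 H0.
  assert (NU : near tau0 U) by (apply near_locally, HO, H0).
  assert (Hs0 : forall tau, U tau -> s tau <> 0).
  { intros tau Hu E. destruct (HU tau Hu) as [Ht HS]. destruct (Hs tau Hu) as [_ E2].
    apply HS, g2_zero_iff; [exact Ht|]. transitivity (12 * (g2 tau / 12)); [field|]. rewrite <- E2, E. ring. }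
  set (s' := fun tau => g2' tau * / (24 * s tau)).
  assert (Ds : forall tau, U tau -> cderiv s tau (s' tau)).
  { intros tau Hu. destruct (HU tau Hu) as [Ht _]. destruct (Hs tau Hu) as [[l Hl] _].
    change C in (type of l). apply cderiv_is_derive in Hl. eapply cderiv_eq; [exact Hl|].
    assert (E : l * s tau + s tau * l = / 12 * g2' tau).
    { apply (cderiv_unique (fun t => s t * s t) tau); [now apply cderiv_mult|].
      apply (cderiv_ext_near (fun t => / 12 * g2 t)); [|apply cderiv_scal; now apply cderiv_g2].
      assert (N : near tau U) by (apply near_locally, HO, Hu).
      refine (near_imp _ _ _ _ N). intros t T. destruct (Hs t T) as [_ E].
      transitivity (s t ^ 2); [rewrite E; field | ring]. }
    unfold s'. pose proof (Hs0 tau Hu) as N. replace (g2' tau) with (12 * (/ 12 * g2' tau)) by field.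
    rewrite <- E. field. exact N. }
  destruct (HU tau0 H0) as [Ht HS]. unfold upper_half_plane in Ht.
  destruct (sub_quot_locally_injective (fun _ => 2 * PI * Ci) (fun tau => eta1 tau + s tau)
    (fun _ => 0) (fun tau => eta1' tau + s' tau) tau0) as [V [HV HI]].
  - refine (near_imp _ _ _ _ (near_and _ _ _ NU (upper_half_plane_near tau0 Ht))).
    intros t [T1 T2]. split; [apply cderiv_const|].
    apply cderiv_plus; [now apply cderiv_eta1 | now apply Ds].
  - apply ccont_const.
  - apply ccont_plus; [now apply ccont_eta1'|].
    apply ccont_mult; [now apply ccont_g2'|].
    apply (ccont_inv (fun tau => 24 * s tau)).
    + apply Cmult_neq_0; [cnum | now apply Hs0].
    + apply ccont_mult; [apply ccont_const|]. eapply cderiv_ccont. now apply Ds.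
  - intros W. pose proof (Hs0 tau0 H0) as N0. destruct (Hs tau0 H0) as [_ E2].
    destruct (e_distinct_sum tau0 Ht) as [D12 [D13 [D23 E3]]].
    unfold s', eta1', g2', e' in W. pose proof pii_neq as Np.
    replace (2 * PI * Ci) with (2 * pii) in W by (unfold pii; ring).
    assert (G : g2 tau0 = 12 * s tau0 ^ 2) by (rewrite E2; field).
    assert (G' : g2 tau0 = 4 * (e 1 tau0 ^ 2 + e 1 tau0 * e 2 tau0 + e 2 tau0 ^ 2)).
    { unfold g2. rewrite E3. ring. }
    rewrite G in W. rewrite E3 in *. rewrite G in G'. clear E2 G.
    set (x := e 1 tau0) in *. set (y := e 2 tau0) in *. set (n := eta1 tau0) in *. set (v := s tau0) in *.
    clearbody x y n v.
    assert (K : 2 * v ^ 3 = x * y * (x + y)).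
    { set (Wt := (n + v) ^ 2 - 0 * (n + v) +
        2 * pii * ((12 * v ^ 2 / 12 - n ^ 2) / (2 * pii) +
          - 4 * (((2 * x ^ 2 - 2 * x * n - 12 * v ^ 2 / 3) / (2 * pii) * y + x * ((2 * y ^ 2 - 2 * y * n - 12 * v ^ 2 / 3) / (2 * pii)))
            + ((2 * x ^ 2 - 2 * x * n - 12 * v ^ 2 / 3) / (2 * pii) * - (x + y) + x * ((2 * (- (x + y)) ^ 2 - 2 * - (x + y) * n - 12 * v ^ 2 / 3) / (2 * pii)))
            + ((2 * y ^ 2 - 2 * y * n - 12 * v ^ 2 / 3) / (2 * pii) * - (x + y) + y * ((2 * (- (x + y)) ^ 2 - 2 * - (x + y) * n - 12 * v ^ 2 / 3) / (2 * pii))))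
          * / (24 * v))) in *.
      assert (F : v * Wt = 2 * v ^ 3 - x * y * (x + y) + n / 6 * (12 * v ^ 2 - 4 * (x ^ 2 + x * y + y ^ 2))).
      { unfold Wt. field. auto. }
      rewrite W, G' in F.
      transitivity (2 * v ^ 3 - x * y * (x + y) + n / 6 * (4 * (x ^ 2 + x * y + y ^ 2) - 4 * (x ^ 2 + x * y + y ^ 2)) + x * y * (x + y)); [ring|].
      rewrite <- F. ring. }
    assert (Disc : (x - y) * (x - y) * ((x - - (x + y)) * (x - - (x + y)) * ((y - - (x + y)) * (y - - (x + y)))) = 0).
    { (* the discriminant of the cubic with roots x, y, - (x + y), where x^2 + xy + y^2 = 3 v^2 *)
      transitivity (4 * (3 * v ^ 2) ^ 3 - 27 * (x * y * (x + y)) ^ 2).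
      - replace (3 * v ^ 2) with (x ^ 2 + x * y + y ^ 2); [ring|].
        transitivity (/ 4 * (4 * (x ^ 2 + x * y + y ^ 2))); [field|]. rewrite <- G'. field.
      - rewrite <- K. ring. }
    revert Disc. apply Cminus_eq_contra in D12, D13, D23. repeat apply Cmult_neq_0; assumption.
  - exists V. split; [exact HV|]. intros x y Vx _ Vy _. now apply HI.
Qed.

(** The negative of a branch is a branch. *)
Lemma phi_minus_locally_one_to_one (U : C -> Prop) (s : C -> C) :
  open (T := C_UniformSpace) U ->
  (forall tau, U tau -> upper_half_plane tau /\ ~ frak_S tau) ->
  is_sqrt_branch U s -> locally_one_to_one U (phi_minus s).
Proof.
  intros HO HU Hs. change (phi_minus s) with (phi_plus (fun tau => - s tau)).
  apply phi_plus_locally_one_to_one; auto.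
  intros tau Hu. destruct (Hs tau Hu) as [[l Hl] E]. split.
  - exists (- l). apply cderiv_is_derive, cderiv_opp. now apply cderiv_is_derive.
  - rewrite <- E. ring.
Qed.

(** [W] equals [- 3 (e_k - e_i) (e_k - e_j) (e_i - e_j)^2]; the term [N' D] is
    [- 2 D^2], because [D] is a multiple of the derivative of [e_k]. *)
Lemma phi_k_locally_one_to_one k : (k = 1 \/ k = 2 \/ k = 3)%nat ->
  locally_one_to_one upper_half_plane (phi_k k).
Proof.
  intros Hk tau0 Ht. unfold upper_half_plane in Ht.
  destruct (sub_quot_locally_injective (fun tau => 6 * PI * Ci * e k tau)
    (fun tau => 3 * e k tau * eta1 tau + g2 tau / 2 - 3 * e k tau ^ 2)
    (fun tau => 6 * PI * Ci * e' k tau)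
    (fun tau => 3 * (e' k tau * eta1 tau + e k tau * eta1' tau) + g2' tau * / 2 - 3 * (e' k tau * e k tau + e k tau * e' k tau)) tau0)
    as [V [HV HI]].
  - refine (near_imp _ _ _ _ (upper_half_plane_near tau0 Ht)). intros t T.
    pose proof (cderiv_e k t T) as De. pose proof (cderiv_eta1 t T) as Dn. pose proof (cderiv_g2 t T) as Dg.
    split; [now apply cderiv_scal|].
    apply (cderiv_ext (fun tau => 3 * (e k tau * eta1 tau) + / 2 * g2 tau - 3 * (e k tau * e k tau))).
    { intros y. field. }
    eapply cderiv_eq.
    + apply cderiv_minus; [apply cderiv_plus|]; apply cderiv_scal; [apply cderiv_mult | | apply cderiv_mult]; eassumption.
    + ring.
  - apply ccont_mult; [apply ccont_const | now apply ccont_e'].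
  - ccont_tac; first [now apply ccont_e' | now apply ccont_eta1' | now apply ccont_g2'].
  - intros W. destruct (e_distinct_sum tau0 Ht) as [D12 [D13 [D23 E3]]].
    unfold eta1', g2', e' in W. pose proof pii_neq as Np.
    replace (6 * PI * Ci) with (6 * pii) in W by (unfold pii; ring).
    assert (G : g2 tau0 = 4 * (e 1 tau0 ^ 2 + e 1 tau0 * e 2 tau0 + e 2 tau0 ^ 2)).
    { unfold g2. rewrite E3. ring. }
    rewrite G in W. clear G.
    assert (F : (e 1 tau0 - e 2 tau0) * ((e 1 tau0 - e 3 tau0) * (e 2 tau0 - e 3 tau0)) <> 0).
    { apply Cminus_eq_contra in D12, D13, D23. repeat apply Cmult_neq_0; assumption. }
    apply F. clear F. rewrite E3 in *.
    destruct Hk as [->|[->| ->]]; rewrite ?E3 in W;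
    set (x := e 1 tau0) in *; set (y := e 2 tau0) in *; set (n := eta1 tau0) in *; clearbody x y n.
    + apply (Cmult_cancel (- 3 * (y - - (x + y)))).
      * rewrite <- W. field. exact Np.
      * apply Cmult_neq_0; [cnum | now apply Cminus_eq_contra].
    + apply (Cmult_cancel (3 * (x - - (x + y)))).
      * rewrite <- W. field. exact Np.
      * apply Cmult_neq_0; [cnum | now apply Cminus_eq_contra].
    + apply (Cmult_cancel (- 3 * (x - y))).
      * rewrite <- W. field. exact Np.
      * apply Cmult_neq_0; [cnum | now apply Cminus_eq_contra].
  - exists V. split; [exact HV|]. intros x y Vx _ Vy _. now apply HI.
Qed.

(* H \ frak_S is covered by open sets carrying a holomorphic branch of
   sqrt (g2 / 12), and for every such branch both phi_plus and phi_minus are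
   locally one-to-one. *)
Theorem theorem1p2 :
  ((forall tau0 : C, upper_half_plane tau0 -> ~ frak_S tau0 ->
      exists (U : C -> Prop) (s : C -> C),
        open U /\ U tau0 /\
        (forall tau, U tau -> upper_half_plane tau /\ ~ frak_S tau) /\
        is_sqrt_branch U s) /\
   (forall (U : C -> Prop) (s : C -> C),
      open U ->
      (forall tau, U tau -> upper_half_plane tau /\ ~ frak_S tau) ->
      is_sqrt_branch U s ->
      locally_one_to_one U (phi_plus s) /\
      locally_one_to_one U (phi_minus s)))
  /\
  (forall k : nat, (k = 1 \/ k = 2 \/ k = 3)%nat ->
     locally_one_to_one upper_half_plane (phi_k k)).
Proof.
  split; [split|].
  - exact sqrt_branch_exists.
  - intros U s HO HU Hs. split.
    + now apply phi_plus_locally_one_to_one.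
    + now apply phi_minus_locally_one_to_one.
  - exact phi_k_locally_one_to_one.
Qed.
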